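(* Let $(p,q,r)$ be a triple of positive integers with $\frac1p+\frac1q+\frac1r<1$ which is not in the Hilbert series. Let $n=\mathrm{lcm}(2,p,q,r)$. Then there exists an integer $k$ with $\gcd(k,n)=1$ such that $$\left|\left(\frac kp,\frac kq,\frac kr\right)-\Lambda\right|\ge 1 .$$
   Context: $\Lambda\subset\mathbf{Z}^3$ is the lattice of integer triples $(a,b,c)$ with $a+b+c$ even. For $\mathbf{v}=(x,y,z)\in\mathbf{R}^3$, $|\mathbf{v}-\Lambda|=\min\{|x-a|+|y-b|+|z-c| : (a,b,c)\in\Lambda\}$ is the $\ell^1$-distance from $\mathbf{v}$ to $\Lambda$. A triple is in the Hilbert series if it is, up to reordering, one of $(2,4,6)$, $(2,6,6)$, $(3,4,4)$, $(3,6,6)$, $(2,6,10)$, $(3,10,10)$, $(5,6,6)$, $(6,10,15)$, $(4,6,12)$, $(6,9,18)$, $(14,21,42)$. *)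

(* Defs.v *)
From mathcomp Require Import all_boot all_order all_algebra.
From mathcomp Require Import boolp classical_sets reals.
From mathcomp Require Import zify lra.

Set Implicit Arguments.
Unset Strict Implicit.
Unset Printing Implicit Defensive.

Import Order.TTheory GRing.Theory Num.Theory.

Local Open Scope classical_set_scope.
Local Open Scope ring_scope.

Definition Lambda : set (int * int * int) :=
  [set w | (2 %| w.1.1 + w.1.2 + w.2)%Z].

Definition l1dist (R : realType) (v : R * R * R) (w : int * int * int) : R :=
  `|v.1.1 - w.1.1%:~R| + `|v.1.2 - w.1.2%:~R| + `|v.2 - w.2%:~R|.

(* The infimum is a minimum: see [dist_Lambda_min]. *)
Definition dist_Lambda (R : realType) (v : R * R * R) : R :=
  inf [set l1dist v w | w in Lambda].

Definition hilbert_triples : seq (seq nat) :=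
  [:: [:: 2; 4; 6]; [:: 2; 6; 6]; [:: 3; 4; 4]; [:: 3; 6; 6];
      [:: 2; 6; 10]; [:: 3; 10; 10]; [:: 5; 6; 6]; [:: 6; 10; 15];
      [:: 4; 6; 12]; [:: 6; 9; 18]; [:: 14; 21; 42]]%N.

Definition in_hilbert_series (p q r : nat) : bool :=
  has (perm_eq [:: p; q; r]) hilbert_triples.

(* Moving an integer next to [x] without changing its parity. *)
Lemma clamp_parity (R : realType) (x : R) (a : int) :
  exists b : bool, (2 %| a - (Num.floor x + b%:Z))%Z /\
    `|x - (Num.floor x + b%:Z)%:~R| <= `|x - a%:~R|.
Proof.
have /andP[] := floor_itv x; set f := Num.floor x => fx xf.
rewrite intrD in xf.
have [af|fa] := lerP a f; last first.
  have ge_fa : (f + 1)%:~R <= a%:~R :> R by rewrite ler_int; lia.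
  rewrite intrD in ge_fa.
  case: (boolP (2 %| a - f)%Z) => [da|nda].
    exists false; split; first by rewrite addr0.
    have : (f + 2)%:~R <= a%:~R :> R by rewrite ler_int; lia.
    rewrite addr0 intrD => ge2.
    by rewrite [leRHS]distrC (le_trans _ (ler_norm _)) // ler_norml; lra.
  exists true; split; first by lia.
  rewrite [leRHS]distrC (le_trans _ (ler_norm _)) // ler_norml intrD /=.
  by apply/andP; split; lra.
have le_af : a%:~R <= f%:~R :> R by rewrite ler_int.
case: (boolP (2 %| a - f)%Z) => [da|nda].
  exists false; split; first by rewrite addr0.
  by rewrite addr0 (le_trans _ (ler_norm _)) // ler_norml; lra.
exists true; split; first by lia.
have : (a + 1)%:~R <= f%:~R :> R by rewrite ler_int; lia.
rewrite !intrD => le1.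
by rewrite (le_trans _ (ler_norm _)) // ler_norml /=; apply/andP; split; lra.
Qed.

Lemma dist_Lambda_min (R : realType) (v : R * R * R) :
  (exists2 w, Lambda w & dist_Lambda v = l1dist v w) /\
  (forall w, Lambda w -> dist_Lambda v <= l1dist v w).
Proof.
case: v => -[x y] z; set v := (x, y, z).
pose c (t : bool * bool * bool) : int * int * int :=
  (Num.floor x + t.1.1%:Z, Num.floor y + t.1.2%:Z, Num.floor z + t.2%:Z).
pose P t := (2 %| (c t).1.1 + (c t).1.2 + (c t).2)%Z.
have near w : Lambda w -> exists2 t, P t & l1dist v (c t) <= l1dist v w.
  case: w => -[a b] d; rewrite /Lambda /= => Lw.
  have [i [Hi li]] := clamp_parity x a.
  have [j [Hj lj]] := clamp_parity y b.
  have [k [Hk lk]] := clamp_parity z d.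
  exists (i, j, k); first by rewrite /P /=; lia.
  by rewrite /l1dist /= !lerD.
have L0 : Lambda (0, 0, 0) by [].
have [t0 Pt0 _] := near _ L0.
case: (@arg_minP _ _ _ t0 P (fun t => l1dist v (c t)) Pt0) => t Pt tmin.
have lb w : Lambda w -> l1dist v (c t) <= l1dist v w.
  by move=> /near[u Pu]; apply: le_trans; exact: tmin.
suff -> : dist_Lambda v = l1dist v (c t) by split=> //; exists (c t).
apply/eqP; rewrite eq_le; apply/andP; split.
  by apply: ge_inf; [exists (l1dist v (c t)) => _ [w /lb + <-] | exists (c t)].
by apply: lb_le_inf; [exists (l1dist v (c t)), (c t) | move=> _ [w /lb + <-]].
Qed.

(* Main.v *)
(* Let N be the distance to the even integers.  The point (x, y, z) is at distance at least 1 from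
   the lattice as soon as 1 - N(z) lies between N(x + y) and N(x - y).  Multipliers k with 2k, 3k
   or 4k congruent to 1 modulo a large part of n, or k congruent to a small number, put the three
   coordinates close to fixed fractions; translating k by a power of 2 times the odd part of n, or
   by a multiple of n/3, then moves some of them by 1/4, 1/2 or 2/3.  Comparing the powers of 2, then
   of 3, dividing p, q and r, this settles all triples except those in which two of the numbers
   belong to a finite list of pairs.  For such a pair p, q, one translates k by multiples of
   2 lcm(p, q): if r has a large prime power not absorbed by lcm(p, q), this brings k/r into the
   required interval, and only finitely many r are left, for which k is found by computation. *)

From Stdlib Require Import BinInt Znat.
Require Import Defs.
From mathcomp Require Import all_boot all_order all_algebra.
From mathcomp Require Import reals.
From mathcomp Require Import zify ssrZ ring lra.

Set Implicit Arguments.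
Unset Strict Implicit.
Unset Printing Implicit Defensive.

Import Order.TTheory GRing.Theory Num.Theory.

Local Open Scope ring_scope.

(** * Distances to the even integers and to the lattice *)

(** Modulo [Lambda] and sign changes of the coordinates, a point is given by its three distances to
    the integers and one parity. When the distances satisfy the triangle inequalities, one of the
    two parities gives a far point ([tri_far]), so it suffices to control three distances and to be
    able to translate by an integer vector of odd sum. Let N be an odd common multiple of the odd
    parts and 2^e, e > 0, the largest power of 2. Adding 2^e N to k is such a translation when 2^e
    divides one or all three of p, q, r. When it divides exactly two, the sum is even; one adds
    2^(e-1) N instead, which moves only one of x + y and x - y by 1 relative to z. This breaks down
    at e = 1, where the step is odd and would make k even: only 3-adic translations remain, and the
    cases depend on which numbers carry the full power of 3 and on whether 9 divides N. If 3 divides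
    none of the three numbers, k near 1/3 settles the triple at once, so this last case may assume
    that 3 divides N. The finite list of pairs consists of those whose reciprocals are too large for
    the error terms. *)

Ltac keep_reals :=
  match goal with R : realType |- _ =>
    repeat match goal with H : ?T |- _ =>
      lazymatch T with
      | realType => fail
      | forall _, _ => clear H
      | context [R] => fail
      | _ => clear H
      end
    end
  end.
Tactic Notation "rlra" := try keep_reals; lra.

Section Lattice.

Context {R : realType}.

Section Circle.
Implicit Types (t u v x y z : R) (m i : int).

(** [2 * Num.floor ((t + 1) / 2)] is an even integer nearest to [t], so this is the distance N to
    the even integers. *)
Definition nrm t : R := `|t - 2 * (Num.floor ((t + 1) / 2))%:~R|.

Lemma nrmP t : exists i, nrm t = `|t - 2 * i%:~R| /\ `|t - 2 * i%:~R| <= 1.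
Proof.
exists (Num.floor ((t + 1) / 2)); split=> //.
have /andP[] := floor_itv ((t + 1) / 2); set f := Num.floor _.
rewrite intrD => f1 f2; rewrite ler_norml; rlra.
Qed.

Lemma nrm_ge0 t : 0 <= nrm t. Proof. exact: normr_ge0. Qed.

Lemma nrm_le1 t : nrm t <= 1.
Proof. by have [i [-> ]] := nrmP t. Qed.

Lemma nrmE t i : `|t - 2 * i%:~R| <= 1 -> nrm t = `|t - 2 * i%:~R|.
Proof.
have [j [-> tj]] := nrmP t => ti.
have [-> //|ij] := eqVneq i j.
have : `|(i - j)%:~R| <= 1 :> R.
  rewrite intrB; move: ti tj; rewrite !ler_norml; rlra.
rewrite -intr_norm lerz1 => ij1.
have {ij1}[E|E] : i = j + 1 \/ j = i + 1 by lia.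
  move: ti tj; rewrite E intrD /= !ler_norml => ti tj.
  rewrite [LHS]ger0_norm ?[RHS]ler0_norm; rlra.
move: ti tj; rewrite E intrD /= !ler_norml => ti tj.
rewrite [RHS]ger0_norm ?[LHS]ler0_norm; rlra.
Qed.

Lemma nrm_le t i : nrm t <= `|t - 2 * i%:~R|.
Proof.
have [/nrmE-> //|/ltW] := lerP `|t - 2 * i%:~R| 1.
exact: le_trans (nrm_le1 t).
Qed.

Lemma nrm_small t : `|t| <= 1 -> nrm t = `|t|.
Proof. by move=> t1; rewrite (@nrmE t 0) ?mulr0 ?subr0. Qed.

Lemma nrm_le_norm t : nrm t <= `|t|.
Proof. by have := nrm_le t 0; rewrite mulr0 subr0. Qed.

Lemma nrmN t : nrm (- t) = nrm t.
Proof.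
have [i [-> ti]] := nrmP t.
have E : `|- t - 2 * (- i)%:~R| = `|t - 2 * i%:~R|.
  by rewrite -normrN rmorphN /=; congr `|_|; ring.
by rewrite (@nrmE _ (- i)) E.
Qed.

Lemma nrm_even t m : (2 %| m)%Z -> nrm (t + m%:~R) = nrm t.
Proof.
move=> /dvdzP[j ->]; have [i [-> ti]] := nrmP t.
have E : t + (j * 2)%:~R - 2 * (i + j)%:~R = t - 2 * i%:~R.
  by rewrite intrM intrD; ring.
by rewrite (@nrmE _ (i + j)) E.
Qed.

Lemma nrm_add1 t : nrm (t + 1) = 1 - nrm t.
Proof.
have [i [-> ]] := nrmP t; rewrite ler_norml => ti.
have [H|H] := lerP 0 (t - 2 * i%:~R).
  have E : t + 1 - 2 * (i + 1)%:~R = t - 2 * i%:~R - 1 by rewrite intrD; ring.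
  by rewrite (@nrmE _ (i + 1)) E ler0_norm ?ger0_norm; rlra.
by rewrite (@nrmE _ i) (ger0_norm (x := _ + 1 - _)) ?ltr0_norm //; rlra.
Qed.

Lemma nrm_odd t m : ~~ (2 %| m)%Z -> nrm (t + m%:~R) = 1 - nrm t.
Proof.
move=> om; have -> : m = 1 + (m - 1) by ring.
by rewrite intrD addrA nrm_even ?nrm_add1 //; lia.
Qed.

Lemma nrm_lip t u : nrm t <= nrm u + `|t - u|.
Proof.
have [i [-> _]] := nrmP u; apply: le_trans (nrm_le t i) _.
by apply: le_trans (ler_normD _ _); rewrite le_eqVlt; apply/orP; left; apply/eqP; congr `|_|; ring.
Qed.

Lemma intr_divE (c : nat) m i : m = c%:R * i -> (0 < c)%N -> i%:~R = m%:~R / c%:R :> R.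
Proof.
move=> -> c0; have c0' : c%:R != 0 :> R by rewrite pnatr_eq0 -lt0n.
by rewrite intrM rmorph_nat mulrC mulKf.
Qed.

Lemma nrm_odd_le t m : ~~ (2 %| m)%Z -> 1 - nrm t <= `|t - m%:~R|.
Proof.
move=> om; have := nrm_odd (t - m%:~R) om; rewrite subrK => ->.
by rewrite opprB addrCA subrr addr0 nrm_le_norm.
Qed.

Lemma nrm_even_le t m : (2 %| m)%Z -> nrm t <= `|t - m%:~R|.
Proof.
by move=> em; have := nrm_even (t - m%:~R) em; rewrite subrK => ->; apply: nrm_le_norm.
Qed.

(** Distance to the nearest integer: the even ones are at distance [nrm t], the odd ones at
    [1 - nrm t]. *)
Definition dst t : R := Num.min (nrm t) (1 - nrm t).

Lemma dst_ge0 t : 0 <= dst t.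
Proof. by rewrite /dst le_min nrm_ge0 subr_ge0 nrm_le1. Qed.

Lemma dst_cases t :
  (dst t = nrm t /\ nrm t <= 1/2) \/ (dst t = 1 - nrm t /\ 1/2 <= nrm t).
Proof. by rewrite /dst; case: (lerP (nrm t) (1 - nrm t)) => ?; [left|right]; split=> //; rlra. Qed.

Lemma dst_le_half t : dst t <= 1/2.
Proof. by case: (dst_cases t) => -[-> ?]; rlra. Qed.

Lemma dst_int t m : dst (t + m%:~R) = dst t.
Proof.
rewrite /dst; case: (boolP (2 %| m)%Z) => hm; first by rewrite nrm_even.
by rewrite nrm_odd // opprB addrCA subrr addr0 minC.
Qed.

Lemma dst_le t m : dst t <= `|t - m%:~R|.
Proof.
rewrite -(subrK m%:~R t) dst_int addrK.
by apply: le_trans (nrm_le_norm _); rewrite /dst ge_min lexx.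
Qed.

Lemma dst_small t : `|t| <= 1/2 -> dst t = `|t|.
Proof.
move=> H; have E : nrm t = `|t| by apply: nrm_small; rlra.
by case: (dst_cases t) => -[-> ?]; rlra.
Qed.

Lemma dstP t : exists m, dst t = `|t - m%:~R|.
Proof.
have [i [E H]] := nrmP t; case: (dst_cases t) => -[-> _].
  by exists (2 * i); rewrite E intrM.
move: E H; rewrite ler_norml; have [H0|H0] := lerP 0 (t - 2 * i%:~R).
  rewrite (ger0_norm H0) => -> H; exists (2 * i + 1).
  by rewrite ler0_norm; rewrite intrD intrM; rlra.
rewrite (ltr0_norm H0) => -> H; exists (2 * i - 1).
by rewrite ger0_norm; rewrite intrB intrM; rlra.
Qed.

Lemma dst_half_int t m : ~~ (2 %| m)%Z -> dst (t + m%:~R / 2) = 1/2 - dst t.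
Proof.
move=> om; have [i E] : exists i, m = 2 * i + 1.
  by exists ((m - 1) %/ 2)%Z; lia.
have -> : m%:~R / 2 = 1/2 + i%:~R :> R by rewrite E intrD intrM; field.
rewrite addrA dst_int {om E m i}.
have [m E] := dstP t; have := dst_le_half t; rewrite E => H.
have {E} : dst (t - m%:~R) = `|t - m%:~R|.
  by apply: dst_small.
have -> : dst (t + 1/2) = dst (t - m%:~R + 1/2).
  by rewrite -(dst_int (t + 1/2) (- m)) rmorphN /=; congr dst; ring.
move: (t - m%:~R) H => u; rewrite ler_norml => H _.
have [H0|H0] := lerP 0 u.
  have := dst_int (u - 1/2) 1; rewrite (_ : u - 1/2 + 1%:~R = u + 1/2); last by rlra.
  by move=> ->; rewrite dst_small ler0_norm ?ger0_norm; rlra.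
by rewrite dst_small ger0_norm ?ltr0_norm; rlra.
Qed.

Lemma dst_double t : dst (2 * t) = Num.min (2 * dst t) (1 - 2 * dst t).
Proof.
have [m E] := dstP t; have := dst_le_half t; rewrite E => H.
have -> : dst (2 * t) = dst (2 * (t - m%:~R)).
  by rewrite -(dst_int _ (- (2 * m))) rmorphN /= intrM; congr dst; ring.
move: (t - m%:~R) H => u H.
have [H0|H0] := lerP (2 * `|u|) (1 - 2 * `|u|).
  rewrite dst_small; first by rewrite normrM ger0_norm.
  by rewrite normrM ger0_norm; rlra.
have := dst_half_int (2 * u - 1/2) (m := 1) isT.
rewrite (_ : 2 * u - 1/2 + 1%:~R / 2 = 2 * u); last by rewrite mulr1z subrK.
move=> ->; have [u0|u0] := lerP 0 u.
  by rewrite dst_small; move: H H0; rewrite (ger0_norm u0) => H H0; rewrite ?ler_norml ?ger0_norm; rlra.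
have := dst_int (2 * u - 1/2) 1; rewrite mulr1z => <-.
by rewrite dst_small; move: H H0; rewrite (ltr0_norm u0) => H H0; rewrite ?ler_norml ?ler0_norm; rlra.
Qed.

Definition btw u x y := (x <= u <= y) || (y <= u <= x).

Definition far x y z := forall w, Lambda w -> 1 <= l1dist (x, y, z) w.

(* The parity of the third coordinate of a lattice point decides which of
   [x + y] and [x - y] has to be used to bound the distance from below. *)
Lemma btw_far x y z : btw (1 - nrm z) (nrm (x + y)) (nrm (x - y)) -> far x y z.
Proof.
move=> H [[a b] c]; rewrite /Lambda /l1dist /= => L.
have sum_le : `|x + y - (a + b)%:~R| <= `|x - a%:~R| + `|y - b%:~R|.
  by apply: le_trans (ler_normD _ _); rewrite intrD le_eqVlt; apply/orP; left; apply/eqP; congr `|_|; ring.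
have dif_le : `|x - y - (a - b)%:~R| <= `|x - a%:~R| + `|y - b%:~R|.
  by apply: le_trans (ler_normB _ _); rewrite intrB le_eqVlt; apply/orP; left; apply/eqP; congr `|_|; ring.
case: (boolP (2 %| c)%Z) => hc.
  have h1 := nrm_even_le z hc.
  have h2 : nrm (x + y) <= `|x + y - (a + b)%:~R| by apply: nrm_even_le; lia.
  have h3 : nrm (x - y) <= `|x - y - (a - b)%:~R| by apply: nrm_even_le; lia.
  by case/orP: H => /andP[? ?]; rlra.
have h1 := nrm_odd_le z hc.
have h2 : 1 - nrm (x + y) <= `|x + y - (a + b)%:~R| by apply: nrm_odd_le; lia.
have h3 : 1 - nrm (x - y) <= `|x - y - (a - b)%:~R| by apply: nrm_odd_le; lia.
by case/orP: H => /andP[? ?]; rlra.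
Qed.

Lemma far_perm12 x y z : far x y z -> far y x z.
Proof.
move=> H [[a b] c] L; have := H (b, a, c); rewrite /l1dist /= (addrC `|x - _|); apply.
by move: L; rewrite /Lambda /=; lia.
Qed.

Lemma far_perm23 x y z : far x y z -> far x z y.
Proof.
move=> H [[a b] c] L; have := H (a, c, b); rewrite /l1dist /= addrAC; apply.
by move: L; rewrite /Lambda /=; lia.
Qed.

End Circle.

(** * Folding the coordinates: signs, integer translations and the triangle criterion *)

Section Folding.
Implicit Types (t u v x y z e : R) (m i X : int).

Lemma far_shift x y z (a b c : int) : (2 %| a + b + c)%Z ->
  far x y z -> far (x + a%:~R) (y + b%:~R) (z + c%:~R).
Proof.
move=> L H [[a' b'] c']; rewrite /Lambda /l1dist /= => L'.
have E t (n n' : int) : t + n%:~R - n'%:~R = t - (n' - n)%:~R by rewrite intrB; ring.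
by rewrite !E; apply: (H (a' - a, b' - b, c' - c)); rewrite /Lambda /=; lia.
Qed.

Lemma far_opp x y z : far x y z -> far (- x) y z.
Proof.
move=> H [[a b] c]; rewrite /Lambda /l1dist /= => L.
have -> : `|- x - a%:~R| = `|x - (- a)%:~R|.
  by rewrite -normrN rmorphN /=; congr `|_|; ring.
by apply: (H (- a, b, c)); rewrite /Lambda /=; lia.
Qed.

Lemma far_signs x y z (a b c : bool) :
  far x y z -> far ((-1) ^+ a * x) ((-1) ^+ b * y) ((-1) ^+ c * z).
Proof.
move=> H.
have H1 : far ((-1) ^+ a * x) y z.
  by case: a; rewrite ?expr1 ?mulN1r ?mul1r //; apply: far_opp.
have {H1} H2 : far ((-1) ^+ a * x) ((-1) ^+ b * y) z.
  case: b; rewrite ?expr1 ?mulN1r ?mul1r //.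
  by apply: far_perm12; apply: far_opp; apply: far_perm12.
case: c; rewrite ?expr1 ?mulN1r ?mul1r //.
apply: far_perm23; apply: far_perm12; apply: far_opp.
by apply: far_perm12; apply: far_perm23.
Qed.

Lemma dst_repr t : exists m (s : bool), t = (-1) ^+ s * dst t + m%:~R.
Proof.
have [m E] := dstP t; exists m, (t - m%:~R < 0); rewrite E; case: ltrP => H.
  by rewrite expr1 ltr0_norm // mulN1r opprK subrK.
by rewrite expr0 ger0_norm // mul1r subrK.
Qed.

Definition tri (a b c : R) := [&& a <= b + c, b <= a + c & c <= a + b].

(** Signs and translations by [Lambda] bring the point to the three distances [u], [v], [w], or to
    [u + 1], [v], [w]. The latter is far: its sum and difference have [nrm] equal to [1 - (u + v)]
    and at least [1 - |u - v|], and [1 - w] lies between. A translation by a vector of odd sum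
    exchanges the two classes. *)
Lemma tri_far x y z (a b c : int) : ~~ (2 %| a + b + c)%Z ->
  tri (dst x) (dst y) (dst z) ->
  far x y z \/ far (x + a%:~R) (y + b%:~R) (z + c%:~R).
Proof.
move=> oabc /and3P[t1 t2 t3].
have F : far (dst x + 1) (dst y) (dst z).
  have := dst_ge0 x; have := dst_ge0 y; have := dst_ge0 z.
  have := dst_le_half x; have := dst_le_half y; have := dst_le_half z.
  move: (dst x) (dst y) (dst z) t1 t2 t3 => u v w *.
  apply: btw_far; apply/orP; left.
  rewrite addrAC nrm_add1 addrAC nrm_add1.
  rewrite (@nrm_small w) ?ger0_norm //; last rlra.
  rewrite (@nrm_small (u + v)) ger0_norm; try rlra.
  have : nrm (u - v) <= `|u - v| by apply: nrm_le_norm.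
  by have [?|?] := lerP 0 (u - v); [rewrite ger0_norm | rewrite ltr0_norm] => //; rlra.
have [m1 [s1 E1]] := dst_repr x; have [m2 [s2 E2]] := dst_repr y.
have [m3 [s3 E3]] := dst_repr z.
have {}F (n1 n2 n3 : int) : ~~ (2 %| n1 + n2 + n3)%Z ->
    far ((-1) ^+ s1 * dst x + n1%:~R) ((-1) ^+ s2 * dst y + n2%:~R)
        ((-1) ^+ s3 * dst z + n3%:~R).
  move=> odd_n.
  have := far_signs s1 s2 s3 F; rewrite mulrDr mulr1.
  have -> : (-1) ^+ s1 = (if s1 then -1 else 1 : int)%:~R :> R.
    by case: s1 {E1}; rewrite ?expr1 ?expr0 ?rmorphN.
  set o : int := if s1 then _ else _.
  have /far_shift : (2 %| (n1 - o) + n2 + n3)%Z by rewrite /o; case: (s1); lia.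
  move=> H /H; rewrite intrB; congr far; ring.
case: (boolP (2 %| m1 + m2 + m3)%Z) => em; last first.
  by left; have := F _ _ _ em; rewrite -E1 -E2 -E3.
right.
have -> : x + a%:~R = (-1) ^+ s1 * dst x + (m1 + a)%:~R by rewrite intrD addrA -E1.
have -> : y + b%:~R = (-1) ^+ s2 * dst y + (m2 + b)%:~R by rewrite intrD addrA -E2.
have -> : z + c%:~R = (-1) ^+ s3 * dst z + (m3 + c)%:~R by rewrite intrD addrA -E3.
by apply: F; lia.
Qed.

Lemma dst_odd2 t e X : ~~ (2 %| X)%Z -> t = e + X%:~R / 2 -> 1/2 - `|e| <= dst t.
Proof.
move=> oX ->; rewrite dst_half_int //.
by have := dst_le e 0; rewrite subr0; rlra.
Qed.

(** Doubling reduces this to [dst_odd2]; the two terms of the minimum in [dst_double] give the two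
    bounds. *)
Lemma dst_odd4 t e X : ~~ (2 %| X)%Z -> t = e + X%:~R / 4 ->
  1/4 - `|e| <= dst t <= 1/4 + `|e|.
Proof.
move=> oX E; have /(dst_odd2 oX) : 2 * t = 2 * e + X%:~R / 2 by rewrite E; field.
rewrite dst_double normrM ger0_norm // le_min => /andP[? ?]; apply/andP; split; rlra.
Qed.

Lemma dst_odd8 t e X : ~~ (2 %| X)%Z -> t = e + X%:~R / 8 ->
  (1/8 - `|e| <= dst t <= 1/8 + `|e|) \/ (3/8 - `|e| <= dst t <= 3/8 + `|e|).
Proof.
move=> oX E; have /(dst_odd4 oX) : 2 * t = 2 * e + X%:~R / 4 by rewrite E; field.
rewrite dst_double normrM ger0_norm // le_min ge_min => /andP[/andP[? ?]].
by case/orP => ?; [left|right]; apply/andP; split; rlra.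
Qed.

End Folding.

(** * Multipliers prime to n *)

Section Units.
Implicit Types (k h m i : int) (p q r N A B C : nat).

Definition pt k p : R := k%:~R / p%:R.

Definition good p q r := exists k, [/\ coprimez k 2, coprimez k p,
  coprimez k q, coprimez k r & far (pt k p) (pt k q) (pt k r)].

Lemma good_perm12 p q r : good p q r -> good q p r.
Proof. by case=> k [? ? ? ? /far_perm12 ?]; exists k. Qed.

Lemma good_perm23 p q r : good p q r -> good p r q.
Proof. by case=> k [? ? ? ? /far_perm23 ?]; exists k. Qed.

Lemma pt_add k h p : pt (k + h) p = pt k p + pt h p.
Proof. by rewrite /pt intrD mulrDl. Qed.

(** Writes [p = 2 ^ e * N / A], so [e] is the 2-adic valuation of [p]. The odd number [N] is shared
    by the three numbers of a triple, and adding a multiple of [N] to [k] moves [k / p] by a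
    multiple of [A / 2 ^ e]. *)
Definition dec p e A N := [/\ (0 < p)%N, odd A, odd N & (p * A = 2 ^ e * N)%N].

Lemma dec_neq0 p e A N : dec p e A N -> p%:R != 0 :> R.
Proof. by case=> p0 _ _ _; rewrite pnatr_eq0 -lt0n. Qed.

(** Source of all multipliers close to fixed fractions: the term [E / (D * p)] is an error of order
    [1 / p], and the other term depends on [p] only through [A] and [e]. *)
Lemma pt_affine k (D E i : int) p e A N : dec p e A N -> D != 0 ->
  D * k = E + N%:Z * i ->
  pt k p = E%:~R / D%:~R / p%:R + (i * A%:Z)%:~R / (D%:~R * 2 ^+ e).
Proof.
move=> d D0 Ek; have p0 := dec_neq0 d; have [_ _ _ pA] := d.
have {}pA : p%:R * A%:R = 2 ^+ e * N%:R :> R by rewrite -!natrM pA natrM natrX.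
have {}Ek : D%:~R * k%:~R = E%:~R + N%:R * i%:~R :> R.
  by rewrite -[LHS]intrM Ek intrD intrM.
have {}D0 : D%:~R != 0 :> R by rewrite intr_eq0.
have e0 : 2 ^+ e != 0 :> R by rewrite expf_neq0 // pnatr_eq0.
rewrite /pt intrM -pmulrn; apply: (mulfI D0); apply: (mulfI p0); apply: (mulfI e0).
have -> : 2 ^+ e * (p%:R * (D%:~R * (k%:~R / p%:R))) = 2 ^+ e * (D%:~R * k%:~R) :> R.
  by field.
rewrite Ek; have -> : 2 ^+ e * (p%:R * (D%:~R * (E%:~R / D%:~R / p%:R +
  i%:~R * A%:R / (D%:~R * 2 ^+ e)))) = 2 ^+ e * E%:~R + i%:~R * (p%:R * A%:R) :> R.
  by field; rewrite D0 p0 e0.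
by rewrite pA; ring.
Qed.

Lemma coprimez_affine k (D E i : int) (N : nat) :
  D * k = E + N%:Z * i -> coprimez E N -> coprimez k N.
Proof.
move=> Ek /coprimezP[[u v] /= uv]; apply/coprimezP; exists (u * D, v - u * i) => /=.
by rewrite -mulrA Ek -[RHS]uv; ring.
Qed.

Definition uN k N := coprimez k 2 && coprimez k N.

Lemma coprimez2 k : coprimez k 2 = ~~ (2 %| k)%Z.
Proof. by rewrite coprimez_sym coprimezE prime_coprime // dvdzE. Qed.

Lemma uN_shift k h N : uN k N -> (2 %| h)%Z -> (N%:Z %| h)%Z -> uN (k + h) N.
Proof.
case/andP=> k2 kN h2 hN; apply/andP; split.
  by move: k2; rewrite !coprimez2; lia.
have [i E] := dvdzP hN.
apply: (@coprimez_affine _ 1 k i) => //; rewrite mul1r E; ring.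
Qed.

Lemma uN_dec k N p e A : dec p e A N -> uN k N -> coprimez k p.
Proof.
case=> _ _ _ pA /andP[k2 kN].
have : coprimez k (p * A)%N.
  rewrite pA PoszM coprimezMr kN andbT; move: k2; rewrite !coprimezE /=.
  exact: coprimeXr.
by rewrite PoszM coprimezMr => /andP[].
Qed.

End Units.

Arguments pt k p%_N.
Arguments good (p q r)%_N.
Arguments dec (p e A N)%_N.
Arguments uN k N%_N.

(** * 2-adic translations *)

Local Notation inv n := ((n%:R : R)^-1).

Section TwoAdic.
Implicit Types (t u v x y z : R) (k h m i X : int) (p q r N A B C e f : nat).

Lemma inv_bound n p : (n <= p)%N -> (0 < n)%N -> 0 < inv p <= inv n.
Proof.
move=> np n0; rewrite invr_gt0 ltr0n (leq_trans n0 np) /=.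
by rewrite lef_pV2 ?posrE ?ltr0n ?ler_nat // (leq_trans n0 np).
Qed.

Lemma dec_pos p e A N : dec p e A N -> 0 < inv p.
Proof. by case=> p0 _ _ _; rewrite invr_gt0 ltr0n. Qed.

Lemma good_intro k p q r e1 e2 e3 A B C N :
  dec p e1 A N -> dec q e2 B N -> dec r e3 C N -> uN k N ->
  far (pt k p) (pt k q) (pt k r) -> good p q r.
Proof.
move=> dp dq dr uk H; exists k; split=> //; first by case/andP: uk.
- exact: uN_dec dp uk.
- exact: uN_dec dq uk.
- exact: uN_dec dr uk.
Qed.

Lemma pt_shift h j f p e A N : dec p e A N -> h = 2 ^+ f * N%:Z * j ->
  pt h p = (j * A%:Z)%:~R * 2 ^+ f / 2 ^+ e.
Proof.
move=> d E; rewrite (@pt_affine h 1 0 (2 ^+ f * j) p e A N d) //; last by rewrite E; ring.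
by rewrite mul0r mul0r add0r mul1r -mulrA intrM; congr (_ / _); rewrite rmorphXn /=; ring.
Qed.

Lemma shift_int f p e A N : dec p e A N -> (e <= f)%N ->
  exists2 m, pt (2 ^+ f * N%:Z) p = m%:~R & (2 %| m)%Z = (e < f)%N.
Proof.
move=> d ef; have oA : odd A by case: d.
exists (2 ^+ (f - e) * A%:Z).
  rewrite (@pt_shift _ 1 f _ _ _ _ d) ?mulr1 // mul1r intrM rmorphXn /=.
  by rewrite -{1}(subnK ef) exprD; field; rewrite expf_neq0 ?pnatr_eq0.
rewrite -subn_gt0; case: (f - e)%N => [|n]; first by rewrite expr0; lia.
by rewrite exprS -mulrA dvdz_mulr.
Qed.

Lemma shift_half p e A N : dec p e.+1 A N -> pt (2 ^+ e * N%:Z) p = (A%:Z)%:~R / 2.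
Proof.
move=> d; rewrite (@pt_shift _ 1 e _ _ _ _ d) ?mulr1 // mul1r exprSr.
by field; rewrite expf_neq0 ?pnatr_eq0.
Qed.

Lemma shift_quarter p e A N : dec p e.+2 A N -> pt (2 ^+ e * N%:Z) p = (A%:Z)%:~R / 4.
Proof.
move=> d; rewrite (@pt_shift _ 1 e _ _ _ _ d) ?mulr1 // mul1r !exprSr.
by field; rewrite expf_neq0 ?pnatr_eq0.
Qed.

Lemma uN_shift2 k f N : (0 < f)%N -> uN k N -> uN (k + 2 ^+ f * N%:Z) N.
Proof.
case: f => // f _ uk; apply: uN_shift => //; last by rewrite dvdz_mull.
by rewrite exprS -mulrA dvdz_mulr.
Qed.

Lemma odd_dvdz A : odd A -> ~~ (2 %| A%:Z)%Z. Proof. lia. Qed.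

Lemma dec_odd p e A N : dec p e A N -> ~~ (2 %| A%:Z)%Z.
Proof. by case=> _ /odd_dvdz. Qed.

Lemma dst_shift_int f p e A N k : dec p e A N -> (e <= f)%N ->
  dst (pt (k + 2 ^+ f * N%:Z) p) = dst (pt k p).
Proof. by move=> d ef; have [m E _] := shift_int d ef; rewrite pt_add E dst_int. Qed.

Lemma dst_shift_half p e A N k : dec p e.+1 A N ->
  dst (pt (k + 2 ^+ e * N%:Z) p) = 1/2 - dst (pt k p).
Proof. by move=> d; rewrite pt_add (shift_half d) dst_half_int // (dec_odd d). Qed.

Lemma dst_shift_quarter p e A N k : dec p e.+2 A N ->
  dst (2 * pt (k + 2 ^+ e * N%:Z) p) = 1/2 - dst (2 * pt k p).
Proof.
move=> d; rewrite pt_add (shift_quarter d) mulrDr.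
rewrite (_ : 2 * (_ / 4) = (A%:Z)%:~R / 2); last by field.
by rewrite dst_half_int // (dec_odd d).
Qed.

(** [(1 + N ^ 2) / 2] inverts 2 modulo [N], and it is odd because an odd square is 1 modulo 4. With
    this [k], [k / p] is close to an odd multiple of 1/2, 1/4 or 1/8 when the valuation [e] is 0, 1
    or 2. *)
Lemma exists_half N : odd N -> exists k, 2 * k = 1 + N%:Z * N%:Z /\ uN k N.
Proof.
move=> oN; have [n E] : exists n : int, N%:Z = 2 * n + 1.
  by exists (N./2)%:Z; lia.
have [l El] : exists l : int, n * (n + 1) = 2 * l.
  have [a [Ea|Ea]] : exists a : int, n = 2 * a \/ n = 2 * a + 1.
    by exists (n %/ 2)%Z; lia.
    by exists (a * (n + 1)); rewrite Ea; ring.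
  by exists (n * (a + 1)); rewrite Ea; ring.
exists (1 + 4 * l); have E2 : 2 * (1 + 4 * l) = 1 + N%:Z * N%:Z.
  have -> : 2 * (1 + 4 * l) = 2 + 4 * (2 * l) by ring.
  by rewrite -El E; ring.
split=> //; rewrite /uN coprimez2; apply/andP; split; first by lia.
by apply: (coprimez_affine E2); rewrite coprimezE coprime1n.
Qed.

Lemma half_pt k p e A N : dec p e A N -> 2 * k = 1 + N%:Z * N%:Z ->
  pt k p = inv p / 2 + (N%:Z * A%:Z)%:~R / (2 * 2 ^+ e).
Proof.
move=> d E; rewrite (@pt_affine k 2 1 N _ _ _ _ d) // ?E //.
by rewrite mul1r mulrC.
Qed.

Lemma small_pt (E : nat) k p e A N : dec p e A N -> k = E%:Z + N%:Z ->
  pt k p = E%:R * inv p + (A%:Z)%:~R / 2 ^+ e.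
Proof.
move=> d Ek; rewrite (@pt_affine k 1 E 1 _ _ _ _ d) // ?Ek; last by ring.
by rewrite !mul1r !divr1.
Qed.

Lemma uN_small (E : nat) k N : odd N -> ~~ odd E -> coprime E N -> k = E%:Z + N%:Z -> uN k N.
Proof.
move=> oN eE cEN ->; rewrite /uN coprimez2; apply/andP; split; first by lia.
by apply: (@coprimez_affine _ 1 E 1); rewrite ?coprimezE //; ring.
Qed.

Lemma oddM2 N A : odd N -> odd A -> ~~ (2 %| N%:Z * A%:Z)%Z.
Proof. by move=> oN oA; rewrite -PoszM; apply: odd_dvdz; rewrite oddM oN. Qed.

Lemma half_dst0 k p A N : dec p 0 A N -> 2 * k = 1 + N%:Z * N%:Z ->
  1/2 - inv p / 2 <= dst (pt k p).
Proof.
move=> d E; have [_ oA oN _] := d; have p0 := dec_pos d.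
have /dst_odd2 : pt k p = inv p / 2 + (N%:Z * A%:Z)%:~R / 2.
  by rewrite (half_pt d E) expr0 mulr1.
by move=> /(_ (oddM2 oN oA)); rewrite ger0_norm //; rlra.
Qed.

Lemma half_dst1 k p A N : dec p 1 A N -> 2 * k = 1 + N%:Z * N%:Z ->
  1/4 - inv p / 2 <= dst (pt k p) <= 1/4 + inv p / 2.
Proof.
move=> d E; have [_ oA oN _] := d; have p0 := dec_pos d.
have /dst_odd4 : pt k p = inv p / 2 + (N%:Z * A%:Z)%:~R / 4.
  by rewrite (half_pt d E) expr1; congr (_ + _ / _); ring.
by move=> /(_ (oddM2 oN oA)); rewrite ger0_norm //; rlra.
Qed.

Lemma half_dst2 k p A N : dec p 2 A N -> 2 * k = 1 + N%:Z * N%:Z ->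
  (1/8 - inv p / 2 <= dst (pt k p) <= 1/8 + inv p / 2) \/
  (3/8 - inv p / 2 <= dst (pt k p) <= 3/8 + inv p / 2).
Proof.
move=> d E; have [_ oA oN _] := d; have p0 := dec_pos d.
have /dst_odd8 : pt k p = inv p / 2 + (N%:Z * A%:Z)%:~R / 8.
  by rewrite (half_pt d E) expr2; congr (_ + _ / _); ring.
by move=> /(_ (oddM2 oN oA)); rewrite ger0_norm //; rlra.
Qed.

Lemma small_dst1 (E : nat) k p A N : dec p 1 A N -> k = E%:Z + N%:Z ->
  1/2 - E%:R * inv p <= dst (pt k p).
Proof.
move=> d Ek; have p0 := dec_pos d.
have := dst_odd2 (dec_odd d) (small_pt d Ek).
by rewrite ger0_norm // mulr_ge0 // ltW.
Qed.

Lemma dst_pt2 k : coprimez k 2 -> dst (pt k 2%N) = 1/2.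
Proof.
rewrite coprimez2 => ok; have := dst_le_half (pt k 2%N).
have : 1/2 - `|0 : R| <= dst (pt k 2%N) by apply: (@dst_odd2 _ _ _ ok); rewrite add0r.
by rewrite normr0; rlra.
Qed.

Lemma dst_pt4 k : coprimez k 2 -> dst (pt k 4%N) = 1/4.
Proof.
rewrite coprimez2 => ok.
have : 1/4 - `|0 : R| <= dst (pt k 4%N) <= 1/4 + `|0 : R| by apply: (@dst_odd4 _ _ _ ok); rewrite add0r.
by rewrite normr0; rlra.
Qed.

(* Adding [2 ^ e1 * N] to [k] translates the point by an integer vector
   outside [Lambda]. *)
Lemma flip_good k p q r e1 e2 e3 A B C N :
  dec p e1 A N -> dec q e2 B N -> dec r e3 C N -> uN k N -> (0 < e1)%N ->
  (e2 < e1)%N && (e3 < e1)%N || (e2 == e1) && (e3 == e1) ->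
  tri (dst (pt k p)) (dst (pt k q)) (dst (pt k r)) -> good p q r.
Proof.
move=> dp dq dr uk e0 He H.
have [l1 [l2 l3]] : [/\ (e1 <= e1)%N, (e2 <= e1)%N & (e3 <= e1)%N] by split; lia.
have [m1 E1 H1] := shift_int dp l1.
have [m2 E2 H2] := shift_int dq l2.
have [m3 E3 H3] := shift_int dr l3.
have om : ~~ (2 %| m1 + m2 + m3)%Z.
  move: H1 H2 H3; rewrite ltnn; case/orP: He => /andP[].
    by move=> -> -> *; lia.
  by move=> /eqP-> /eqP->; rewrite ltnn; lia.
have [F|F] := tri_far om H.
  exact: (good_intro dp dq dr uk F).
apply: (good_intro dp dq dr (uN_shift2 e0 uk)).
by rewrite !pt_add E1 E2 E3.
Qed.

End TwoAdic.

(** * Triples with a unique largest power of 2, or with equal powers of 2 *)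

Section Flip.
Implicit Types (t u v x y z : R) (k h m i X : int) (p q r N A B C e f : nat).

(** Adding [2 ^ e.+1 * N] reflects the first distance about 1/4 and moves the other two coordinates
    by integers. *)
Lemma choose_half k p q r e e2 e3 A B C N :
  dec p e.+2 A N -> dec q e2 B N -> dec r e3 C N -> uN k N ->
  (e2 <= e.+1)%N -> (e3 <= e.+1)%N ->
  exists k', [/\ uN k' N, 1/4 <= dst (pt k' p),
    dst (pt k' p) = dst (pt k p) \/ dst (pt k' p) = 1/2 - dst (pt k p),
    dst (pt k' q) = dst (pt k q) & dst (pt k' r) = dst (pt k r)].
Proof.
move=> dp dq dr uk l2 l3.
have [H|H] := lerP (1/4) (dst (pt k p)); first by exists k; split=> //; left.
exists (k + 2 ^+ e.+1 * N%:Z).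
have E := dst_shift_half k dp.
split; [exact: uN_shift2 | by rewrite E; rlra | by right | |].
  exact: dst_shift_int dq l2.
exact: dst_shift_int dr l3.
Qed.

(** Adding [2 ^ e.+1 * N] reflects [dst (2 * pt k p)] about 1/4, so one of the two multipliers has
    its first distance in [1/8, 3/8] and the other outside the interior of this interval. A further
    step [2 ^ e.+2 * N], which reflects [dst (pt k p)] itself, selects the desired half. *)
Lemma choose_quarter k p q r e e2 e3 A B C N :
  dec p e.+3 A N -> dec q e2 B N -> dec r e3 C N -> uN k N ->
  (e2 <= e.+1)%N -> (e3 <= e.+1)%N ->
  exists k1 k2, [/\ uN k1 N, 1/8 <= dst (pt k1 p) <= 1/4,
    dst (pt k1 q) = dst (pt k q) & dst (pt k1 r) = dst (pt k r)] /\
    [/\ uN k2 N, 3/8 <= dst (pt k2 p),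
    dst (pt k2 q) = dst (pt k q) & dst (pt k2 r) = dst (pt k r)].
Proof.
move=> dp dq dr uk l2 l3; pose k' := k + 2 ^+ e.+1 * N%:Z.
have uk' : uN k' N by apply: uN_shift2.
have Eq : dst (pt k' q) = dst (pt k q) by apply: dst_shift_int dq l2.
have Er : dst (pt k' r) = dst (pt k r) by apply: dst_shift_int dr l3.
have E2 := dst_shift_quarter k dp; rewrite -/k' in E2.
have [k1 [uk1 D1 q1 r1]] : exists k1, [/\ uN k1 N, 1/8 <= dst (pt k1 p) <= 3/8,
    dst (pt k1 q) = dst (pt k q) & dst (pt k1 r) = dst (pt k r)].
  have [H|H] := lerP (1/4) (dst (2 * pt k p)).
    by exists k; split=> //; move: H; rewrite dst_double le_min; rlra.
  by exists k'; split=> //; have := E2; rewrite dst_double; case: (lerP (2 * dst (pt k' p)) (1 - 2 * dst (pt k' p))); rlra.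
have [k2 [uk2 D2 q2 r2]] : exists k2, [/\ uN k2 N, (dst (pt k2 p) <= 1/8) || (3/8 <= dst (pt k2 p)),
    dst (pt k2 q) = dst (pt k q) & dst (pt k2 r) = dst (pt k r)].
  have [H|H] := lerP (dst (2 * pt k p)) (1/4).
    exists k; split=> //; move: H; rewrite dst_double ge_min => /orP[?|?]; apply/orP; [left|right]; rlra.
  exists k'; split=> //; have := E2; rewrite dst_double.
  by case: (lerP (2 * dst (pt k' p)) (1 - 2 * dst (pt k' p))) => ? ?; apply/orP; [left|right]; rlra.
have m2 : (e2 <= e.+2)%N by apply: leqW.
have m3 : (e3 <= e.+2)%N by apply: leqW.
have up k0 : uN k0 N -> uN (k0 + 2 ^+ e.+2 * N%:Z) N by apply: uN_shift2.
have Qs k0 : dst (pt (k0 + 2 ^+ e.+2 * N%:Z) q) = dst (pt k0 q) by apply: dst_shift_int dq m2.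
have Rs k0 : dst (pt (k0 + 2 ^+ e.+2 * N%:Z) r) = dst (pt k0 r) by apply: dst_shift_int dr m3.
have Ps k0 := dst_shift_half k0 dp.
have [k3 [? ? ? ?]] : exists k3, [/\ uN k3 N, 1/8 <= dst (pt k3 p) <= 1/4,
    dst (pt k3 q) = dst (pt k q) & dst (pt k3 r) = dst (pt k r)].
  have [H|H] := lerP (dst (pt k1 p)) (1/4).
    by exists k1; split=> //; rlra.
  by exists (k1 + 2 ^+ e.+2 * N%:Z); rewrite Qs Rs Ps; split=> //; [exact: up | rlra].
have [k4 [? ? ? ?]] : exists k4, [/\ uN k4 N, 3/8 <= dst (pt k4 p),
    dst (pt k4 q) = dst (pt k q) & dst (pt k4 r) = dst (pt k r)].
  case/orP: D2 => D2; last by exists k2; split=> //; rlra.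
  by exists (k2 + 2 ^+ e.+2 * N%:Z); rewrite Qs Rs Ps; split=> //; [exact: up | rlra].
by exists k3, k4.
Qed.

(** For [k] near 1/2 the two odd numbers have distances in [1/3, 1/2], so any first distance of at
    least 1/6 completes a triangle. *)
Lemma flip_e00 p q r e A B C N :
  dec p e.+1 A N -> dec q 0 B N -> dec r 0 C N ->
  (3 <= q)%N -> (3 <= r)%N -> (e == 0%N) ==> (p == 2%N) || (6 <= p)%N -> good p q r.
Proof.
move=> dp dq dr q3 r3 p6; have [_ _ oN _] := dp.
have [k [Ek uk]] := exists_half oN.
have := half_dst0 dq Ek; have := half_dst0 dr Ek.
have := inv_bound q3 isT; have := inv_bound r3 isT.
have Dq := dst_le_half (pt k q); have Dr := dst_le_half (pt k r).
case: e dp p6 => [|e] dp p6.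
  move=> *; have Dp := dst_le_half (pt k p).
  have H : 1/6 <= dst (pt k p).
    case/orP: p6 => [/eqP->|p6]; first by rewrite dst_pt2 //; [rlra | case/andP: uk].
    by have := half_dst1 dp Ek; have := inv_bound p6 isT; rlra.
  apply: (flip_good dp dq dr uk) => //.
  by apply/and3P; split; rlra.
have [k' [uk' D _ <- <-]] := choose_half dp dq dr uk isT isT.
have Dp := dst_le_half (pt k' p); have Dq' := dst_le_half (pt k' q); have Dr' := dst_le_half (pt k' r) => *.
apply: (flip_good dp dq dr uk') => //.
by apply/and3P; split; rlra.
Qed.

Lemma flip_210 p q r A B C N :
  dec p 2 A N -> dec q 1 B N -> dec r 0 C N -> (3 <= r)%N ->
  (q == 2%N) && (p == 4%N) || (12 <= p)%N -> (q == 2%N) || (6 <= q)%N -> good p q r.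
Proof.
move=> dp dq dr r3 p4 q2; have [_ _ oN _] := dp.
have [k [Ek uk]] := exists_half oN.
have [k' [uk' D Dp' Eq Er]] := choose_half dp dq dr uk isT isT.
have uk2 : coprimez k' 2 by case/andP: uk'.
have := half_dst0 dr Ek; rewrite -Er.
have := inv_bound r3 isT.
have := dst_le_half (pt k' q); have := dst_le_half (pt k' r); have := dst_le_half (pt k' p).
move=> *; apply: (flip_good dp dq dr uk') => //.
case/orP: q2 => [/eqP q2|q6].
  have : dst (pt k' q) = 1/2 by rewrite q2 dst_pt2.
  move=> *.
  by apply/and3P; split; rlra.
have := half_dst1 dq Ek; rewrite -Eq; have := inv_bound q6 isT => *.
have p12 : (12 <= p)%N by case/orP: p4 => // /andP[/eqP Eq2]; rewrite Eq2 in q6.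
have := inv_bound p12 isT => *.
have H : 3/8 - inv p / 2 <= dst (pt k' p).
  by case: (half_dst2 dp Ek) => ?; case: Dp' => ?; rlra.
by apply/and3P; split; rlra.
Qed.

(** [(1 + 3 * N ^ 2) / 4] inverts 4 modulo [N]; it is an odd integer because an odd square is 1
    modulo 8. *)
Lemma exists_three_quarters N : odd N ->
  exists k, 4 * k = 1 + N%:Z * (3 * N%:Z) /\ uN k N.
Proof.
move=> oN; have [k [Ek uk]] := exists_half oN.
have [l El] : exists l, k = 2 * l + 1.
  by exists (k %/ 2)%Z; case/andP: uk; rewrite coprimez2; lia.
have e2 : 4 * (3 * l + 1) = 1 + N%:Z * (3 * N%:Z).
  have -> : 1 + N%:Z * (3 * N%:Z) = 3 * (2 * k) - 2 by rewrite Ek; ring.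
  by rewrite El; ring.
have El2 : (2 %| l)%Z.
  have [n E] : exists n : int, N%:Z = 2 * n + 1 by exists (N./2)%:Z; lia.
  have : 2 * l = 2 * (n * (n + 1)).
    have -> : 2 * l = k - 1 by rewrite El addrK.
    apply: (mulfI (_ : 2 != 0 :> int)) => //.
    by rewrite mulrBr Ek E; ring.
  have [a [Ea|Ea]] : exists a : int, n = 2 * a \/ n = 2 * a + 1.
    by exists (n %/ 2)%Z; lia.
    by move/(mulfI (_ : 2 != 0 :> int)) => -> //; rewrite Ea -mulrA dvdz_mulr.
  move/(mulfI (_ : 2 != 0 :> int)) => -> //; rewrite Ea.
  have -> : (2 * a + 1) * (2 * a + 1 + 1) = 2 * ((2 * a + 1) * (a + 1)) by ring.
  by rewrite dvdz_mulr.
exists (3 * l + 1); split=> //; rewrite /uN coprimez2; apply/andP; split; first lia.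
by apply: (coprimez_affine e2); rewrite coprimezE coprime1n.
Qed.

(** The distance of [k / 4] is always 1/4. A multiplier near 1/2 would give distances near 1/4, 1/4
    and 1/2, with no margin in the triangle inequality; near 1/4 they are 1/4, about 1/8 or 3/8, and
    about 1/4. *)
Lemma flip_210_4 q r A B C N :
  dec 4 2 A N -> dec q 1 B N -> dec r 0 C N -> (3 <= r)%N -> (6 <= q)%N ->
  good 4%N q r.
Proof.
move=> dp dq dr r3 q6; have [_ _ oN _] := dp.
have [k [Ek uk]] := exists_three_quarters oN.
apply: (flip_good dp dq dr uk) => //.
rewrite dst_pt4; last by case/andP: uk.
have := inv_bound r3 isT; have := inv_bound q6 isT.
have oB := @dec_odd _ _ _ _ dq; have oC := @dec_odd _ _ _ _ dr.
have oX X : ~~ (2 %| X)%Z -> ~~ (2 %| 3 * N%:Z * X)%Z.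
  move=> oX; have := odd_dvdz oN; rewrite -!coprimez2 in oX * => oN2.
  by rewrite !coprimezMl oN2 oX.
have Er : pt k r = inv r / 4 + (3 * N%:Z * C%:Z)%:~R / 4.
  by rewrite (@pt_affine k 4 1 (3 * N%:Z) _ _ _ _ dr) // expr0 mulr1 mul1r mulrC.
have Eq : pt k q = inv q / 4 + (3 * N%:Z * B%:Z)%:~R / 8.
  by rewrite (@pt_affine k 4 1 (3 * N%:Z) _ _ _ _ dq) // expr1 mul1r mulrC; congr (_ + _ / _); ring.
have := dst_odd4 (oX _ oC) Er; have := dst_odd8 (oX _ oB) Eq.
move=> H8 H4 *; have rp := dec_pos dr; have qp := dec_pos dq.
rewrite ger0_norm in H4; last rlra.
by case: H8; rewrite ger0_norm => *; try rlra; apply/and3P; split; rlra.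
Qed.

Lemma flip_e10 p q r e A B C N :
  dec p e.+3 A N -> dec q 1 B N -> dec r 0 C N -> (3 <= r)%N ->
  (q == 2%N) || (6 <= q)%N -> good p q r.
Proof.
move=> dp dq dr r3 q2; have [_ _ oN _] := dp.
have [k [Ek uk]] := exists_half oN.
have [_ [k' [_ [uk' D Eq Er]]]] := choose_quarter dp dq dr uk isT isT.
have uk2 : coprimez k' 2 by case/andP: uk'.
have := half_dst0 dr Ek; rewrite -Er.
have := inv_bound r3 isT.
have := dst_le_half (pt k' q); have := dst_le_half (pt k' r); have := dst_le_half (pt k' p).
move=> *; apply: (flip_good dp dq dr uk') => //.
case/orP: q2 => [/eqP q2|q6].
  have : dst (pt k' q) = 1/2 by rewrite q2 dst_pt2.
  move=> *.
  by apply/and3P; split; rlra.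
have := half_dst1 dq Ek; rewrite -Eq; have := inv_bound q6 isT => *.
by apply/and3P; split; rlra.
Qed.

Lemma dec_form p e A N : dec p e A N -> exists2 p', odd p' & (p = 2 ^ e * p')%N.
Proof.
case=> p0 oA oN pA; have : (2 ^ e %| p)%N.
  rewrite -(@Gauss_dvdl _ _ A) ?pA ?dvdn_mulr //.
  by rewrite coprimeXl // coprime2n.
case/dvdnP=> p' Ep; exists p'; last by rewrite mulnC.
have E : (2 ^ e * (p' * A) = 2 ^ e * N)%N by rewrite -pA Ep; ring.
by move/eqP: E; rewrite eqn_pmul2l ?expn_gt0 // => /eqP E; move: oN; rewrite -E oddM => /andP[].
Qed.

Lemma dec_ge4 p e A N : dec p e.+2 A N -> (4 <= p)%N.
Proof.
case/dec_form=> p' op' ->; rewrite -[e.+2]/(2 + e)%N expnD -mulnA.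
have := expn_gt0 2 e; have := odd_gt0 op' => p0 e0; nia.
Qed.

Lemma uN1_shift f N : odd N -> uN (1 + 2 ^+ f.+1 * N%:Z) N.
Proof. by move=> oN; apply: uN_shift2 => //; rewrite /uN !coprimezE !coprime1n. Qed.

(** The multiplier 1 gives the small value [1 / r], and the added multiple of [N] turns it into a
    value near 1/2. *)
Lemma shift1_dst f k r C N : dec r f.+2 C N -> k = 1 + 2 ^+ f.+1 * N%:Z ->
  1/2 - inv r <= dst (pt k r).
Proof.
move=> d ->; have r0 := dec_pos d.
have : pt (1 + 2 ^+ f.+1 * N%:Z) r = inv r + (C%:Z)%:~R / 2.
  by rewrite pt_add (shift_half d) /pt mul1r.
by move/(dst_odd2 (dec_odd d)); rewrite ger0_norm // ltW.
Qed.

(** The number 6 is a true exception, by [dst_pt6]. Otherwise [k / r] is brought near 1/2 by a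
    multiplier near 1/2, by [2 + N], or by 1 plus a multiple of [N], according to the valuation of
    [r]. *)
Lemma exists_dst_ge_quarter r e C N : dec r e C N -> (1 < r)%N -> r != 6%N ->
  exists k, uN k N /\ 1/4 <= dst (pt k r).
Proof.
move=> d r1 r6; have [_ _ oN _] := d; have [r' or' Er] := dec_form d.
case: e d Er => [|[|e]] d Er.
- have [k [Ek uk]] := exists_half oN; exists k; split=> //.
  by have := half_dst0 d Ek; have := inv_bound r1 isT; rlra.
- have uk : uN (2%:Z + N%:Z) N by apply: (@uN_small 2) => //; rewrite coprime2n.
  exists (2%:Z + N%:Z); split=> //.
  have [r2|r2] := eqVneq r 2%N; first by rewrite r2 dst_pt2; [rlra | case/andP: uk].
  have r10 : (10 <= r)%N by move: Er r6 r2 r1 or'; rewrite expn1; lia.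
  by have := small_dst1 (E:=2) d erefl; have := inv_bound r10 isT; rlra.
- exists (1 + 2 ^+ e.+1 * N%:Z); split; first exact: uN1_shift.
  have r4 := dec_ge4 d.
  by have := shift1_dst d erefl; have := inv_bound r4 isT; rlra.
Qed.

Lemma tri_ge_quarter (a b c : R) : 1/4 <= a <= 1/2 -> 1/4 <= b <= 1/2 ->
  1/4 <= c <= 1/2 -> tri a b c.
Proof. by move=> *; apply/and3P; split; rlra. Qed.

Lemma flip_decreasing p q r e1 e2 e3 A B C N :
  dec p e1 A N -> dec q e2 B N -> dec r e3 C N -> (e3 < e2 < e1)%N -> (1 < e2)%N ->
  (1 < r)%N -> r != 6%N -> good p q r.
Proof.
move=> dp dq dr /andP[l32 l21] l2 r1 r6.
have [k [uk Dr]] := exists_dst_ge_quarter dr r1 r6.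
case: e2 l2 l32 l21 dq => [|[|f]] // _ l32 l21 dq.
case: e1 l21 dp => [|[|g]] // l21 dp.
(* The second number is adjusted before the first: its shift disturbs [k / p], whereas the later
   shift for [p] moves [k / q] and [k / r] by integers. *)
have [k1 [uk1 D1 _ E1 _]] := choose_half dq dr dr uk l32 l32.
have l31 : (e3 <= g.+1)%N by lia.
have [k2 [uk2 D2 _ E2 E3]] := choose_half dp dq dr uk1 l21 l31.
apply: (flip_good dp dq dr uk2) => //; first by lia.
by apply: tri_ge_quarter; rewrite dst_le_half ?E2 ?E3 ?E1 andbT.
Qed.

Lemma dst_pt6 k : coprimez k 6 -> dst (pt k 6%N) = 1/6.
Proof.
rewrite -[6]/(2 * 3 : int) coprimezMr coprimez2 => /andP[k2 k3].
have [m [E|E]] : exists m, k = 6 * m + 1 \/ k = 6 * m - 1.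
  have : ~~ (3 %| k)%Z by rewrite coprimez_sym coprimezE prime_coprime // in k3.
  by exists ((k + 1) %/ 6)%Z; lia.
- rewrite /pt E intrD intrM (_ : (_ + _) / _ = 1/6 + m%:~R :> R); last by field.
  by rewrite dst_int dst_small ger0_norm //; rlra.
- rewrite /pt E intrB intrM (_ : (_ - _) / _ = - (1/6) + m%:~R :> R); last by field.
  by rewrite dst_int dst_small normrN ger0_norm //; rlra.
Qed.

(** Since the third distance is 1/6, the first two must differ by at most 1/6 and add up to at least
    1/6. The second is first placed in [1/4, 5/12]; if the valuation of [p] exceeds that of [q] by
    at least 2, the first can be placed independently in [1/4, 3/8]. *)
Lemma flip_decreasing_6 p q e1 e2 A B C N :
  dec p e1 A N -> dec q e2 B N -> dec 6 1 C N -> (1 < e2 < e1)%N ->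
  q != 4%N -> good p q 6.
Proof.
move=> dp dq dr /andP[l2 l21] q4; have [_ _ oN _] := dp.
have c6 k : uN k N -> dst (pt k 6%N) = 1/6 by move=> /(uN_dec dr) /dst_pt6.
case: e2 l2 l21 dq => [|[|f]] // _ l21 dq.
have [k [uk Dk]] : exists k, uN k N /\ 1/4 <= dst (pt k q) <= 5/12.
  case: f l21 dq => [|f] l21 dq.
    have [k [Ek uk]] := exists_half oN.
    have q12 : (12 <= q)%N.
      by have [q' oq Eq] := dec_form dq; move: q4; rewrite Eq; lia.
    have := inv_bound q12 isT => Iq.
    have [k1 [uk1 D1 D2 _ _]] := choose_half dq dr dr uk isT isT.
    exists k1; split=> //.
    by case: (half_dst2 dq Ek); case: D2; rlra.
  have [k [Ek uk]] := exists_half oN.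
  have [k1 [_ [[uk1 D1 _ _] _]]] := choose_quarter dq dr dr uk isT isT.
  exists (k1 + 2 ^+ f.+2 * N%:Z); split; first exact: uN_shift2.
  by rewrite (dst_shift_half _ dq); rlra.
have [g1|[g Eg]] : e1 = f.+3 \/ exists g, e1 = g.+3 /\ (f.+2 <= g.+1)%N.
- by have [->|H] := eqVneq e1 f.+3; [left | right; exists (e1 - 3)%N; lia].
- rewrite g1 in dp.
  have [k1 [uk1 D1 _ E1 _]] := choose_half dp dq dr uk (leqnn _) isT.
  have U1 := dst_le_half (pt k1 p).
  have [H|H] := lerP (dst (pt k1 p)) (dst (pt k1 q) + 1/6).
    apply: (flip_good dp dq dr uk1) => //; first by rewrite !ltnS leqnn.
    by rewrite c6 //; apply/and3P; split; rlra.
  (* The valuations differ by 1, so one shift acts on both coordinates. Here the first distance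
     exceeds 5/12 and the second is below 1/3; the shift replaces them by [dst (pt k1 p) - 1/4],
     after a possible reflection, and [1/2 - dst (pt k1 q)], both in [1/6, 1/4]. *)
  have [k2 [uk2 H2 E2 _]] : exists k2, [/\ uN k2 N, dst (2 * pt k2 p) = 1/2 - dst (2 * pt k1 p),
      dst (pt k2 q) = 1/2 - dst (pt k1 q) & True].
    exists (k1 + 2 ^+ f.+1 * N%:Z); split=> //; first exact: uN_shift2.
      exact: dst_shift_quarter dp.
    exact: dst_shift_half dq.
  have {}H2 : dst (2 * pt k2 p) = 2 * dst (pt k1 p) - 1/2.
    by rewrite H2 dst_double; case: (lerP (2 * dst (pt k1 p)) (1 - 2 * dst (pt k1 p))) => ?; rlra.
  have [k3 [uk3 H3 E3]] : exists k3, [/\ uN k3 N, dst (pt k3 p) = dst (pt k1 p) - 1/4 &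
      dst (pt k3 q) = dst (pt k2 q)].
    move: H2; rewrite dst_double; case: (lerP (2 * dst (pt k2 p)) (1 - 2 * dst (pt k2 p))) => _ H2.
      by exists k2; split=> //; rlra.
    exists (k2 + 2 ^+ f.+2 * N%:Z); split; first exact: uN_shift2.
      by rewrite (dst_shift_half _ dp); rlra.
    exact: dst_shift_int dq (leqnn _).
  apply: (flip_good dp dq dr uk3) => //; first by rewrite !ltnS leqnn.
  by rewrite c6 //; apply/and3P; split; rlra.
- case: Eg => Eg lg; rewrite Eg in dp.
  have [k1 [_ [[uk1 D1 E1 _] _]]] := choose_quarter dp dq dr uk lg isT.
  have uk2 : uN (k1 + 2 ^+ g.+2 * N%:Z) N by apply: uN_shift2.
  apply: (flip_good dp dq dr uk2) => //; first by lia.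
  rewrite c6 // (dst_shift_half _ dp) (dst_shift_int k1 dq (leqW lg)) E1.
  by apply/and3P; split; rlra.
Qed.

(** For [k] near 1/2, the last two distances are near 1/4 and the first near 1/8 or 3/8. In both
    cases the triangle inequality has margin 1/8, against errors of half the reciprocals, hence the
    bound 1/4. *)
Lemma flip_e11 p q r e A B C N :
  dec p e.+2 A N -> dec q 1 B N -> dec r 1 C N -> (6 <= q)%N -> (6 <= r)%N ->
  (if e == 0%N then (p == 4%N) || (inv p + inv q + inv r <= 1/4)
   else inv q + inv r <= 1/4) -> good p q r.
Proof.
move=> dp dq dr q6 r6; have [_ _ oN _] := dp; have p0 := dec_pos dp.
have [k [Ek uk]] := exists_half oN.
have := half_dst1 dq Ek; have := half_dst1 dr Ek.
have := inv_bound q6 isT; have := inv_bound r6 isT => Ir Iq Dr Dq.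
case: e dp => [|e] dp /= H.
  apply: (flip_good dp dq dr uk) => //.
  case/orP: H => [/eqP p4|H].
    have Dp : dst (pt k p) = 1/4 by rewrite p4 dst_pt4 //; case/andP: uk.
    by apply/and3P; split; rlra.
  by case: (half_dst2 dp Ek) => Dp; apply/and3P; split; rlra.
have [k1 [_ [[uk1 D1 E1 E2] _]]] := choose_quarter dp dq dr uk isT isT.
by apply: (flip_good dp dq dr uk1) => //; rewrite E1 E2; apply/and3P; split; rlra.
Qed.

Lemma flip_e11_2 p r e A B C N :
  dec p e.+2 A N -> dec 2 1 B N -> dec r 1 C N -> (6 <= r)%N ->
  (e == 0%N) ==> (12 <= p)%N -> good p 2 r.
Proof.
move=> dp dq dr r6 p12; have [_ _ oN _] := dp.
have [k [Ek uk]] := exists_half oN.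
have := half_dst1 dr Ek; have := inv_bound r6 isT => Ir Dr.
have [k1 [uk1 D1 E1]] : exists k1, [/\ uN k1 N, 1/3 <= dst (pt k1 p) & dst (pt k1 r) = dst (pt k r)].
  case: e dp p12 => [|e] dp /= p12.
    have Ip := inv_bound p12 isT.
    have [k1 [uk1 D1 D2 _ E1]] := choose_half dp dr dr uk isT isT.
    exists k1; split=> //.
    by case: (half_dst2 dp Ek); case: D2; rlra.
  have [_ [k1 [_ [uk1 D1 E1 _]]]] := choose_quarter dp dr dr uk isT isT.
  by exists k1; split=> //; rlra.
have U := dst_le_half (pt k1 p).
apply: (flip_good dp dq dr uk1) => //.
have -> : dst (pt k1 2%N) = 1/2 by apply: dst_pt2; case/andP: uk1.
by rewrite E1; apply/and3P; split; rlra.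
Qed.

Lemma flip_eff p q r e1 f A B C N :
  dec p e1 A N -> dec q f.+2 B N -> dec r f.+2 C N -> (f.+2 < e1)%N -> good p q r.
Proof.
move=> dp dq dr; have [_ _ oN _] := dp.
case: e1 dp => [|[|e]] // dp le.
have uk := uN1_shift f oN.
have := shift1_dst dq erefl; have := shift1_dst dr erefl.
have [k1 [uk1 D1 _ <- <-]] := choose_half dp dq dr uk le le.
have := inv_bound (dec_ge4 dq) isT; have := inv_bound (dec_ge4 dr) isT => *.
apply: (flip_good dp dq dr uk1) => //; first by rewrite le.
by apply: tri_ge_quarter; rewrite dst_le_half andbT; rlra.
Qed.

Lemma flip_eee p q r f A B C N :
  dec p f.+2 A N -> dec q f.+2 B N -> dec r f.+2 C N -> good p q r.
Proof.
move=> dp dq dr; have [_ _ oN _] := dp.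
have uk := uN1_shift f oN.
have := shift1_dst dq erefl; have := shift1_dst dr erefl; have := shift1_dst dp erefl.
have := inv_bound (dec_ge4 dq) isT; have := inv_bound (dec_ge4 dr) isT.
have := inv_bound (dec_ge4 dp) isT => *.
apply: (flip_good dp dq dr uk) => //; first by rewrite eqxx orbT.
by apply: tri_ge_quarter; rewrite dst_le_half andbT; rlra.
Qed.

Lemma flip_111 p q r A B C N :
  dec p 1 A N -> dec q 1 B N -> dec r 1 C N ->
  (6 <= p)%N -> (6 <= q)%N -> (6 <= r)%N -> good p q r.
Proof.
move=> dp dq dr p6 q6 r6; have [_ _ oN _] := dp.
have [k [Ek uk]] := exists_half oN.
have := half_dst1 dq Ek; have := half_dst1 dr Ek; have := half_dst1 dp Ek.
have := inv_bound q6 isT; have := inv_bound r6 isT; have := inv_bound p6 isT => *.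
by apply: (flip_good dp dq dr uk) => //; apply/and3P; split; rlra.
Qed.

(** The distance of [k / 2] is 1/2, so the other two must add up to at least 1/2. A multiplier near
    1/2 puts both near 1/4; [2 + N] puts both near 1/2, with errors [2 / q] and [2 / r]. *)
Lemma flip_111_2 q r A B C N :
  dec 2 1 A N -> dec q 1 B N -> dec r 1 C N ->
  (6 <= q)%N -> (6 <= r)%N -> inv q + inv r <= 1/4 -> good 2 q r.
Proof.
move=> dp dq dr q6 r6 H; have [_ _ oN _] := dp.
have uk : uN (2%:Z + N%:Z) N by apply: (@uN_small 2) => //; rewrite coprime2n.
have := small_dst1 (E:=2) dq erefl; have := small_dst1 (E:=2) dr erefl.
have := dst_le_half (pt (2%:Z + N%:Z) q); have := dst_le_half (pt (2%:Z + N%:Z) r).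
have := inv_bound q6 isT; have := inv_bound r6 isT => *.
apply: (flip_good dp dq dr uk) => //.
have -> : dst (pt (2%:Z + N%:Z) 2%N) = 1/2 by apply: dst_pt2; case/andP: uk.
by apply/and3P; split; rlra.
Qed.

End Flip.

(** * Triples of odd numbers and triples prime to 3 *)

Section Thirds.
Implicit Types (t u v x y z e : R) (k h m i X Y : int) (p q r N A B C f : nat).

Lemma nrm_near_even t e Y : t = e + (2 * Y)%:~R -> nrm t <= `|e|.
Proof. by move=> ->; rewrite nrm_even ?dvdz_mulr //; apply: nrm_le_norm. Qed.

Lemma nrm_near_odd t e X : ~~ (2 %| X)%Z -> t = e + X%:~R -> 1 - `|e| <= nrm t.
Proof. by move=> oX ->; rewrite nrm_odd //; have := nrm_le_norm e; rlra. Qed.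

Lemma nrm_near_third t e Y : ~~ (3 %| Y)%Z -> t = e + (2 * Y)%:~R / 3 ->
  2/3 - `|e| <= nrm t <= 2/3 + `|e|.
Proof.
move=> Y3 E; have [m [EY|EY]] : exists m, Y = 3 * m + 1 \/ Y = 3 * m - 1.
  by exists ((Y + 1) %/ 3)%Z; lia.
- pose u : R := 2/3 + (2 * m)%:~R; have Eu : t - u = e by rewrite E EY /u; field.
  have := nrm_lip t u; have := nrm_lip u t; rewrite (distrC u) Eu.
  by rewrite /u !nrm_even ?dvdz_mulr // (@nrm_small (2/3)) ger0_norm; rlra.
- pose u : R := - (2/3) + (2 * m)%:~R; have Eu : t - u = e by rewrite E EY /u; field.
  have := nrm_lip t u; have := nrm_lip u t; rewrite (distrC u) Eu.
  by rewrite /u !nrm_even ?dvdz_mulr // (@nrm_small (- (2/3))) normrN ger0_norm; rlra.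
Qed.

Lemma btwP u x y : x <= u <= y \/ y <= u <= x -> btw u x y.
Proof. by case=> ?; apply/orP; [left|right]. Qed.

Lemma even_or_even (a b : int) : ~~ (2 %| a + b)%Z ->
  (exists a', a = 2 * a' /\ ~~ (2 %| b)%Z) \/ (exists b', b = 2 * b' /\ ~~ (2 %| a)%Z).
Proof.
move=> oab; case: (boolP (2 %| a)%Z) => ea.
  by left; exists (a %/ 2)%Z; lia.
by right; exists (b %/ 2)%Z; lia.
Qed.

Lemma third_or_third (a b : int) : ~~ (3 %| a)%Z -> ~~ (3 %| b)%Z ->
  (exists a', a + b = a' * 3 /\ ~~ (3 %| a - b)%Z) \/
  (exists b', a - b = b' * 3 /\ ~~ (3 %| a + b)%Z).
Proof.
move=> a3 b3; case: (boolP (3 %| a + b)%Z) => ab.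
  by left; exists ((a + b) %/ 3)%Z; lia.
by right; exists ((a - b) %/ 3)%Z; lia.
Qed.

(** For [k] near 1/2, [x + y] and [x - y] are near the integers [a] and [b], whose sum [N * A] is
    odd. One is thus near an even and the other near an odd integer, while [nrm z] is near 1/2. The
    errors are half the reciprocals. *)
Lemma good_odd p q r A B C N : dec p 0 A N -> dec q 0 B N -> dec r 0 C N ->
  inv p + inv q + inv r <= 1 -> good p q r.
Proof.
move=> dp dq dr H; have [_ oA oN _] := dp; have [_ oB _ _] := dq; have [_ oC _ _] := dr.
have [p0 [q0 r0]] : 0 < inv p /\ 0 < inv q /\ 0 < inv r.
  by split; [exact: dec_pos dp | split; [exact: dec_pos dq | exact: dec_pos dr]].
have [k [Ek uk]] := exists_half oN.
apply: (good_intro dp dq dr uk); apply: btw_far.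
have := half_dst0 dr Ek.
have Ep := half_pt dp Ek; have Eq := half_pt dq Ek.
rewrite expr0 mulr1 in Ep Eq.
have [a [b [Ea Eb]]] : exists a b : int, N%:Z * A%:Z = a + b /\ N%:Z * B%:Z = a - b.
  exists ((N * A + N * B)./2%:Z), ((N * A + N * B)./2%:Z - N%:Z * B%:Z).
  have : (2 %| N * A + N * B)%N by rewrite dvdn2 oddD !oddM oN oA oB.
  by split; [lia | lia].
have oab : ~~ (2 %| a + b)%Z by rewrite -Ea oddM2.
have Hab := even_or_even oab.
have Es : pt k p + pt k q = (inv p + inv q) / 2 + a%:~R.
  by rewrite Ep Eq Ea Eb intrD intrB; rlra.
have Ed : pt k p - pt k q = (inv p - inv q) / 2 + b%:~R.
  by rewrite Ep Eq Ea Eb intrD intrB; rlra.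
have Hs : `|(inv p + inv q) / 2| = (inv p + inv q) / 2 by rewrite ger0_norm; rlra.
have Hd : `|(inv p - inv q) / 2| <= (inv p + inv q) / 2 by rewrite ler_norml; rlra.
move: (pt k p + pt k q) (pt k p - pt k q) Es Ed => s d Es Ed Dr.
have Nr : 1/2 - inv r / 2 <= nrm (pt k r) <= 1/2 + inv r / 2.
  by case: (dst_cases (pt k r)) => -[E ?]; rlra.
apply: btwP; case: Hab => [[a' [E ob]]|[b' [E ea]]].
  rewrite E in Es; have := nrm_near_even Es; have := nrm_near_odd ob Ed.
  by left; rlra.
rewrite E in Ed; have := nrm_near_even Ed; have := nrm_near_odd ea Es.
by right; rlra.
Qed.

Lemma nrm_frac (D c : nat) U t e : (0 < D)%N -> (c <= D)%N ->
  ((2 * D)%:Z %| U - c%:Z)%Z || ((2 * D)%:Z %| U + c%:Z)%Z -> t = e + U%:~R / D%:R ->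
  c%:R / D%:R - `|e| <= nrm t <= c%:R / D%:R + `|e|.
Proof.
move=> D0 cD H Et; have D0' : D%:R != 0 :> R by rewrite pnatr_eq0 -lt0n.
have [v [Ev Nv]] : exists v, t - v = e /\ nrm v = c%:R / D%:R.
  have Nc : nrm (c%:R / D%:R : R) = c%:R / D%:R.
    by rewrite nrm_small ger0_norm ?divr_ge0 // ler_pdivrMr ?ltr0n // mul1r ler_nat.
  case/orP: H => /dvdzP[m Em].
    exists (c%:R / D%:R + (2 * m)%:~R); rewrite nrm_even ?dvdz_mulr //; split=> //.
    by rewrite Et -(subrK c%:Z U) Em PoszM !(intrD, intrM) -!pmulrn; field.
  exists (- (c%:R / D%:R) + (2 * m)%:~R); rewrite nrm_even ?dvdz_mulr // nrmN; split=> //.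
  by rewrite Et -(addrK c%:Z U) Em PoszM !(intrB, intrM) -!pmulrn; field.
have := nrm_lip t v; have := nrm_lip v t; rewrite (distrC v) Ev Nv.
by move=> *; apply/andP; split; rlra.
Qed.

(** Exactly one of [a + b] and [a - b] is a multiple of 3, so one of [x + y] and [x - y] is near an
    even integer and the other near 2/3 up to sign modulo 2. *)
Lemma far_two_thirds x y z e1 e2 (a b : int) :
  ~~ (3 %| a)%Z -> ~~ (3 %| b)%Z ->
  x = e1 + (2 * a)%:~R / 3 -> y = e2 + (2 * b)%:~R / 3 ->
  `|e1| + `|e2| <= 1 - nrm z <= 2/3 - (`|e1| + `|e2|) -> far x y z.
Proof.
move=> a3 b3 Ex Ey H; apply: btw_far.
have Hab := third_or_third a3 b3.
have Es : x + y = (e1 + e2) + (2 * (a + b))%:~R / 3.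
  by rewrite Ex Ey !intrM intrD; rlra.
have Ed : x - y = (e1 - e2) + (2 * (a - b))%:~R / 3.
  by rewrite Ex Ey !intrM intrB; rlra.
have := ler_normD e1 e2; have := ler_normB e1 e2.
move: (x + y) (x - y) Es Ed => s d Es Ed Hd Hs.
apply: btwP; case: Hab => [[m [E ob]]|[m [E ab]]].
  have {}Es : s = (e1 + e2) + (2 * m)%:~R by rewrite Es E !intrM; rlra.
  have := nrm_near_even Es; have := nrm_near_third ob Ed.
  by left; rlra.
have {}Ed : d = (e1 - e2) + (2 * m)%:~R by rewrite Ed E !intrM; rlra.
have := nrm_near_even Ed; have := nrm_near_third ab Es.
by right; rlra.
Qed.

Lemma far_thirds x y z e1 e2 e3 (a b c : int) :
  ~~ (3 %| a)%Z -> ~~ (3 %| b)%Z -> ~~ (3 %| c)%Z ->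
  x = e1 + (2 * a)%:~R / 3 -> y = e2 + (2 * b)%:~R / 3 -> z = e3 + (2 * c)%:~R / 3 ->
  `|e1| + `|e2| + `|e3| <= 1/3 -> far x y z.
Proof.
move=> a3 b3 c3 Ex Ey Ez H; apply: (far_two_thirds a3 b3 Ex Ey).
by have := nrm_near_third c3 Ez; rlra.
Qed.

(** [(1 + 2 * M ^ 2) / 3] is an integer because 3 does not divide [M], and it is odd. All three
    coordinates are near multiples of 2/3, and the errors are a third of the reciprocals: the
    hyperbolic inequality is exactly what [far_thirds] requires. *)
Lemma good_coprime3 p q r : coprime 3 (p * q * r) ->
  inv p + inv q + inv r <= 1 -> good p q r.
Proof.
set M := (p * q * r)%N => M3 H.
have M0 : (0 < M)%N by case: M M3.
have /and3P[p0 q0 r0] : [&& 0 < p, 0 < q & 0 < r]%N.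
  by move: M0; rewrite !muln_gt0 andbA.
have [k Ek] : exists k : int, 3 * k = 1 + 2 * M%:Z * M%:Z.
  have [n [E|E]] : exists n : int, M%:Z = 3 * n + 1 \/ M%:Z = 3 * n - 1.
    exists ((M%:Z + 1) %/ 3)%Z; move: M3; rewrite prime_coprime //; lia.
    by exists (6 * n * n + 4 * n + 1); rewrite E; ring.
  by exists (6 * n * n - 4 * n + 1); rewrite E; ring.
have k2 : coprimez k 2.
  rewrite coprimez2; apply/negP=> /dvdzP[l El]; move: Ek; rewrite El -mulrA; move: (M%:Z * M%:Z).
  by move=> n; lia.
have kM : coprimez k M.
  by apply: (@coprimez_affine k 3 1 (2 * M%:Z)); rewrite ?coprimezE ?coprime1n // Ek; ring.
have point n A : (0 < n)%N -> (n * A = M)%N ->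
    [/\ coprimez k n, ~~ (3 %| M%:Z * A%:Z)%Z & pt k n = inv n / 3 + (2 * (M%:Z * A%:Z))%:~R / 3].
  move=> n0 nA; split.
  - by move: kM; rewrite -nA PoszM coprimezMr => /andP[].
  - rewrite dvdzE abszM /= Euclid_dvdM // negb_or -!prime_coprime // M3.
    by move: M3; rewrite -nA coprimeMr => /andP[].
  have n0' : n%:R != 0 :> R by rewrite pnatr_eq0 -lt0n.
  have {}Ek : (3 * k)%:~R = (1 + 2 * M%:Z * M%:Z)%:~R :> R by rewrite Ek.
  have nA' : n%:R * A%:R = M%:R :> R by rewrite -natrM nA.
  rewrite intrD !intrM -!pmulrn in Ek.
  rewrite /pt (_ : k%:~R = (1 + 2 * M%:R * M%:R) / 3); last by rewrite -Ek; field.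
  by rewrite !intrM -!pmulrn -[X in 2 * M%:R * X]nA'; field.
have [kp pA Ep] := point p (q * r)%N p0 (mulnA _ _ _).
have [kq qA Eq] : [/\ coprimez k q, ~~ (3 %| M%:Z * (p * r)%N%:Z)%Z &
    pt k q = inv q / 3 + (2 * (M%:Z * (p * r)%N%:Z))%:~R / 3].
  by apply: point => //; rewrite mulnA (mulnC q).
have [kr rA Er] := point r (p * q)%N r0 (mulnC _ _).
have Gp := (inv_bound p0 isT); have Gq := (inv_bound q0 isT); have Gr := (inv_bound r0 isT).
exists k; split=> //; apply: (far_thirds pA qA rA Ep Eq Er).
by rewrite !ger0_norm; rlra.
Qed.

End Thirds.

(** * Triples with exactly two largest powers of 2 *)

Section Tie.
Implicit Types (t u v x y z : R) (k h m i X Y sg : int) (p q r N A B C f e : nat).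

Lemma far_sign sg x y z : sg = 1 \/ sg = -1 ->
  btw (1 - nrm z) (nrm (x + sg%:~R * y)) (nrm (x - sg%:~R * y)) -> far x y z.
Proof.
case=> ->; first by rewrite mul1r; apply: btw_far.
by rewrite rmorphN /= mulN1r opprK /btw orbC; apply: btw_far.
Qed.

(** The hypothesis says that [1 - nrm w] lies between [nrm s] and [1 - nrm s], so one of these two
    values is on the side of [1 - nrm w] opposite to [nrm d]. *)
Lemma btw_flip (s d w : R) : dst s <= dst w ->
  btw (1 - nrm w) (nrm s) (nrm d) \/ btw (1 - nrm w) (1 - nrm s) (nrm d).
Proof.
move=> H; have [L|L] := lerP (nrm d) (1 - nrm w).
  case: (dst_cases s) (dst_cases w) => -[Es ?] [[Ew ?]|[Ew ?]].
  - by right; apply: btwP; right; rlra.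
  - by right; apply: btwP; right; rlra.
  - by left; apply: btwP; right; rlra.
  - by left; apply: btwP; right; rlra.
case: (dst_cases s) (dst_cases w) => -[Es ?] [[Ew ?]|[Ew ?]].
- by left; apply: btwP; left; rlra.
- by left; apply: btwP; left; rlra.
- by right; apply: btwP; left; rlra.
- by right; apply: btwP; left; rlra.
Qed.

(** The half sum and the half difference of two odd numbers add up to an odd number, hence have
    opposite parities; the sign decides which of them is [m]. *)
Lemma sign_sum A B : odd A -> odd B -> forall b : bool, exists sg m,
  [/\ sg = 1 \/ sg = -1, A%:Z + sg * B%:Z = 2 * m, (2 %| m)%Z = b &
    exists2 m', A%:Z - sg * B%:Z = 2 * m' & (2 %| m')%Z = ~~ b].
Proof.
move=> oA oB b; have [m [m' [E E']]] : exists m m' : int, A%:Z + B%:Z = 2 * m /\ A%:Z - B%:Z = 2 * m'.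
  by exists ((A + B)./2%:Z), ((A + B)./2%:Z - B%:Z); lia.
have [H|H] := eqVneq (2 %| m)%Z b.
  exists 1, m; split; rewrite ?mul1r //; [by left | exists m' => //; lia].
exists (-1), m'; split; rewrite ?mulN1r ?opprK //; first by right.
  by case: b H; lia.
by exists m => //; case: b H; lia.
Qed.

(* The two points differing by [2 ^ e.+1 * N] in [k] have the same coordinates
   modulo [Lambda], except that one of [x + y] and [x - y] moves by 1. *)
Lemma tie_sign p q r e e3 A B C N :
  dec p e.+2 A N -> dec q e.+2 B N -> dec r e3 C N -> (e3 <= e.+1)%N ->
  exists sg m, [/\ sg = 1 \/ sg = -1, A%:Z + sg * B%:Z = 2 * m, (2 %| m)%Z = (e3 == e.+1) &
    forall k, uN k N -> dst (pt k p + sg%:~R * pt k q) <= dst (pt k r) -> good p q r].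
Proof.
move=> dp dq dr l3; have [_ oA _ _] := dp; have [_ oB _ _] := dq.
have [sg [m [Hsg E Em [m' E' Em']]]] := sign_sum oA oB (e3 == e.+1).
exists sg, m; split=> // k uk /btw_flip H.
have {H} := H (pt k p - sg%:~R * pt k q).
pose k' := k + 2 ^+ e.+1 * N%:Z.
have uk' : uN k' N by apply: uN_shift2.
have [m3 E3 H3] := shift_int dr l3.
have Er : pt k' r = pt k r + m3%:~R by rewrite pt_add E3.
have Es : pt k' p + sg%:~R * pt k' q = pt k p + sg%:~R * pt k q + m%:~R.
  by rewrite !pt_add (shift_half dp) (shift_half dq) (intr_divE E) // intrD intrM; field.
have Ed : pt k' p - sg%:~R * pt k' q = pt k p - sg%:~R * pt k q + m'%:~R.
  by rewrite !pt_add (shift_half dp) (shift_half dq) (intr_divE E') // intrB intrM; field.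
case=> [H|H].
  by apply: (good_intro dp dq dr uk); apply: far_sign Hsg H.
apply: (good_intro dp dq dr uk'); apply: (far_sign Hsg).
rewrite Er Es Ed; move: Em Em' H3; rewrite ltn_neqAle l3 andbT.
have [_|_] := eqVneq e3 e.+1 => /= Em Em' H3.
  rewrite (@nrm_even (_ + _) m) ?Em // (@nrm_odd _ m3) ?H3 // (@nrm_odd _ m') ?Em' //.
  by move: H; rewrite /btw => /orP[] /andP[? ?]; apply: btwP; [right|left]; rlra.
by rewrite (@nrm_odd _ m) ?Em // !nrm_even ?Em' ?H3.
Qed.

Lemma pt_small_comb (E : nat) k p q e A B N sg m :
  dec p e A N -> dec q e B N -> k = E%:Z + N%:Z -> A%:Z + sg * B%:Z = 2 * m ->
  pt k p + sg%:~R * pt k q = E%:R * (inv p + sg%:~R * inv q) + m%:~R * 2 / 2 ^+ e.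
Proof.
move=> dp dq Ek E2; rewrite (small_pt dp Ek) (small_pt dq Ek) (intr_divE E2) // intrD intrM.
by field; rewrite !(dec_neq0 dp, dec_neq0 dq) expf_neq0 ?pnatr_eq0.
Qed.

Lemma sign_norm sg x y : sg = 1 \/ sg = -1 -> 0 < x -> 0 < y ->
  `|x + sg%:~R * y| <= x + y.
Proof.
move=> Hsg x0 y0; have E : `|sg%:~R * y| = y.
  by case: Hsg => ->; rewrite ?rmorphN ?mulN1r ?normrN ?mul1r gtr0_norm.
by have := ler_normD x (sg%:~R * y); rewrite E (gtr0_norm x0).
Qed.

Lemma dst_quarter_sign sg m k p q e A B N : dec p e.+3 A N -> dec q e.+3 B N ->
  A%:Z + sg * B%:Z = 2 * m ->
  pt (k + 2 ^+ e.+1 * N%:Z) p + sg%:~R * pt (k + 2 ^+ e.+1 * N%:Z) q =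
  pt k p + sg%:~R * pt k q + m%:~R / 2.
Proof.
move=> dp dq E2; rewrite !pt_add (shift_quarter dp) (shift_quarter dq).
by rewrite (intr_divE E2) // intrD intrM; field.
Qed.

Lemma uN1 N : uN 1 N. Proof. by rewrite /uN !coprimezE !coprime1n. Qed.

(** Here [m] is odd, so adding [2 ^ e.+1 * N] reflects the distance of [x + sg * y] about 1/4. It
    can be made at most 1/4 while [k / r] keeps a distance of at least 1/4. *)
Lemma tie_gap p q r e e3 A B C N :
  dec p e.+3 A N -> dec q e.+3 B N -> dec r e3 C N -> (e3 <= e.+1)%N ->
  (1 < r)%N -> r != 6%N -> good p q r.
Proof.
move=> dp dq dr l3 r1 r6.
have [sg [m [Hsg E Em F]]] := tie_sign dp dq dr (leqW l3).
have om : ~~ (2 %| m)%Z by rewrite Em neq_ltn ltnS l3.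
have [k [uk Dr]] := exists_dst_ge_quarter dr r1 r6.
have [H|H] := lerP (dst (pt k p + sg%:~R * pt k q)) (1/4).
  by apply: (F k uk); rlra.
apply: (F (k + 2 ^+ e.+1 * N%:Z)); first exact: uN_shift2.
rewrite (dst_quarter_sign _ dp dq E) dst_half_int // (dst_shift_int k dr l3).
rlra.
Qed.

Lemma tie_gap_6 p q e A B C N :
  dec p e.+3 A N -> dec q e.+3 B N -> dec 6 1 C N ->
  inv p + inv q <= 1/6 -> good p q 6.
Proof.
move=> dp dq dr H.
have [sg [m [Hsg E Em F]]] := tie_sign dp dq dr isT.
apply: (F 1 (uN1 N)).
have p0 := dec_pos dp; have q0 := dec_pos dq.
have := sign_norm Hsg p0 q0; rewrite dst_pt6 // /pt !mul1r.
by have := dst_le (inv p + sg%:~R * inv q) 0; rewrite subr0; rlra.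
Qed.

Lemma dec_ge8 p e A N : dec p e.+3 A N -> (8 <= p)%N.
Proof.
case/dec_form=> p' op' ->; rewrite -[e.+3]/(3 + e)%N expnD -mulnA.
have := expn_gt0 2 e; have := odd_gt0 op' => p0 e0; nia.
Qed.

(** Here [m] is even, so the same shift moves [x + sg * y] by an integer and reflects the distance
    of [k / r] instead. Starting from [k = 1], the former distance is at most 1/8 + 1/8. *)
Lemma tie_adjacent p q r e A B C N :
  dec p e.+3 A N -> dec q e.+3 B N -> dec r e.+2 C N -> good p q r.
Proof.
move=> dp dq dr.
have [sg [m [Hsg E Em F]]] := tie_sign dp dq dr (leqnn _).
rewrite eqxx in Em; have [m2 Em2] := dvdzP Em.
have p0 := dec_pos dp; have q0 := dec_pos dq.
have H1 : dst (pt 1 p + sg%:~R * pt 1 q) <= 1/4.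
  have := sign_norm Hsg p0 q0; rewrite /pt !mul1r.
  have := dst_le (inv p + sg%:~R * inv q) 0; rewrite subr0.
  by have := inv_bound (dec_ge8 dp) isT; have := inv_bound (dec_ge8 dq) isT; rlra.
have [H|H] := lerP (1/4) (dst (pt 1 r)).
  by apply: (F 1 (uN1 N)); rlra.
apply: (F (1 + 2 ^+ e.+1 * N%:Z)); first by apply: uN_shift2 => //; apply: uN1.
rewrite (dst_quarter_sign _ dp dq E) (dst_shift_half _ dr) Em2 intrM.
rewrite (_ : m2%:~R * _ / 2 = m2%:~R); last by field.
by rewrite dst_int; rlra.
Qed.

(** For [k] near 1/2, [x + sg * y] is near an odd multiple of 1/4 and [z] near 1/2; the margin is
    1/4 and the errors are half the reciprocals. *)
Lemma tie_220 p q r A B C N :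
  dec p 2 A N -> dec q 2 B N -> dec r 0 C N ->
  inv p + inv q + inv r <= 1/2 -> good p q r.
Proof.
move=> dp dq dr H; have [_ _ oN _] := dp.
have [sg [m [Hsg E Em F]]] := tie_sign dp dq dr isT.
have p0 := dec_pos dp; have q0 := dec_pos dq.
have [k [Ek uk]] := exists_half oN.
apply: (F k uk); have := half_dst0 dr Ek.
have : pt k p + sg%:~R * pt k q = (inv p + sg%:~R * inv q) / 2 + (N%:Z * m)%:~R / 4.
  rewrite (half_pt dp Ek) (half_pt dq Ek) (intrM _ N m) (intr_divE E) // intrD intrM.
  by field; rewrite !(dec_neq0 dp, dec_neq0 dq).
have oNm : ~~ (2 %| N%:Z * m)%Z.
  by have := odd_dvdz oN; rewrite -!coprimez2 coprimezMl => ->; rewrite coprimez2 Em.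
move/(dst_odd4 oNm); rewrite normrM (@ger0_norm _ 2^-1) ?invr_ge0 //.
by have := sign_norm Hsg p0 q0; rlra.
Qed.

(** With [k = 2 + N], the evenness of [m] makes [x + sg * y] an integer up to [2 / p + 2 / q], while
    [z] is at most [2 / r] away from 1/2. *)
Lemma tie_221 p q r A B C N :
  dec p 2 A N -> dec q 2 B N -> dec r 1 C N ->
  (r == 2%N) || (inv p + inv q + inv r <= 1/4) -> good p q r.
Proof.
move=> dp dq dr H; have [_ _ oN _] := dp.
have [sg [m [Hsg E Em F]]] := tie_sign dp dq dr isT.
rewrite eqxx in Em; have [m2 Em2] := dvdzP Em.
have p0 := dec_pos dp; have q0 := dec_pos dq.
have uk : uN (2%:Z + N%:Z) N by apply: (@uN_small 2) => //; rewrite coprime2n.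
apply: (F _ uk); case/orP: H => [/eqP r2|H].
  by rewrite r2 dst_pt2 ?dst_le_half //; case/andP: uk.
have := small_dst1 (E:=2) dr erefl.
rewrite (pt_small_comb dp dq erefl E) Em2 intrM (_ : m2%:~R * 2%:~R * 2 / 2 ^+ 2 = m2%:~R); last by field.
rewrite dst_int; have := dst_le (2 * (inv p + sg%:~R * inv q)) 0; rewrite subr0 normrM (@ger0_norm _ 2) //.
by have := sign_norm Hsg p0 q0; rlra.
Qed.

(** The multiplier [4 + N] makes the contribution [4 / 4] of the first number an integer, so that it
    causes no error. *)
Lemma tie_221_4 q r A B C N :
  dec 4 2 A N -> dec q 2 B N -> dec r 1 C N ->
  inv q + inv r <= 1/8 -> good 4%N q r.
Proof.
move=> dp dq dr H; have [_ _ oN _] := dp.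
have [sg [m [Hsg E Em F]]] := tie_sign dp dq dr isT.
rewrite eqxx in Em; have [m2 Em2] := dvdzP Em.
have q0 := dec_pos dq.
have uk : uN (4%:Z + N%:Z) N by apply: (@uN_small 4) => //; rewrite (@coprimeXl 2 2) ?coprime2n.
apply: (F _ uk); have := small_dst1 (E:=4) dr erefl.
rewrite (pt_small_comb dp dq erefl E) Em2 intrM.
rewrite (_ : 4 * _ + _ = sg%:~R * (4 * inv q) + (1 + m2)%:~R); last by rewrite intrD; field; rewrite (dec_neq0 dq).
rewrite dst_int; have := dst_le (sg%:~R * (4 * inv q)) 0; rewrite subr0.
have -> : `|sg%:~R * (4 * inv q)| = 4 * inv q.
  by case: Hsg => ->; rewrite ?rmorphN ?mulN1r ?normrN ?mul1r gtr0_norm //; rlra.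
rlra.
Qed.

End Tie.

(** * 3-adic translations *)

Section ThreeAdic.
Implicit Types (t u v x y z : R) (k h m i j X Y sg : int) (p q r N A B C P Q U L M f e : nat).

Lemma dvdn_fact p P M : (p * P = M)%N -> (p %| M)%N.
Proof. by move=> <-; apply: dvdn_mulr. Qed.

Lemma good_intro_dvd k p q r M : uN k M -> (p %| M)%N -> (q %| M)%N -> (r %| M)%N ->
  far (pt k p) (pt k q) (pt k r) -> good p q r.
Proof.
by case/andP=> k2 kM pM qM rM H; exists k; split=> //; apply: coprimez_dvdr kM.
Qed.

Lemma pt_third_shift p P L j : (0 < p)%N -> (p * P = 3 * L)%N ->
  pt (2 * L%:Z * j) p = (2 * (P%:Z * j))%:~R / 3.
Proof.
move=> p0 E; have p0' : p%:R != 0 :> R by rewrite pnatr_eq0 -lt0n.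
have {}E : p%:R * P%:R = 3 * L%:R :> R by rewrite -!natrM E natrM.
rewrite /pt !intrM -!pmulrn (_ : L%:R = p%:R * P%:R / 3); last by rewrite E; field.
by field.
Qed.

(** As 3 divides [L], a number prime to [L] is prime to [3 * L], and the shift does not change [k]
    modulo [L]. *)
Lemma uN_third_shift k L j : (3 %| L)%N -> uN k (3 * L) -> uN (k + 2 * L%:Z * j) (3 * L).
Proof.
move=> L3 /andP[k2 kL]; apply/andP; split.
  by move: k2; rewrite !coprimez2 -mulrA; move: (L%:Z * j) => X; lia.
have kL' : coprimez (k + 2 * L%:Z * j) L.
  apply: (@coprimez_affine _ 1 k (2 * j)); first by ring.
  by apply: coprimez_dvdr kL; rewrite dvdn_mull.
rewrite PoszM coprimezMr kL' andbT; exact: coprimez_dvdr kL'.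
Qed.

(** The cofactors prime to 3 say that the three numbers contain the same power of 3. Shifting 1 by
    [2 * L * j] then puts each coordinate near a nonzero multiple of 2/3, with the reciprocals
    themselves as errors. *)
Lemma good_equal3 p q r P Q U L :
  (0 < p)%N -> (0 < q)%N -> (0 < r)%N ->
  (p * P = 3 * L)%N -> (q * Q = 3 * L)%N -> (r * U = 3 * L)%N ->
  ~~ (3 %| P)%N -> ~~ (3 %| Q)%N -> ~~ (3 %| U)%N ->
  inv p + inv q + inv r <= 1/3 -> good p q r.
Proof.
move=> p0 q0 r0 pP qQ rU P3 Q3 U3 H.
(* If 3 does not divide [L], the shift changes the multiplier modulo 3, and one of the signs of [j]
   may be forbidden. *)
have [j j3 kj3] : exists2 j, ~~ (3 %| j)%Z & ~~ (3 %| 1 + 2 * L%:Z * j)%Z.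
  case: (boolP (3 %| 1 + 2 * L%:Z)%Z) => L3; first by exists (-1) => //; lia.
  by exists 1 => //; rewrite mulr1.
have uk : uN (1 + 2 * L%:Z * j) (3 * L).
  rewrite /uN coprimez2 PoszM coprimezMr; apply/and3P; split.
  - by rewrite -mulrA; move: (_ * j) => X; lia.
  - by rewrite coprimez_sym coprimezE prime_coprime // -(dvdzE 3).
  - apply: (@coprimez_affine _ 1 1 (2 * j)); first by ring.
    by rewrite coprimezE coprime1n.
have point n V : (0 < n)%N -> (n * V = 3 * L)%N -> ~~ (3 %| V)%N ->
    ~~ (3 %| V%:Z * j)%Z /\ pt (1 + 2 * L%:Z * j) n = inv n + (2 * (V%:Z * j))%:~R / 3.
  move=> n0 nV V3; split; last by rewrite pt_add (pt_third_shift _ n0 nV) /pt mul1r.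
  by rewrite dvdzE abszM Euclid_dvdM // negb_or V3 -(dvdzE 3).
have [p3 Ep] := point p P p0 pP P3; have [q3 Eq] := point q Q q0 qQ Q3.
have [r3 Er] := point r U r0 rU U3.
apply: (good_intro_dvd uk (dvdn_fact pP) (dvdn_fact qQ) (dvdn_fact rU)).
apply: (far_thirds p3 q3 r3 Ep Eq Er).
by rewrite !ger0_norm ?invr_ge0.
Qed.

(** Modulo 9 the numbers [V + 3 * d * t], for [t] modulo 3, fill a nonzero class modulo 3; exactly
    one of them is 1 or -1, and the other two are allowed. Exactly one [t] violates the first
    condition, so at least one [t] remains. *)
Lemma residue_ninths X V (c d : int) : ~~ (3 %| V)%Z -> c = 1 \/ c = -1 -> d = 1 \/ d = -1 ->
  exists2 t : int, ~~ (3 %| X + 2 * (c * t))%Z &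
    [|| (9 %| V + 3 * (d * t) - 2)%Z, (9 %| V + 3 * (d * t) + 2)%Z,
     (9 %| V + 3 * (d * t) - 4)%Z | (9 %| V + 3 * (d * t) + 4)%Z].
Proof.
move=> V3 Hc Hd; pose ok (x v a b t : int) := ~~ (3 %| x + 2 * (a * t))%Z &&
  [|| (9 %| v + 3 * (b * t) - 2)%Z, (9 %| v + 3 * (b * t) + 2)%Z,
   (9 %| v + 3 * (b * t) - 4)%Z | (9 %| v + 3 * (b * t) + 4)%Z].
have table : all (fun x : int => all (fun v : int => all (fun a : int => all (fun b : int =>
    (3 %| v)%Z || has (ok x v a b) [:: 0; 1; -1]) [:: 1; -1]) [:: 1; -1])
    (map Posz (iota 0 9))) (map Posz (iota 0 3)) by vm_compute.
have mem (n : nat) (k : int) : 0 <= k < n%:Z -> k \in map Posz (iota 0 n).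
  by case: k => // k Hk; apply: map_f; rewrite mem_iota.
have pm k : k = 1 \/ k = -1 -> k \in [:: 1; -1 : int] by case=> ->.
have x0 : 0 <= (X %% 3)%Z < 3%:Z by lia.
have v0 : 0 <= (V %% 9)%Z < 9%:Z by lia.
have /allP/(_ _ (mem _ _ v0))/allP/(_ _ (pm _ Hc))/allP/(_ _ (pm _ Hd)) := allP table _ (mem _ _ x0).
case/orP=> [v3|/hasP[t _ /andP[xt vt]]]; first by move: V3 v3; clear; lia.
exists t; first by move: xt; move: (c * t); clear => y; lia.
move: (d * t) vt; clear => y.
by case/or4P=> H; [apply/or4P/Or41 | apply/or4P/Or42 | apply/or4P/Or43 | apply/or4P/Or44]; lia.
Qed.

(** Only [r] is divisible by 3. A multiplier [k] with [3 * k] congruent to 1 modulo [M] puts [x] and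
    [y] near multiples of 2/3 and [z] near a multiple of 2/9. The parameter [t] keeps [k] prime to 3
    and makes [nrm z] near 4/9 or 8/9, so that [1 - nrm z] has distance 1/9 to the ends of
    [0, 2/3]. *)
Lemma good_single3 p q r P Q U M :
  (0 < p)%N -> (0 < q)%N -> (0 < r)%N ->
  (p * P = M)%N -> (q * Q = M)%N -> (r * U = 3 * M)%N -> ~~ (3 %| M)%N -> ~~ (3 %| U)%N ->
  inv p + inv q + inv r <= 1/3 -> good p q r.
Proof.
move=> p0 q0 r0 pP qQ rU M3 U3 H.
have [a [e [EM He]]] : exists a e : int, M%:Z = 3 * a + e /\ (e = 1 \/ e = -1).
  by exists ((M%:Z + 1) %/ 3)%Z, (M%:Z - 3 * ((M%:Z + 1) %/ 3)%Z); lia.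
have [b [d [EU Hd]]] : exists b d : int, U%:Z = 3 * b + d /\ (d = 1 \/ d = -1).
  by exists ((U%:Z + 1) %/ 3)%Z, (U%:Z - 3 * ((U%:Z + 1) %/ 3)%Z); lia.
have MU3 : ~~ (3 %| U%:Z * M%:Z)%Z by rewrite -PoszM dvdzE /= Euclid_dvdM // negb_or U3.
(* With [M = 3 * a + e], the multiplier [(1 + 2 * M * (M + 3 * t)) / 3] is
   [1 + 4 * a * e + 2 * e * t] modulo 3. *)
have [t kt Ht] := residue_ninths (1 + 4 * (a * e)) MU3 He Hd.
have [s Es] : exists s, U%:Z * (M%:Z + 3 * t) = U%:Z * M%:Z + 3 * (d * t) + 9 * s.
  by exists (b * t); rewrite mulrDr EU; ring.
have [k Ek] : exists k : int, 3 * k = 1 + 2 * M%:Z * (M%:Z + 3 * t) /\ ~~ (3 %| k)%Z.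
  have [l El] : exists l, 1 + 2 * M%:Z * (M%:Z + 3 * t) = 3 * (1 + 4 * (a * e) + 2 * (e * t) + 3 * l).
    exists (2 * a * a + 2 * a * t); rewrite EM.
    have e2 : e * e = 1 by case: He => ->.
    have -> : 1 + 2 * (3 * a + e) * (3 * a + e + 3 * t) =
       1 + 2 * (e * e) + 18 * a * a + 12 * (a * e) + 18 * a * t + 6 * (e * t) by ring.
    by rewrite e2; ring.
  exists (1 + 4 * (a * e) + 2 * (e * t) + 3 * l); rewrite El; split=> //.
  by move: kt; move: (1 + _ + _) => X; lia.
case: Ek => Ek k3.
have k2 : coprimez k 2.
  rewrite coprimez2; move: Ek; rewrite -mulrA; move: (M%:Z * _) => X; lia.
have kM : coprimez k M.
  apply: (@coprimez_affine k 3 1 (2 * (M%:Z + 3 * t))); last by rewrite coprimezE coprime1n.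
  by rewrite Ek; ring.
have uk : uN k (3 * M).
  rewrite /uN k2 PoszM coprimezMr kM andbT.
  by rewrite coprimez_sym coprimezE prime_coprime // -(dvdzE 3).
have EkR : k%:~R = (1 + 2 * (M%:Z * (M%:Z + 3 * t))%:~R) / 3 :> R.
  have : (3 * k)%:~R = (1 + 2 * M%:Z * (M%:Z + 3 * t))%:~R :> R by rewrite Ek.
  by rewrite -mulrA intrD (@intrM _ 3) (@intrM _ 2) => E0; rlra.
have point n V : (0 < n)%N -> (n * V = M)%N ->
    ~~ (3 %| V%:Z * (M%:Z + 3 * t))%Z /\
    pt k n = inv n / 3 + (2 * (V%:Z * (M%:Z + 3 * t)))%:~R / 3.
  move=> n0 nV; split.
    rewrite dvdzE abszM Euclid_dvdM // negb_or; apply/andP; split.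
      by apply: contra M3; rewrite -nV; apply: dvdn_mull.
    by rewrite -(dvdzE 3); move: M3; clear; lia.
  have n0' : n%:R != 0 :> R by rewrite pnatr_eq0 -lt0n.
  rewrite /pt EkR -nV PoszM !intrM -!pmulrn; field; exact: n0'.
have [p3 Ep] := point p P p0 pP; have [q3 Eq] := point q Q q0 qQ.
have r0' : r%:R != 0 :> R by rewrite pnatr_eq0 -lt0n.
have Er : pt k r = inv r / 3 + (2 * (U%:Z * (M%:Z + 3 * t)))%:~R / 9.
  have EM' : M%:R = r%:R * U%:R / 3 :> R.
    by rewrite -natrM rU natrM; field.
  rewrite /pt EkR !intrM -!pmulrn EM'; field; exact: r0'.
have rp : 0 < inv r by rewrite invr_gt0 ltr0n.
have pp : 0 < inv p by rewrite invr_gt0 ltr0n.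
have qp : 0 < inv q by rewrite invr_gt0 ltr0n.
have Nr : 4/9 - inv r / 3 <= nrm (pt k r) <= 8/9 + inv r / 3.
  have Ne : `|inv r / 3| = inv r / 3 by rewrite ger0_norm; rlra.
  have F (c : nat) : (c <= 9)%N ->
    ((2 * 9)%:Z %| 2 * (U%:Z * (M%:Z + 3 * t)) - c%:Z)%Z ||
     ((2 * 9)%:Z %| 2 * (U%:Z * (M%:Z + 3 * t)) + c%:Z)%Z ->
    c%:R / 9 - inv r / 3 <= nrm (pt k r) <= c%:R / 9 + inv r / 3.
    by move=> c9 H9; have := nrm_frac (D:=9%N) isT c9 H9 Er; rewrite Ne.
  have [H4|H8] :
    ((2 * 9)%:Z %| 2 * (U%:Z * (M%:Z + 3 * t)) - 4)%Z ||
     ((2 * 9)%:Z %| 2 * (U%:Z * (M%:Z + 3 * t)) + 4)%Z \/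
    ((2 * 9)%:Z %| 2 * (U%:Z * (M%:Z + 3 * t)) - 8)%Z ||
     ((2 * 9)%:Z %| 2 * (U%:Z * (M%:Z + 3 * t)) + 8)%Z.
    rewrite Es; move: Ht; move: (U%:Z * M%:Z + _) => X; clear.
    by case/or4P=> H; [left | left | right | right]; apply/orP; [left|right|left|right]; lia.
    by have := F 4%N isT H4; rlra.
  by have := F 8%N isT H8; rlra.
apply: (good_intro_dvd uk (dvdn_mull _ (dvdn_fact pP)) (dvdn_mull _ (dvdn_fact qQ)) (dvdn_fact rU)).
apply: (far_two_thirds p3 q3 Ep Eq).
by rewrite !ger0_norm; rlra.
Qed.

(** The translations by multiples of 2/3 divide the circle of length 2 into three equal arcs, so one
    of them brings [t] within 1/3 of an even integer. *)
Lemma nrm_third_le t Y : ~~ (3 %| Y)%Z -> exists j, nrm (t + (2 * (Y * j))%:~R / 3) <= 1/3.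
Proof.
move=> Y3; have [i [_ H]] := nrmP t.
have [m [d [EY Hd]]] : exists m d : int, Y = 3 * m + d /\ (d = 1 \/ d = -1).
  by exists ((Y + 1) %/ 3)%Z, (Y - 3 * ((Y + 1) %/ 3)%Z); lia.
have E j : nrm (t + (2 * (Y * j))%:~R / 3) = nrm (t - 2 * i%:~R + 2 * (d * j)%:~R / 3).
  rewrite -(nrm_even (t - _ + _) (m := 2 * (i + m * j))) ?dvdz_mulr //.
  by congr nrm; rewrite EY !(intrM, intrD); field.
move: (t - _) H E => u H E; have [H1|H1] := lerP u (-(1/3)).
  exists d; rewrite E (_ : d * d = 1); last by case: Hd => ->.
  by apply: le_trans (nrm_le_norm _) _; rewrite ler_norml; move: H; rewrite ler_norml; rlra.
have [H2|H2] := lerP u (1/3).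
  exists 0; rewrite E; apply: le_trans (nrm_le_norm _) _.
  by rewrite ler_norml mulr0; rlra.
exists (- d); rewrite E (_ : d * - d = -1); last by case: Hd => ->.
by apply: le_trans (nrm_le_norm _) _; rewrite ler_norml; move: H; rewrite ler_norml; rlra.
Qed.

Lemma nrm_third_ge t Y : ~~ (3 %| Y)%Z -> exists j, 2/3 <= nrm (t + (2 * (Y * j))%:~R / 3).
Proof.
move=> /(nrm_third_le (t + 1))[j Hj]; exists j.
by move: Hj; rewrite addrAC nrm_add1; rlra.
Qed.

Lemma sign_sum3 P Q : ~~ (3 %| P)%N -> ~~ (3 %| Q)%N -> exists sg m,
  [/\ sg = 1 \/ sg = -1, P%:Z - sg * Q%:Z = 3 * m & ~~ (3 %| P%:Z + sg * Q%:Z)%Z].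
Proof.
move=> P3 Q3; case: (boolP (3 %| P%:Z - Q%:Z)%Z) => H.
  exists 1, ((P%:Z - Q%:Z) %/ 3)%Z; rewrite mul1r; split; [by left | lia | lia].
exists (-1), ((P%:Z + Q%:Z) %/ 3)%Z; rewrite mulN1r; split; [by right | lia | lia].
Qed.

(* Adding [2 * L * j] to [k] translates [x + sg * y] by a multiple of [2/3]
   and does not move [x - sg * y] and [z] modulo 2. *)
Lemma good_third_shift k j p q r P Q U L sg m :
  (0 < p)%N -> (0 < q)%N -> (0 < r)%N ->
  (p * P = 3 * L)%N -> (q * Q = 3 * L)%N -> (r * U = 3 * L)%N -> (3 %| U)%N ->
  sg = 1 \/ sg = -1 -> P%:Z - sg * Q%:Z = 3 * m -> uN (k + 2 * L%:Z * j) (3 * L) ->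
  btw (1 - nrm (pt k r))
    (nrm (pt k p + sg%:~R * pt k q + (2 * ((P%:Z + sg * Q%:Z) * j))%:~R / 3))
    (nrm (pt k p - sg%:~R * pt k q)) -> good p q r.
Proof.
move=> p0 q0 r0 pP qQ rU /dvdnP[U' EU] Hsg Em uk'.
have -> : nrm (pt k r) = nrm (pt (k + 2 * L%:Z * j) r).
  rewrite -(nrm_even (pt k r) (m := 2 * (U'%:Z * j))) ?dvdz_mulr //; congr nrm.
  by rewrite pt_add (pt_third_shift _ r0 rU) EU PoszM !intrM; field.
have -> : nrm (pt k p - sg%:~R * pt k q) =
    nrm (pt (k + 2 * L%:Z * j) p - sg%:~R * pt (k + 2 * L%:Z * j) q).
  rewrite -(nrm_even (pt k p - _) (m := 2 * (m * j))) ?dvdz_mulr //; congr nrm.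
  rewrite !pt_add (pt_third_shift _ p0 pP) (pt_third_shift _ q0 qQ).
  by rewrite !intrM (intr_divE Em) // intrB intrM; field.
have -> : pt k p + sg%:~R * pt k q + (2 * ((P%:Z + sg * Q%:Z) * j))%:~R / 3 =
    pt (k + 2 * L%:Z * j) p + sg%:~R * pt (k + 2 * L%:Z * j) q.
  rewrite !pt_add (pt_third_shift _ p0 pP) (pt_third_shift _ q0 qQ).
  by rewrite !(intrM, intrD); field.
move=> /(far_sign Hsg).
exact: good_intro_dvd uk' (dvdn_fact pP) (dvdn_fact qQ) (dvdn_fact rU).
Qed.

(** The hypothesis on [r] puts [1 - nrm z] in [1/3, 2/3], and the shifts can bring
    [nrm (x + sg * y)] below 1/3 or above 2/3 without moving [x - sg * y] or [z] modulo 2. *)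
Lemma good_pair3 k p q r P Q U L :
  (0 < p)%N -> (0 < q)%N -> (0 < r)%N ->
  (p * P = 3 * L)%N -> (q * Q = 3 * L)%N -> (r * U = L)%N -> (3 %| L)%N ->
  ~~ (3 %| P)%N -> ~~ (3 %| Q)%N -> uN k (3 * L) -> 1/3 <= dst (pt k r) ->
  good p q r.
Proof.
move=> p0 q0 r0 pP qQ rU L3 P3 Q3 uk Hr.
have [sg [m [Hsg Em S3]]] := sign_sum3 P3 Q3.
have rU3 : (r * (3 * U) = 3 * L)%N by rewrite -rU mulnCA.
have fin j := good_third_shift p0 q0 r0 pP qQ rU3 (dvdn_mulr U (dvdnn 3)) Hsg Em
  (uN_third_shift j L3 uk).
have [Hw1 Hw2] : 1/3 <= 1 - nrm (pt k r) /\ 1 - nrm (pt k r) <= 2/3.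
  by case: (dst_cases (pt k r)) => -[E ?]; rlra.
have [H|H] := lerP (nrm (pt k p - sg%:~R * pt k q)) (1 - nrm (pt k r)).
  have [j Hj] := nrm_third_ge (pt k p + sg%:~R * pt k q) S3.
  by apply: (fin j); apply: btwP; right; rlra.
have [j Hj] := nrm_third_le (pt k p + sg%:~R * pt k q) S3.
by apply: (fin j); apply: btwP; left; rlra.
Qed.

End ThreeAdic.

(** * Two numbers congruent to 2 modulo 4 and an odd number *)

Section TieAtTwo.
Implicit Types (t u v x y z : R) (k h m i j X Y sg T : int) (p q r N A B C P Q U L M f e W : nat).

(** As [x = k / 2] with [k] odd, [x - y = k - (x + y)], so [nrm (x - y) = 1 - nrm (x + y)]. It
    remains to compare distances: that of [x + y] is at most [1/4 + 1 / (2 * q)], that of [z] at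
    least [1/2 - 1 / (2 * r)]. *)
Lemma good_110_2 q r A B C N : dec 2 1 A N -> dec q 1 B N -> dec r 0 C N ->
  inv q + inv r <= 1/2 -> good 2%N q r.
Proof.
move=> dp dq dr H; have [_ _ oN _] := dp.
have [k [Ek uk]] := exists_half oN.
have k2 : ~~ (2 %| k)%Z by rewrite -coprimez2; case/andP: uk.
apply: (good_intro dp dq dr uk); apply: btw_far.
have := half_dst0 dr Ek; have := half_dst1 dq Ek.
have E2 : pt k 2 = k%:~R / 2 by [].
have : dst (pt k 2 + pt k q) = 1/2 - dst (pt k q).
  by rewrite addrC E2 dst_half_int.
have -> : nrm (pt k 2 - pt k q) = 1 - nrm (pt k 2 + pt k q).
  by rewrite -(nrmN (pt k 2 + pt k q)) -(nrm_odd _ k2) E2; congr nrm; field.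
move: (pt k 2 + pt k q) => s.
case: (dst_cases s) => -[-> ?]; case: (dst_cases (pt k r)) => -[-> ?] *.
- by apply: btwP; left; rlra.
- by apply: btwP; left; rlra.
- by apply: btwP; right; rlra.
- by apply: btwP; right; rlra.
Qed.

Lemma uN_double k N : uN k N -> uN k (2 * N).
Proof. by case/andP=> k2 kN; rewrite /uN PoszM coprimezMr k2. Qed.

Lemma half_pt_comb k p q e A B N sg m :
  dec p e A N -> dec q e B N -> 2 * k = 1 + N%:Z * N%:Z -> A%:Z + sg * B%:Z = 2 * m ->
  pt k p + sg%:~R * pt k q = (inv p + sg%:~R * inv q) / 2 + (N%:Z * m)%:~R / 2 ^+ e.
Proof.
move=> dp dq Ek E2; rewrite (half_pt dp Ek) (half_pt dq Ek) (intrM _ N m) (intr_divE E2) // intrD intrM.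
by field; rewrite !(dec_neq0 dp, dec_neq0 dq) expf_neq0 ?pnatr_eq0.
Qed.

Lemma sign_normB sg x y : sg = 1 \/ sg = -1 -> 0 < x -> 0 < y ->
  `|x - sg%:~R * y| <= x + y.
Proof.
move=> Hsg; rewrite -mulNr -rmorphN; apply: sign_norm.
by case: Hsg => ->; [right | left; rewrite opprK].
Qed.

Lemma dst_ge_half t x : 1/2 - x <= dst t -> 1/2 - x <= nrm t <= 1/2 + x.
Proof. by case: (dst_cases t) => -[-> ?] ?; rlra. Qed.

Lemma nrm_pt3 k : coprimez k 2 -> coprimez k 3 -> nrm (pt k 3) = 1/3.
Proof.
rewrite coprimez2 => k2; rewrite coprimez_sym coprimezE prime_coprime // => k3.
have E : pt k 3 = 0 + k%:~R / 3%:R by rewrite add0r.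
have H : ((2 * 3)%:Z %| k - 1)%Z || ((2 * 3)%:Z %| k + 1)%Z \/ (6 %| k - 3)%Z by lia.
case: H => [H|H]; last by move: k3; lia.
by have := nrm_frac (c:=1) (D:=3%N) isT isT H E; rewrite normr0 subr0 addr0 => ?; rlra.
Qed.

(** Here [1 - nrm z] is always 2/3. With [k = 2 + N] and [m] even, [x + sg * y] is near an even and
    [x - sg * y] near an odd integer, within [2 / p + 2 / q]. *)
Lemma good_110_3 p q A B C N : dec p 1 A N -> dec q 1 B N -> dec 3 0 C N ->
  inv p + inv q <= 1/6 -> good p q 3.
Proof.
move=> dp dq dr H; have [_ oA oN _] := dp; have [_ oB _ _] := dq.
have p0 := dec_pos dp; have q0 := dec_pos dq.
have uk : uN (2%:Z + N%:Z) N by apply: (@uN_small 2) => //; rewrite coprime2n.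
have [sg [m [Hsg E Em [m' E' Em']]]] := sign_sum oA oB true.
apply: (good_intro dp dq dr uk); apply: (far_sign Hsg).
rewrite nrm_pt3; [|by case/andP: uk | exact: uN_dec dr uk].
have Hs := pt_small_comb dp dq (erefl (2%:Z + N%:Z)) E.
have E'' : A%:Z + - sg * B%:Z = 2 * m' by rewrite mulNr.
have := pt_small_comb dp dq (erefl (2%:Z + N%:Z)) E''.
rewrite mulrNz !mulNr => Hd.
have H1 := sign_norm Hsg p0 q0; have H2 := sign_normB Hsg p0 q0.
have [n En] := dvdzP Em.
have {}Hs : pt (2%:Z + N%:Z) p + sg%:~R * pt (2%:Z + N%:Z) q = 2 * (inv p + sg%:~R * inv q) + (2 * n)%:~R.
  by rewrite Hs En !intrM; field; rewrite !(dec_neq0 dp, dec_neq0 dq).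
have {}Hd : pt (2%:Z + N%:Z) p - sg%:~R * pt (2%:Z + N%:Z) q = 2 * (inv p - sg%:~R * inv q) + m'%:~R.
  by rewrite Hd; field; rewrite !(dec_neq0 dp, dec_neq0 dq).
have := nrm_near_even Hs; have := nrm_near_odd (negbT Em') Hd.
rewrite !normrM !(@ger0_norm _ 2) // => *.
by apply: btwP; left; rlra.
Qed.

(** For [j] equal to 1 or -1, the residue of the second expression up to sign depends only on the
    parity of [X2], while the sign of [j] chooses between 1 and 5 for the first. Read as sixths, the
    two values can thus be put on opposite sides of 1/2. *)
Lemma residue_top_even X1 X2 m m2 : ~~ (2 %| X1)%Z -> ~~ (3 %| m)%Z -> ~~ (3 %| m2)%Z ->
  exists j,
   [&& (12 %| 3 * X1 + 8 * (m * j) - 1)%Z || (12 %| 3 * X1 + 8 * (m * j) + 1)%Z &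
       (12 %| 6 * X2 + 16 * (m2 * j) - 4)%Z || (12 %| 6 * X2 + 16 * (m2 * j) + 4)%Z] ||
   [&& (12 %| 3 * X1 + 8 * (m * j) - 5)%Z || (12 %| 3 * X1 + 8 * (m * j) + 5)%Z &
       (12 %| 6 * X2 + 16 * (m2 * j) - 2)%Z || (12 %| 6 * X2 + 16 * (m2 * j) + 2)%Z].
Proof.
move=> H1 H2 H3.
have D2 : (12 %| 6 * X2 + 16 * m2 - 4)%Z || (12 %| 6 * X2 + 16 * m2 + 4)%Z \/
          (12 %| 6 * X2 + 16 * m2 - 2)%Z || (12 %| 6 * X2 + 16 * m2 + 2)%Z by lia.
have D1 : (12 %| 3 * X1 + 8 * m - 1)%Z || (12 %| 3 * X1 + 8 * m + 1)%Z \/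
          (12 %| 3 * X1 + 8 * m - 5)%Z || (12 %| 3 * X1 + 8 * m + 5)%Z by lia.
case: D1 D2 => [D1|D1] [D2|D2]; [exists 1 | exists (-1) | exists (-1) | exists 1]; rewrite ?mulr1 ?mulrN1; lia.
Qed.

(** Only [p] carries the full power of 3, so the shift moves [x + y] and [x - y] together. They
    become near 1/6 and 4/6, or near 5/6 and 2/6, around [1 - nrm z] near 1/2; the margin 1/6
    against half the reciprocals gives the bound 1/3. *)
Lemma good_110_top_even p q r A B C L :
  dec p 1 A (3 * L) -> dec q 1 B (3 * L) -> dec r 0 C (3 * L) -> (3 %| L)%N ->
  ~~ (3 %| A)%N -> (3 %| B)%N -> (3 %| C)%N ->
  inv p + inv q + inv r <= 1/3 -> good p q r.
Proof.
move=> dp dq dr L3 A3 B3 C3 H; have [p0 oA oN pA] := dp; have [q0 oB _ qB] := dq.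
have [r0 oC _ rC] := dr.
have Ip := dec_pos dp; have Iq := dec_pos dq; have Ir := dec_pos dr.
have [sg [m [Hsg E Em [m' E' Em']]]] := sign_sum oA oB false.
have [m2 Em2] := dvdzP Em'.
have [k [Ek uk]] := exists_half oN.
have pA' : (p * A = 3 * (2 * L))%N by rewrite pA; ring.
have qB' : (q * B = 3 * (2 * L))%N by rewrite qB; ring.
have rC' : (r * (2 * C) = 3 * (2 * L))%N by rewrite mulnCA rC; ring.
have [C' EC] := dvdnP C3.
have [j Hj] : exists j,
   [&& (12 %| 3 * ((3 * L)%N%:Z * m) + 8 * (m * j) - 1)%Z || (12 %| 3 * ((3 * L)%N%:Z * m) + 8 * (m * j) + 1)%Z &
       (12 %| 6 * ((3 * L)%N%:Z * m2) + 16 * (m2 * j) - 4)%Z || (12 %| 6 * ((3 * L)%N%:Z * m2) + 16 * (m2 * j) + 4)%Z] ||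
   [&& (12 %| 3 * ((3 * L)%N%:Z * m) + 8 * (m * j) - 5)%Z || (12 %| 3 * ((3 * L)%N%:Z * m) + 8 * (m * j) + 5)%Z &
       (12 %| 6 * ((3 * L)%N%:Z * m2) + 16 * (m2 * j) - 2)%Z || (12 %| 6 * ((3 * L)%N%:Z * m2) + 16 * (m2 * j) + 2)%Z].
  apply: residue_top_even.
  - by have := odd_dvdz oN; rewrite -!coprimez2 coprimezMl => ->; rewrite coprimez2 Em.
  - by move: E A3 B3 Hsg; clear => E A3 B3 [] ?; subst sg; lia.
  - by move: E' A3 B3 Hsg Em2; clear => E A3 B3 [] ? ?; subst sg; lia.
pose k' := k + 2 * (2 * L)%N%:Z * j.
have uk' : uN k' (3 * (2 * L)).
  apply: uN_third_shift; first by rewrite dvdn_mull.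
  by rewrite mulnCA; apply: uN_double.
apply: (good_intro_dvd uk' (dvdn_fact pA') (dvdn_fact qB') (dvdn_fact rC')).
apply: (far_sign Hsg).
have Hz : 1/2 - inv r / 2 <= dst (pt k' r).
  rewrite pt_add (pt_third_shift _ r0 rC') (_ : _ / 3 = (2 * (2 * C'%:Z * j))%:~R :> R).
    by rewrite dst_int; apply: half_dst0 dr Ek.
  by rewrite EC !PoszM !intrM; field.
have {}Hz := dst_ge_half Hz.
have Es := half_pt_comb dp dq Ek E.
have E'' : A%:Z + - sg * B%:Z = 2 * m' by rewrite mulNr.
have Ed := half_pt_comb dp dq Ek E''; rewrite mulrNz !mulNr in Ed.
have Es' : pt k' p + sg%:~R * pt k' q = (inv p + sg%:~R * inv q) / 2 +
    (3 * ((3 * L)%N%:Z * m) + 8 * (m * j))%:~R / 6%:R.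
  have -> : pt k' p + sg%:~R * pt k' q = pt k p + sg%:~R * pt k q + (2 * ((A%:Z + sg * B%:Z) * j))%:~R / 3.
    by rewrite !pt_add (pt_third_shift _ p0 pA') (pt_third_shift _ q0 qB') !(intrM, intrD); field.
  by rewrite Es E !(intrM, intrD) expr1; field; rewrite !(dec_neq0 dp, dec_neq0 dq).
have Ed' : pt k' p - sg%:~R * pt k' q = (inv p - sg%:~R * inv q) / 2 +
    (6 * ((3 * L)%N%:Z * m2) + 16 * (m2 * j))%:~R / 6%:R.
  have -> : pt k' p - sg%:~R * pt k' q = pt k p - sg%:~R * pt k q + (2 * ((A%:Z - sg * B%:Z) * j))%:~R / 3.
    by rewrite !pt_add (pt_third_shift _ p0 pA') (pt_third_shift _ q0 qB') !(intrM, intrB); field.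
  by rewrite Ed E' Em2 !(intrM, intrD) expr1; field; rewrite !(dec_neq0 dp, dec_neq0 dq).
have H1 := sign_norm Hsg Ip Iq; have H2 := sign_normB Hsg Ip Iq.
have S1 : `|(inv p + sg%:~R * inv q) / 2| = `|inv p + sg%:~R * inv q| / 2.
  by rewrite normrM (@ger0_norm _ 2^-1) ?invr_ge0.
have S2 : `|(inv p - sg%:~R * inv q) / 2| = `|inv p - sg%:~R * inv q| / 2.
  by rewrite normrM (@ger0_norm _ 2^-1) ?invr_ge0.
case/orP: Hj => /andP[J1 J2].
  have := nrm_frac (D:=6%N) (c:=1%N) isT isT J1 Es'.
  have := nrm_frac (D:=6%N) (c:=4%N) isT isT J2 Ed'.
  by rewrite S1 S2 => *; apply: btwP; left; rlra.
have := nrm_frac (D:=6%N) (c:=5%N) isT isT J1 Es'.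
have := nrm_frac (D:=6%N) (c:=2%N) isT isT J2 Ed'.
by rewrite S1 S2 => *; apply: btwP; right; rlra.
Qed.

(** Only the odd number carries the full power of 3, so the shift moves [z] alone. One combination
    of [x] and [y] is near 1/2 and the other near an integer, whose parity decides whether [nrm z]
    should be near 1/6 or 5/6. *)
Lemma good_110_top_odd p q r A B C L :
  dec p 1 A (3 * L) -> dec q 1 B (3 * L) -> dec r 0 C (3 * L) -> (3 %| L)%N ->
  (3 %| A)%N -> (3 %| B)%N -> ~~ (3 %| C)%N ->
  inv p + inv q + inv r <= 1/3 -> good p q r.
Proof.
move=> dp dq dr L3 A3 B3 C3 H; have [p0 oA oN pA] := dp; have [q0 oB _ qB] := dq.
have [r0 oC _ rC] := dr.
have Ip := dec_pos dp; have Iq := dec_pos dq; have Ir := dec_pos dr.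
have [sg [m [Hsg E Em [m' E' Em']]]] := sign_sum oA oB false.
have [m2 Em2] := dvdzP Em'.
have [k [Ek uk]] := exists_half oN.
have pA' : (p * A = 3 * (2 * L))%N by rewrite pA; ring.
have qB' : (q * B = 3 * (2 * L))%N by rewrite qB; ring.
have rC' : (r * (2 * C) = 3 * (2 * L))%N by rewrite mulnCA rC; ring.
have [A' EA] := dvdnP A3; have [B' EB] := dvdnP B3.
have oNm : ~~ (2 %| (3 * L)%N%:Z * m)%Z.
  by have := odd_dvdz oN; rewrite -!coprimez2 coprimezMl => ->; rewrite coprimez2 Em.
have Hm2 : (exists n, (3 * L)%N%:Z * m2 = 2 * n) \/ ~~ (2 %| (3 * L)%N%:Z * m2)%Z.
  move: (_ * m2); clear => X; case: (boolP (2 %| X)%Z) => HX; [left | by right].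
  by exists (X %/ 2)%Z; lia.
have Hj : (exists j, (12 %| 3 * ((3 * L)%N * C)%N%:Z + 8 * (C%:Z * j) - 1)%Z ||
      (12 %| 3 * ((3 * L)%N * C)%N%:Z + 8 * (C%:Z * j) + 1)%Z) /\
   (exists j, (12 %| 3 * ((3 * L)%N * C)%N%:Z + 8 * (C%:Z * j) - 5)%Z ||
      (12 %| 3 * ((3 * L)%N * C)%N%:Z + 8 * (C%:Z * j) + 5)%Z).
  have oX : odd (3 * L * C) by rewrite oddM oN.
  move: (3 * L * C)%N oX C3; clear => X oX C3.
  have D : (12 %| 3 * X%:Z + 8 * C%:Z - 1)%Z || (12 %| 3 * X%:Z + 8 * C%:Z + 1)%Z \/
    (12 %| 3 * X%:Z + 8 * C%:Z - 5)%Z || (12 %| 3 * X%:Z + 8 * C%:Z + 5)%Z by lia.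
  case: D => D; split; [exists 1 | exists (-1) | exists (-1) | exists 1]; rewrite ?mulr1 ?mulrN1; lia.
have Es := half_pt_comb dp dq Ek E.
have E'' : A%:Z + - sg * B%:Z = 2 * m' by rewrite mulNr.
have Ed := half_pt_comb dp dq Ek E''; rewrite mulrNz !mulNr in Ed.
have H1 := sign_norm Hsg Ip Iq; have H2 := sign_normB Hsg Ip Iq.
have {}Ed : pt k p - sg%:~R * pt k q = (inv p - sg%:~R * inv q) / 2 + ((3 * L)%N%:Z * m2)%:~R.
  by rewrite Ed Em2 expr1 !intrM; field; rewrite !(dec_neq0 dp, dec_neq0 dq).
have S1 : `|(inv p + sg%:~R * inv q) / 2| = `|inv p + sg%:~R * inv q| / 2.
  by rewrite normrM (@ger0_norm _ 2^-1) ?invr_ge0.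
have S2 : `|(inv p - sg%:~R * inv q) / 2| = `|inv p - sg%:~R * inv q| / 2.
  by rewrite normrM (@ger0_norm _ 2^-1) ?invr_ge0.
have Hs : 1/2 - (inv p + inv q) / 2 <= nrm (pt k p + sg%:~R * pt k q) <= 1/2 + (inv p + inv q) / 2.
  by apply: dst_ge_half; have := dst_odd2 oNm Es; rewrite S1; rlra.
have fin j : far (pt k p) (pt k q) (pt (k + 2 * (2 * L)%N%:Z * j) r) -> good p q r.
  have uk' : uN (k + 2 * (2 * L)%N%:Z * j) (3 * (2 * L)).
    apply: uN_third_shift; first by rewrite dvdn_mull.
    by rewrite mulnCA; apply: uN_double.
  move=> F; apply: (good_intro_dvd uk' (dvdn_fact pA') (dvdn_fact qB') (dvdn_fact rC')).
  have e2 : (2 %| 2 * (A'%:Z * j) + 2 * (B'%:Z * j) + 0)%Z by rewrite addr0 -mulrDr dvdz_mulr.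
  have := far_shift e2 F; rewrite addr0; congr far.
    by rewrite pt_add (pt_third_shift _ p0 pA') EA PoszM !intrM; field.
  by rewrite pt_add (pt_third_shift _ q0 qB') EB PoszM !intrM; field.
have Ez j : pt (k + 2 * (2 * L)%N%:Z * j) r = inv r / 2 +
    (3 * ((3 * L)%N * C)%N%:Z + 8 * (C%:Z * j))%:~R / 6%:R.
  rewrite pt_add (pt_third_shift _ r0 rC') (half_pt dr Ek) expr0 mulr1.
  by rewrite PoszM !(intrM, intrD) PoszM !intrM; field; exact: (dec_neq0 dr).
have S3 : `|inv r / 2| = inv r / 2 by rewrite ger0_norm ?divr_ge0 ?invr_ge0.
case: Hm2 => [[n En]|Hm2].
  rewrite En in Ed; have := nrm_near_even Ed; rewrite S2 => Hd.
  case: Hj => _ [j Hj]; apply: (fin j); apply: (far_sign Hsg).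
  have := nrm_frac (D:=6%N) (c:=5%N) isT isT Hj (Ez j); rewrite S3 => ?.
  by apply: btwP; right; rlra.
have := nrm_near_odd Hm2 Ed; rewrite S2 => Hd.
case: Hj => [[j Hj] _]; apply: (fin j); apply: (far_sign Hsg).
have := nrm_frac (D:=6%N) (c:=1%N) isT isT Hj (Ez j); rewrite S3 => ?.
by apply: btwP; left; rlra.
Qed.

Lemma good_110_pair_even p q r A B C L :
  dec p 1 A (3 * L) -> dec q 1 B (3 * L) -> dec r 0 C (3 * L) -> (3 %| L)%N ->
  ~~ (3 %| A)%N -> ~~ (3 %| B)%N -> (3 %| C)%N -> (3 <= r)%N -> good p q r.
Proof.
move=> dp dq dr L3 A3 B3 /dvdnP[C' EC] r3.
have [p0 oA oN pA] := dp; have [q0 oB _ qB] := dq; have [r0 oC _ rC] := dr.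
have pA' : (p * A = 3 * (2 * L))%N by rewrite pA; ring.
have qB' : (q * B = 3 * (2 * L))%N by rewrite qB; ring.
have rC' : (r * (2 * C') = 2 * L)%N.
  by move: rC; rewrite EC mulnCA expn0 mul1n; lia.
have [k [Ek uk]] := exists_half oN.
apply: (good_pair3 p0 q0 r0 pA' qB' rC') => //; first by rewrite dvdn_mull.
  by rewrite mulnCA; apply: uN_double uk.
by have := half_dst0 dr Ek; have := inv_bound r3 isT; rlra.
Qed.

(** With [k = 2 + N], the bound 12 on [r] gives the distance [1/2 - 2/12 = 1/3] that [good_pair3]
    requires. Among [r] congruent to 2 modulo 4, it leaves out 2, 6 and 10. *)
Lemma good_110_pair_mixed p q r A B C L :
  dec p 1 A (3 * L) -> dec q 0 B (3 * L) -> dec r 1 C (3 * L) -> (3 %| L)%N ->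
  ~~ (3 %| A)%N -> ~~ (3 %| B)%N -> (3 %| C)%N -> (12 <= r)%N -> good p q r.
Proof.
move=> dp dq dr L3 A3 B3 /dvdnP[C' EC] r3.
have [p0 oA oN pA] := dp; have [q0 oB _ qB] := dq; have [r0 oC _ rC] := dr.
have pA' : (p * A = 3 * (2 * L))%N by rewrite pA; ring.
have qB' : (q * (2 * B) = 3 * (2 * L))%N by rewrite mulnCA qB; ring.
have rC' : (r * C' = 2 * L)%N.
  by move: rC; rewrite EC expn1; lia.
have uk : uN (2%:Z + (3 * L)%N%:Z) (3 * L) by apply: (@uN_small 2) => //; rewrite coprime2n.
apply: (good_pair3 p0 q0 r0 pA' qB' rC') => //; first by rewrite dvdn_mull.
- by rewrite Euclid_dvdM.
- by rewrite mulnCA; apply: uN_double uk.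
by have := small_dst1 (E:=2) dr erefl; have := inv_bound r3 isT; rlra.
Qed.

Lemma odd_sum_mixed sg A B : odd A -> ~~ (2 %| A%:Z + sg * (2 * B)%N%:Z)%Z.
Proof.
by move=> oA; rewrite PoszM mulrCA; move: (sg * B%:Z) => X; lia.
Qed.

(* [T] is prime to 6: this gives both a value near 1/6 and a value near 5/6. *)
Lemma residue_sixths T (b : bool) : ~~ (2 %| T)%Z -> ~~ (3 %| T)%Z ->
  (exists2 j, j = 1 \/ j = -1 &
    (12 %| 3 * T + 4 * (T * j) + 6 * b%:Z - 1)%Z || (12 %| 3 * T + 4 * (T * j) + 6 * b%:Z + 1)%Z) /\
  (exists2 j, j = 1 \/ j = -1 &
    (12 %| 3 * T + 4 * (T * j) + 6 * b%:Z - 5)%Z || (12 %| 3 * T + 4 * (T * j) + 6 * b%:Z + 5)%Z).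
Proof.
move=> T2 T3.
have D : (12 %| 3 * T + 4 * T + 6 * b%:Z - 1)%Z || (12 %| 3 * T + 4 * T + 6 * b%:Z + 1)%Z \/
    (12 %| 3 * T + 4 * T + 6 * b%:Z - 5)%Z || (12 %| 3 * T + 4 * T + 6 * b%:Z + 5)%Z by case: b; lia.
case: D => D; split; [exists 1 | exists (-1) | exists (-1) | exists 1]; rewrite ?mulr1 ?mulrN1;
  by [left | right | case: b D; lia].
Qed.

Lemma dst_fifth : dst (1/5 : R) = 1/5.
Proof. by rewrite dst_small ger0_norm; rlra. Qed.

(** With [k = 2 + N] the distance of [k / 10] is 3/10, too small for [good_pair3]. But [x - sg * y]
    is near 1/2 here, so it suffices to bring [x + sg * y] near 1/6 or 5/6; the constant 1/15 comes
    from [1/6 + 2/15 = 3/10]. *)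
Lemma good_110_pair_10 p q A B C L :
  dec p 1 A (3 * L) -> dec q 0 B (3 * L) -> dec 10 1 C (3 * L) -> (3 %| L)%N ->
  ~~ (3 %| A)%N -> ~~ (3 %| B)%N -> inv p + inv q <= 1/15 -> good p q 10.
Proof.
move=> dp dq dr L3 A3 B3 H.
have [p0 oA oN pA] := dp; have [q0 oB _ qB] := dq; have [r0 oC _ rC] := dr.
have pA' : (p * A = 3 * (2 * L))%N by rewrite pA; ring.
have qB' : (q * (2 * B) = 3 * (2 * L))%N by rewrite mulnCA qB; ring.
have rC' : (10 * C = 3 * (2 * L))%N by rewrite rC; ring.
have C3 : (3 %| C)%N.
  have : (3 %| 10 * C)%N by rewrite rC' dvdn_mulr.
  by rewrite Euclid_dvdM.
have B3' : ~~ (3 %| 2 * B)%N by rewrite Euclid_dvdM.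
have [sg [m [Hsg Em S3]]] := sign_sum3 A3 B3'.
have S2 := odd_sum_mixed sg B oA.
have Hj := residue_sixths false S2 S3.
have Ip := dec_pos dp; have Iq := dec_pos dq.
have uk : uN (2%:Z + (3 * L)%N%:Z) (3 * L) by apply: (@uN_small 2) => //; rewrite coprime2n.
have om : ~~ (2 %| m)%Z.
  move: Em; rewrite PoszM mulrCA; move: (sg * B%:Z) oA; clear; move=> X oA; lia.
set k := 2%:Z + _ in uk.
have Ep := small_pt dp (erefl k); have Eq := small_pt dq (erefl k).
rewrite expr1 in Ep; rewrite expr0 divr1 in Eq.
have Es : pt k p + sg%:~R * pt k q = 2 * (inv p + sg%:~R * inv q) +
    (A%:Z + sg * (2 * B)%N%:Z)%:~R / 2.
  by rewrite Ep Eq PoszM !(intrM, intrD); field; rewrite !(dec_neq0 dp, dec_neq0 dq).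
have Ed : pt k p - sg%:~R * pt k q = 2 * (inv p - sg%:~R * inv q) + (3 * m)%:~R / 2.
  by rewrite -Em Ep Eq PoszM !(intrM, intrB); field; rewrite !(dec_neq0 dp, dec_neq0 dq).
have om3 : ~~ (2 %| 3 * m)%Z by move: om; clear; lia.
have H1 := sign_norm Hsg Ip Iq; have H2 := sign_normB Hsg Ip Iq.
have N2 y : `|2 * y| = 2 * `|y| by rewrite normrM ger0_norm.
have Hd : 1/2 - 2 / 15 <= nrm (pt k p - sg%:~R * pt k q) <= 1/2 + 2 / 15.
  by apply: dst_ge_half; have := dst_odd2 om3 Ed; rewrite N2; rlra.
have Hz : dst (pt k 10) = 3/10.
  rewrite (small_pt dr (erefl k)) expr1 dst_half_int ?(dec_odd dr) //.
  have -> : 2%:R * inv 10 = 1/5 by field.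
  by rewrite dst_fifth; rlra.
have fin j : btw (1 - nrm (pt k 10))
    (nrm (pt k p + sg%:~R * pt k q + (2 * ((A%:Z + sg * (2 * B)%N%:Z) * j))%:~R / 3))
    (nrm (pt k p - sg%:~R * pt k q)) -> good p q 10.
  apply: (good_third_shift p0 q0 r0 pA' qB' rC' C3 Hsg Em).
  apply: uN_third_shift; first by rewrite dvdn_mull.
  by rewrite mulnCA; apply: uN_double.
have Us j : pt k p + sg%:~R * pt k q + (2 * ((A%:Z + sg * (2 * B)%N%:Z) * j))%:~R / 3 =
    2 * (inv p + sg%:~R * inv q) +
    (3 * (A%:Z + sg * (2 * B)%N%:Z) + 4 * ((A%:Z + sg * (2 * B)%N%:Z) * j))%:~R / 6%:R.
  by rewrite Es; move: (_ + sg * _) => T; rewrite !(intrM, intrD); field; rewrite !(dec_neq0 dp, dec_neq0 dq).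
case: Hj => -[j1 _ J1] [j5 _ J5].
rewrite mulr0 addr0 in J1; rewrite mulr0 addr0 in J5.
have {J1} := nrm_frac (D:=6%N) (c:=1%N) isT isT J1 (Us j1).
have {J5} := nrm_frac (D:=6%N) (c:=5%N) isT isT J5 (Us j5).
rewrite N2 => F5 F1.
case: (dst_cases (pt k 10)) Hz => -[-> ?] Hz.
  by apply: (fin j5); apply: btwP; right; rlra.
by apply: (fin j1); apply: btwP; left; rlra.
Qed.

Lemma pt_scale h p P M : (0 < p)%N -> (p * P = M)%N -> (0 < M)%N ->
  pt h p = (h * P%:Z)%:~R / M%:R.
Proof.
move=> p0 <- M0; have p0' : p%:R != 0 :> R by rewrite pnatr_eq0 -lt0n.
have P0' : P%:R != 0 :> R by rewrite pnatr_eq0 -lt0n; move: M0; rewrite muln_gt0 => /andP[].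
by rewrite /pt natrM intrM -pmulrn; field; rewrite P0' p0'.
Qed.

Lemma uN_mul k M N : uN k M -> uN k N -> uN k (M * N).
Proof. by case/andP=> k2 kM /andP[_ kN]; rewrite /uN PoszM coprimezMr k2 kM. Qed.

Lemma uN3 k : ~~ (2 %| k)%Z -> ~~ (3 %| k)%Z -> uN k 3.
Proof.
by move=> k2 k3; rewrite /uN coprimez2 k2 coprimez_sym coprimezE prime_coprime // -(dvdzE 3).
Qed.

(** As 27 divides [N], steps of 2/9 are available: [x + sg * y] is put near 8/9, while [x - sg * y]
    moves by multiples of 2/3 and stays essentially below 2/3. The value [1 - nrm z = 5/6] lies
    between, since [1/54 + 1/27 = 8/9 - 5/6]. *)
Lemma good_110_pair_6_27 p q A B C L :
  dec p 1 A (9 * L) -> dec q 0 B (9 * L) -> dec 6 1 C (9 * L) -> (3 %| L)%N ->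
  ~~ (3 %| A)%N -> ~~ (3 %| B)%N -> good p q 6.
Proof.
move=> dp dq dr L3 A3 B3; have [L' EL] := dvdnP L3.
have [p0 oA oN pA] := dp; have [q0 oB _ qB] := dq.
rewrite expn1 in pA; rewrite expn0 mul1n in qB.
have L0 : (0 < L)%N by move: oN; clear; lia.
have p54 : (54 <= p)%N.
  apply: dvdn_leq => //; rewrite -(@Gauss_dvdl _ _ A) ?pA ?EL.
    by apply/dvdnP; exists L'; ring.
  by rewrite (_ : 54 = 2 * 3 ^ 3)%N // coprimeMl coprime2n oA; apply: coprimeXl; rewrite prime_coprime.
have q27 : (27 <= q)%N.
  apply: dvdn_leq => //; rewrite -(@Gauss_dvdl _ _ B) ?qB ?EL.
    by apply/dvdnP; exists L'; ring.
  by rewrite (_ : 27 = 3 ^ 3)%N //; apply: coprimeXl; rewrite prime_coprime.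
have B3' : ~~ (3 %| 2 * B)%N by rewrite Euclid_dvdM.
have [sg [m [Hsg Em S3]]] := sign_sum3 A3 B3'.
pose T := A%:Z + sg * (2 * B)%N%:Z.
have [j [s Ej]] : exists j s, T * j = 4 + 9 * s.
  have /coprimezP[[u v] /= uv] : coprimez T (3 ^ 2)%N.
    by rewrite coprimez_sym coprimezE coprimeXl // prime_coprime // -(dvdzE 3).
  by exists (4 * u), (- (4 * v)); rewrite mulrCA (mulrC T) -[u * T](addrK (v * 9)) uv; ring.
pose k := 1 + 2 * (2 * L)%N%:Z * j.
have uk : uN k (2 * (9 * L)).
  have k2 : coprimez k 2.
    by rewrite coprimez2 /k -mulrA; move: (_%:Z * j) => X; clear; lia.
  have uL : uN k L.
    rewrite /uN k2; apply: (@coprimez_affine _ 1 1 (4 * j)); last by rewrite coprimezE coprime1n.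
    by rewrite /k PoszM; ring.
  apply: uN_double; apply: uN_mul => //; rewrite (_ : 9 = 3 * 3)%N //.
  by apply: uN_mul; case/andP: uL => _ kL; rewrite /uN k2; apply: coprimez_dvdr kL.
have M0 : (0 < 18 * L)%N by rewrite muln_gt0.
have pA' : (p * A = 18 * L)%N by rewrite pA; ring.
have qB' : (q * (2 * B) = 18 * L)%N by rewrite mulnCA qB; ring.
have rC' : (6 * (3 * L) = 18 * L)%N by ring.
have L0' : L%:R != 0 :> R by rewrite pnatr_eq0 -lt0n.
have Ex : pt k p = inv p + (2 * (A%:Z * j))%:~R / 9.
  rewrite pt_add (pt_scale (_ * j) p0 pA' M0) /pt mul1r natrM !(PoszM, intrM) -!pmulrn.
  by congr (_ + _); field.
have Ey : pt k q = inv q + (2 * ((2 * B)%N%:Z * j))%:~R / 9.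
  rewrite pt_add (pt_scale (_ * j) q0 qB' M0) /pt mul1r natrM !(PoszM, intrM) -!pmulrn.
  by congr (_ + _); field.
have Nz : nrm (pt k 6) = 1/6.
  rewrite (_ : pt k 6 = 1/6 + (2 * (L'%:Z * j))%:~R); last first.
    by rewrite pt_add /pt mul1r EL !(PoszM, intrM) -!pmulrn; field.
  by rewrite nrm_even ?dvdz_mulr // nrm_small ger0_norm; rlra.
have Es : pt k p + sg%:~R * pt k q = (inv p + sg%:~R * inv q) + (2 * (4 + 9 * s))%:~R / 9%:R.
  rewrite -Ej Ex Ey /T !(intrM, intrD); field.
  by rewrite !(dec_neq0 dp, dec_neq0 dq).
have Ed : pt k p - sg%:~R * pt k q = (inv p - sg%:~R * inv q) + (2 * (m * j))%:~R / 3.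
  rewrite Ex Ey !intrM (intr_divE Em) // intrB intrM.
  by field; rewrite !(dec_neq0 dp, dec_neq0 dq).
apply: (good_intro_dvd uk); [exact: dvdn_fact pA | by rewrite dvdn_mull // -qB dvdn_mulr | |].
  by apply/dvdnP; exists (3 * L)%N; ring.
apply: (far_sign Hsg); rewrite Nz.
have Ip := inv_bound p54 isT; have Iq := inv_bound q27 isT.
have J : ((2 * 9)%:Z %| 2 * (4 + 9 * s) - 8)%Z || ((2 * 9)%:Z %| 2 * (4 + 9 * s) + 8)%Z by clear; lia.
have Hs := nrm_frac (D:=9%N) (c:=8%N) isT isT J Es.
have {}Hs : 8%:R / 9 - `|inv p + sg%:~R * inv q| <= nrm (pt k p + sg%:~R * pt k q).
  by case/andP: Hs.
have Hd : nrm (pt k p - sg%:~R * pt k q) <= 2/3 + `|inv p - sg%:~R * inv q|.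
  case: (boolP (3 %| m * j)%Z) => [/dvdzP[n En]|mj3].
    have : nrm (pt k p - sg%:~R * pt k q) <= `|inv p - sg%:~R * inv q|.
      by apply: (@nrm_near_even _ _ n); rewrite Ed En !intrM; field; rewrite !(dec_neq0 dp, dec_neq0 dq).
    by move=> ?; rlra.
  by case/andP: (nrm_near_third mj3 Ed).
have H1 : `|inv p + sg%:~R * inv q| <= inv p + inv q by apply: sign_norm => //; [case/andP: Ip | case/andP: Iq].
have H2 : `|inv p - sg%:~R * inv q| <= inv p + inv q by apply: sign_normB => //; [case/andP: Ip | case/andP: Iq].
by apply: btwP; right; rlra.
Qed.

Lemma residue_eighteenths V T : (12 %| V - 1)%Z || (12 %| V + 1)%Z -> ~~ (3 %| T)%Z ->
  (exists j, (36 %| V + 12 * (T * j) - 1)%Z || (36 %| V + 12 * (T * j) + 1)%Z) /\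
  (exists j, (36 %| V + 12 * (T * j) - 11)%Z || (36 %| V + 12 * (T * j) + 11)%Z).
Proof.
move=> HV HT.
have D1 : [|| (36 %| V - 1)%Z || (36 %| V + 1)%Z,
    (36 %| V + 12 * T - 1)%Z || (36 %| V + 12 * T + 1)%Z |
    (36 %| V - 12 * T - 1)%Z || (36 %| V - 12 * T + 1)%Z] by lia.
have D2 : [|| (36 %| V - 11)%Z || (36 %| V + 11)%Z,
    (36 %| V + 12 * T - 11)%Z || (36 %| V + 12 * T + 11)%Z |
    (36 %| V - 12 * T - 11)%Z || (36 %| V - 12 * T + 11)%Z] by lia.
split; [case/or3P: D1 => H | case/or3P: D2 => H];
  by [exists 0; rewrite !mulr0 addr0 | exists 1; rewrite mulr1 | exists (-1); rewrite mulrN1 mulrN].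
Qed.

Lemma square_mod12 W : odd W -> ~~ (3 %| W)%N -> exists s : int, W%:Z * W%:Z = 1 + 12 * s.
Proof.
move=> oW W3; have [a [d [E Hd]]] : exists a d : int, W%:Z = 6 * a + d /\ (d = 1 \/ d = -1).
  exists ((W%:Z + 1) %/ 6)%Z, (W%:Z - 6 * ((W%:Z + 1) %/ 6)%Z); lia.
exists (3 * a * a + a * d); rewrite E.
have e2 : d * d = 1 by case: Hd => ->.
have -> : (6 * a + d) * (6 * a + d) = d * d + 12 * (3 * a * a + a * d) by ring.
by rewrite e2.
Qed.

(* The multiplier [kap + W * (d * W + 12 * j)] is 5 or 7 modulo 12, so that [1 - nrm z = 1/6];
   [x + y] or [x - y] can be moved by multiples of [2/3] to both sides of [1/6]. *)
Lemma good_110_pair_6_9 p q A B C W :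
  dec p 1 A (9 * W) -> dec q 0 B (9 * W) -> dec 6 1 C (9 * W) -> ~~ (3 %| W)%N ->
  ~~ (3 %| A)%N -> ~~ (3 %| B)%N -> inv p + inv q <= 1/36 -> good p q 6.
Proof.
move=> dp dq dr W3 A3 B3 HI.
have [p0 oA oN pA] := dp; have [q0 oB _ qB] := dq.
rewrite expn1 in pA; rewrite expn0 mul1n in qB.
have oW : odd W by move: oN; rewrite oddM.
have W0 : (0 < W)%N by case: (W) oW.
have B3' : ~~ (3 %| 2 * B)%N by rewrite Euclid_dvdM.
have [sg [m [Hsg Em S3]]] := sign_sum3 A3 B3'.
have S2 := odd_sum_mixed sg B oA.
set T := A%:Z + _ in S3 S2.
have [s Es2] := square_mod12 oW W3.
have Ip := dec_pos dp; have Iq := dec_pos dq.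
(* As [W * W] is 1 modulo 12, the multiplier is [kap + d] modulo 12. Asking [T * d * W] to be 1 or
   -1 leads to [d = 1] or [d = 5], completed to 5 or 7 by [kap = 4] or [kap = 2], powers of 2 and
   hence prime to [W]. *)
have [kap [d [Hkap HT Hk]]] : exists kap d : int, [/\ kap = 2 \/ kap = 4,
    (12 %| T * (d * W%:Z) - 1)%Z || (12 %| T * (d * W%:Z) + 1)%Z &
    (12 %| kap + W%:Z * (d * W%:Z) - 5)%Z || (12 %| kap + W%:Z * (d * W%:Z) + 5)%Z].
  have TW2 : ~~ (2 %| T * W%:Z)%Z.
    by rewrite -coprimez2 coprimezMl !coprimez2 S2 odd_dvdz.
  have TW3 : ~~ (3 %| T * W%:Z)%Z.
    by rewrite dvdzE abszM Euclid_dvdM // negb_or W3 andbT -(dvdzE 3).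
  have [H|H] : (12 %| T * W%:Z - 1)%Z || (12 %| T * W%:Z + 1)%Z \/
     (12 %| T * W%:Z - 5)%Z || (12 %| T * W%:Z + 5)%Z by move: (T * W%:Z) TW2 TW3 => X; clear; lia.
    exists 4, 1; rewrite !mul1r Es2; split; [by right | by [] | clear; lia].
  exists 2, 5; rewrite !(mulrCA _ 5) Es2; split; [by left | move: H; clear | clear; lia].
  by move: (T * W%:Z) => X; lia.
have [[j1 J1] [j11 J11]] := residue_eighteenths HT S3.
have M0 : (0 < 18 * W)%N by rewrite muln_gt0.
have pA' : (p * A = 18 * W)%N by rewrite pA; ring.
have qB' : (q * (2 * B) = 18 * W)%N by rewrite mulnCA qB; ring.
have W0' : W%:R != 0 :> R by rewrite pnatr_eq0 -lt0n.
have kbound : 0 <= (kap%:~R : R) <= 4 by case: Hkap => ->; rlra.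
pose k j := kap + W%:Z * (d * W%:Z + 12 * j).
have Hk6 j : ((2 * 6)%:Z %| k j - 5)%Z || ((2 * 6)%:Z %| k j + 5)%Z.
  rewrite /k (_ : kap + _ = kap + W%:Z * (d * W%:Z) + 12 * (W%:Z * j)); last by ring.
  by move: (kap + _) (W%:Z * j) Hk => X Y; clear; lia.
have uk j : uN (k j) (18 * W).
  have k2 : ~~ (2 %| k j)%Z by move: (k j) (Hk6 j) => X; clear; lia.
  have k3 : ~~ (3 %| k j)%Z by move: (k j) (Hk6 j) => X; clear; lia.
  have -> : (18 * W = 2 * (3 * (3 * W)))%N by ring.
  apply: uN_double; apply: uN_mul; first exact: uN3.
  apply: uN_mul; first exact: uN3.
  rewrite /uN coprimez2 k2; apply: (@coprimez_affine _ 1 kap (d * W%:Z + 12 * j)).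
    by rewrite /k mul1r.
  by case: Hkap => ->; rewrite coprimezE /= ?coprime2n // (@coprimeXl 2 2) ?coprime2n.
have Ex j : pt (k j) p = kap%:~R * inv p + (A%:Z * (d * W%:Z + 12 * j))%:~R / 18.
  rewrite pt_add (pt_scale (W%:Z * _) p0 pA' M0) /pt natrM.
  by move: (d * W%:Z + 12 * j) => X; rewrite !intrM -!pmulrn; congr (_ + _); field.
have Ey j : pt (k j) q = kap%:~R * inv q + ((2 * B)%N%:Z * (d * W%:Z + 12 * j))%:~R / 18.
  rewrite pt_add (pt_scale (W%:Z * _) q0 qB' M0) /pt (natrM _ 18).
  by move: (d * W%:Z + 12 * j) => X; rewrite !intrM -!pmulrn; congr (_ + _); field.
have Nz j : nrm (pt (k j) 6) = 5/6.
  have E : pt (k j) 6 = 0 + (k j)%:~R / 6%:R by rewrite add0r.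
  have := nrm_frac (D:=6%N) (c:=5%N) isT isT (Hk6 j) E.
  by rewrite normr0 subr0 addr0 => ?; rlra.
have Es j : pt (k j) p + sg%:~R * pt (k j) q = kap%:~R * (inv p + sg%:~R * inv q) +
    (T * (d * W%:Z) + 12 * (T * j))%:~R / 18%:R.
  rewrite Ex Ey (_ : T * _ + _ = T * (d * W%:Z + 12 * j)); last by ring.
  rewrite /T; move: (d * W%:Z + 12 * j) => X; rewrite !(intrM, intrD); field.
  by rewrite !(dec_neq0 dp, dec_neq0 dq).
have Ed j : nrm (pt (k j) p - sg%:~R * pt (k j) q) = nrm (pt (k 0) p - sg%:~R * pt (k 0) q).
  rewrite -(nrm_even (pt (k 0) p - _) (m := 2 * (m * j))) ?dvdz_mulr //; congr nrm.
  rewrite !Ex !Ey mulr0 addr0 (intrM _ 2 (m * j)) (intrM _ m j) (intr_divE Em) // intrB.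
  by move: (d * W%:Z) => X; rewrite !(intrM, intrD); field; rewrite !(dec_neq0 dp, dec_neq0 dq).
have fin j : btw (1/6) (nrm (pt (k j) p + sg%:~R * pt (k j) q))
    (nrm (pt (k 0) p - sg%:~R * pt (k 0) q)) -> good p q 6.
  move=> H; apply: (good_intro_dvd (uk j) (dvdn_fact pA') (dvdn_fact qB')).
    by apply/dvdnP; exists (3 * W)%N; ring.
  apply: (far_sign Hsg); rewrite Nz Ed (_ : 1 - 5/6 = 1/6) //; rlra.
(* With [kap] at most 4, the bound 1/36 becomes 1/9, exactly the gap between 1/18 and 1/6. *)
have H1 : `|kap%:~R * (inv p + sg%:~R * inv q)| <= 1/9.
  have := sign_norm Hsg Ip Iq; rewrite normrM ger0_norm; last by case/andP: kbound.
  case/andP: kbound => k0 k4 H; apply: (@le_trans _ _ (4 * (inv p + inv q))); last by rlra.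
  exact: ler_pM.
have F1 := nrm_frac (D:=18%N) (c:=1%N) isT isT J1 (Es j1).
have F11 := nrm_frac (D:=18%N) (c:=11%N) isT isT J11 (Es j11).
have [H|H] := lerP (1/6) (nrm (pt (k 0) p - sg%:~R * pt (k 0) q)).
  by apply: (fin j1); apply: btwP; left; rlra.
by apply: (fin j11); apply: btwP; right; rlra.
Qed.

Lemma residue_pm T X : ~~ (2 %| X)%Z -> ~~ (3 %| T)%Z ->
  (exists2 j, j = 1 \/ j = -1 &
    (12 %| 3 * X + 8 * (T * j) - 1)%Z || (12 %| 3 * X + 8 * (T * j) + 1)%Z) /\
  (exists2 j, j = 1 \/ j = -1 &
    (12 %| 3 * X + 8 * (T * j) - 5)%Z || (12 %| 3 * X + 8 * (T * j) + 5)%Z).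
Proof.
move=> H2 H3.
have D : (12 %| 3 * X + 8 * T - 1)%Z || (12 %| 3 * X + 8 * T + 1)%Z \/
          (12 %| 3 * X + 8 * T - 5)%Z || (12 %| 3 * X + 8 * T + 5)%Z by lia.
case: D => D; split; [exists 1 | exists (-1) | exists (-1) | exists 1]; rewrite ?mulr1 ?mulrN1;
  by [left | right | lia].
Qed.

Lemma prod3 X Y : ~~ (3 %| X)%Z -> ~~ (3 %| Y)%Z -> ~~ (3 %| X * Y)%Z.
Proof. by rewrite !dvdzE abszM Euclid_dvdM // negb_or => -> ->. Qed.

Lemma even_cases X : (exists n, X = 2 * n) \/ ~~ (2 %| X)%Z.
Proof.
case: (boolP (2 %| X)%Z) => HX; [left | by right].
by exists (X %/ 2)%Z; lia.
Qed.

Section TwoMultiplesOfThree.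

Context (p q r A B C W : nat) (sg n m : int).
Context (dp : dec p 1 A (3 * W)) (dq : dec q 1 B (3 * W)) (dr : dec r 0 C (3 * W)).
Context (W3 : ~~ (3 %| W)%N) (C3 : (3 %| C)%N) (Hsg : sg = 1 \/ sg = -1).
Context (En : A%:Z + sg * B%:Z = 2 * n) (Em : A%:Z - sg * B%:Z = 3 * m).
Context (n3 : ~~ (3 %| n)%Z).

Let p0 : (0 < p)%N. Proof. by case: dp. Qed.
Let q0 : (0 < q)%N. Proof. by case: dq. Qed.
Let r0 : (0 < r)%N. Proof. by case: dr. Qed.
Let oN : odd (3 * W). Proof. by case: dr. Qed.
Let oW : odd W. Proof. by move: oN; rewrite oddM. Qed.
Let pA : (p * A = 3 * (2 * W))%N. Proof. by case: dp => _ _ _ ->; ring. Qed.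
Let qB : (q * B = 3 * (2 * W))%N. Proof. by case: dq => _ _ _ ->; ring. Qed.
Let rC : (r * (2 * C) = 3 * (2 * W))%N. Proof. by have [_ _ _ E] := dr; rewrite mulnCA E; ring. Qed.
Let Ip : 0 < inv p. Proof. exact: dec_pos dp. Qed.
Let Iq : 0 < inv q. Proof. exact: dec_pos dq. Qed.
Let Ir : 0 < inv r. Proof. exact: dec_pos dr. Qed.
Let pn0 : p%:R != 0 :> R. Proof. exact: dec_neq0 dp. Qed.
Let qn0 : q%:R != 0 :> R. Proof. exact: dec_neq0 dq. Qed.

(** As 3 does not divide [W], the shift changes the multiplier modulo 3. Primality to 3 is asked of
    the shifted multiplier only, so [k] may be a multiple of 3. *)
Let fin k j : uN k W -> ~~ (3 %| k + 2 * (2 * W)%N%:Z * j)%Z ->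
  btw (1 - nrm (pt k r))
    (nrm (pt k p + sg%:~R * pt k q + (2 * ((2 * n) * j))%:~R / 3))
    (nrm (pt k p - sg%:~R * pt k q)) -> good p q r.
Proof.
move=> uk k3; rewrite -En; apply: (good_third_shift p0 q0 r0 pA qB rC _ Hsg Em).
  by rewrite dvdn_mull.
case/andP: uk => k2 kW; have k2' : coprimez (k + 2 * (2 * W)%N%:Z * j) 2.
  by move: k2; rewrite !coprimez2 -mulrA; move: (_%:Z * j) => X; clear; lia.
apply: uN_mul; first by apply: uN3 => //; rewrite -coprimez2.
apply: uN_double; rewrite /uN k2'.
by apply: (@coprimez_affine _ 1 k (4 * j)) => //; rewrite PoszM; ring.
Qed.

Let W3Z : ~~ (3 %| W%:Z)%Z. Proof. by []. Qed.

(** For [k] near 1/2, [x + sg * y] is near an integer, and [1 - nrm z] near 1/2. The shift by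
    [j = - W] carries [nrm (x + sg * y)] from near 0 to near 2/3, or from near 1 to near 1/3: across
    1/2, so one choice suits any position of [x - sg * y]. *)
Lemma good_110_two3_even : (2 %| n)%Z -> inv p + inv q + inv r <= 1/3 -> good p q r.
Proof.
move=> /dvdzP[n2 En2] H.
have [k [Ek uk]] := exists_half oN.
have Hk3 : ~~ (3 %| k)%Z.
  by move: Ek; rewrite PoszM -!mulrA; move: (_ * (3%:Z * _)) => X; clear; lia.
have k3 : ~~ (3 %| k + 2 * (2 * W)%N%:Z * 0)%Z by rewrite mulr0 addr0.
(* [k] is 2 modulo 3, and this shift makes it 1; [j = W] would make it a multiple of 3. *)
have k3' : ~~ (3 %| k + 2 * (2 * W)%N%:Z * (- W%:Z))%Z.
  have [s Es] := square_mod12 oW W3.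
  have -> : 2 * (2 * W)%N%:Z * (- W%:Z) = - (4 * (W%:Z * W%:Z)) by rewrite PoszM; ring.
  rewrite Es; move: Ek; rewrite PoszM -!mulrA; move: (_ * (3%:Z * _)) => X; clear; lia.
have uW : uN k W.
  by case/andP: uk => k2; rewrite /uN k2 PoszM coprimezMr => /andP[].
have Es := half_pt_comb dp dq Ek En.
have {}Es : pt k p + sg%:~R * pt k q = (inv p + sg%:~R * inv q) / 2 + ((3 * W)%N%:Z * n2)%:~R.
  by rewrite Es En2 expr1 !intrM; field; rewrite pn0 qn0.
have Hz := dst_ge_half (half_dst0 dr Ek).
have S1 : `|(inv p + sg%:~R * inv q) / 2| <= (inv p + inv q) / 2.
  by rewrite normrM (@ger0_norm _ 2^-1) ?invr_ge0 // ler_pM2r ?invr_gt0 //; exact: sign_norm.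
have n3' : ~~ (3 %| (2 * n) * (- W%:Z))%Z.
  by apply: prod3; [exact: prod3 | move: W3Z; clear; lia].
have F0 := fin uW k3; have F1 := fin uW k3'.
move: Es F0 F1 Hz; rewrite 2!mulr0 mul0r addr0.
move: ((3 * W)%N%:Z * n2) (pt k p + _) (nrm (_ - _)) => X s D Es F0 F1 Hz.
have [[X2 EX]|oX] := even_cases X.
  rewrite EX in Es; have L0 := nrm_near_even Es.
  have L1 : 2/3 - (inv p + inv q) / 2 <= nrm (s + (2 * (2 * n * - W%:Z))%:~R / 3).
    have Es' : s + (2 * (2 * n * - W%:Z))%:~R / 3 = (inv p + sg%:~R * inv q) / 2 +
       (2 * (3 * X2 + 2 * n * - W%:Z))%:~R / 3 by rewrite Es !(intrM, intrD); lra.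
    have X3 : ~~ (3 %| 3 * X2 + 2 * n * - W%:Z)%Z.
      by move: n3'; move: (2 * n * _) => Y; clear; lia.
    by have := nrm_near_third X3 Es'; lra.
  have [HD|HD] := lerP D (1 - nrm (pt k r)).
    by apply: F1; apply: btwP; right; lra.
  by apply: F0; apply: btwP; left; lra.
have L0 := nrm_near_odd oX Es.
have L1 : nrm (s + (2 * (2 * n * - W%:Z))%:~R / 3) <= 1/3 + (inv p + inv q) / 2.
  have Es' : s + (2 * (2 * n * - W%:Z))%:~R / 3 + 1 = (inv p + sg%:~R * inv q) / 2 +
     (2 * (3 * ((X + 1) %/ 2)%Z + 2 * n * - W%:Z))%:~R / 3.
    have EX : X = 2 * ((X + 1) %/ 2)%Z - 1 by move: oX; clear; lia.
    by rewrite Es {1}EX !(intrM, intrD); lra.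
  have X3 : ~~ (3 %| 3 * ((X + 1) %/ 2)%Z + 2 * n * - W%:Z)%Z.
    by move: n3'; move: (2 * n * _) (_ %/ 2)%Z => Y Z; clear; lia.
  by have := nrm_near_third X3 Es'; rewrite nrm_add1; lra.
have [HD|HD] := lerP D (1 - nrm (pt k r)).
  by apply: F0; apply: btwP; right; lra.
by apply: F1; apply: btwP; left; lra.
Qed.

(** Starting from a multiple [3 * k] of 3 makes both [j = 1] and [j = -1] admissible. Here
    [x + sg * y] starts near 1/2 and goes near 1/6 or 5/6, on the side of 1/2 opposite to
    [x - sg * y], which is near an integer. The errors are 3/2 of the reciprocals, hence 2/9. *)
Lemma good_110_two3_odd : ~~ (2 %| n)%Z -> inv p + inv q + inv r <= 2/9 -> good p q r.
Proof.
move=> on H.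
have [k [Ek uk]] := exists_half oW.
have uW : uN (3 * k) W.
  have c3 : coprimez 3 W by rewrite coprimezE prime_coprime.
  by case/andP: uk => k2 kW; rewrite /uN !coprimezMl k2 kW c3.
have k3 j : j = 1 \/ j = -1 -> ~~ (3 %| 3 * k + 2 * (2 * W)%N%:Z * j)%Z.
  by rewrite PoszM; case=> ->; move: W3Z; clear; lia.
have EkR : k%:~R = (1 + W%:R * W%:R) / 2 :> R.
  have : (2 * k)%:~R = (1 + W%:Z * W%:Z)%:~R :> R by rewrite Ek.
  by rewrite intrD !intrM -!pmulrn; lra.
have point a D : (0 < a)%N -> (a * D = 6 * W)%N ->
    pt (3 * k) a = 3/2 * inv a + (W%:Z * D%:Z)%:~R / 4.
  move=> a0 aD; have a0' : a%:R != 0 :> R by rewrite pnatr_eq0 -lt0n.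
  have EW : W%:R = a%:R * D%:R / 6 :> R by rewrite -natrM aD natrM; field.
  by rewrite /pt !intrM EkR -!pmulrn {1}EW; field.
have Ep : pt (3 * k) p = 3/2 * inv p + (W%:Z * A%:Z)%:~R / 4.
  by apply: point => //; rewrite pA; ring.
have Eq : pt (3 * k) q = 3/2 * inv q + (W%:Z * B%:Z)%:~R / 4.
  by apply: point => //; rewrite qB; ring.
have Er : pt (3 * k) r = 3/2 * inv r + (W%:Z * C%:Z)%:~R / 2.
  rewrite (point r (2 * C)%N) //; last by rewrite rC; ring.
  by rewrite PoszM !intrM; field; exact: dec_neq0 dr.
have Hz : 1/2 - 3/2 * inv r <= nrm (pt (3 * k) r) <= 1/2 + 3/2 * inv r.
  have oC : odd C by case: dr.
  by apply: dst_ge_half; have := dst_odd2 (oddM2 oW oC) Er; rewrite gtr0_norm // mulr_gt0 ?divr_gt0.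
have [n2 En2] : exists n2, A%:Z - sg * B%:Z = 4 * n2.
  have oA : odd A by case: dp.
  exists ((A%:Z - n) %/ 2)%Z; move: En oA on; clear; move: (sg * _) => X; lia.
have Es : pt (3 * k) p + sg%:~R * pt (3 * k) q = 3/2 * (inv p + sg%:~R * inv q) + (W%:Z * n)%:~R / 2.
  by rewrite Ep Eq !intrM (intr_divE En) // intrD intrM; field; rewrite pn0 qn0.
have Ed : pt (3 * k) p - sg%:~R * pt (3 * k) q = 3/2 * (inv p - sg%:~R * inv q) + (W%:Z * n2)%:~R.
  by rewrite Ep Eq !intrM (intr_divE En2) // intrB intrM; field; rewrite pn0 qn0.
have S1 : `|3/2 * (inv p + sg%:~R * inv q)| <= 3/2 * (inv p + inv q).
  by rewrite normrM ger0_norm ?divr_ge0 // ler_pM2l ?divr_gt0 //; exact: sign_norm.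
have S2 : `|3/2 * (inv p - sg%:~R * inv q)| <= 3/2 * (inv p + inv q).
  by rewrite normrM ger0_norm ?divr_ge0 // ler_pM2l ?divr_gt0 //; exact: sign_normB.
have oWn : ~~ (2 %| W%:Z * n)%Z.
  by have := odd_dvdz oW; rewrite -!coprimez2 coprimezMl => ->; rewrite coprimez2.
have [[j1 Hj1 J1] [j5 Hj5 J5]] := residue_pm oWn n3.
have F1 := fin uW (k3 _ Hj1); have F5 := fin uW (k3 _ Hj5).
have Us j : pt (3 * k) p + sg%:~R * pt (3 * k) q + (2 * ((2 * n) * j))%:~R / 3 =
    3/2 * (inv p + sg%:~R * inv q) + (3 * (W%:Z * n) + 8 * (n * j))%:~R / 6%:R.
  by rewrite Es !(intrM, intrD); field; rewrite pn0 qn0.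
have {J1} := nrm_frac (D:=6%N) (c:=1%N) isT isT J1 (Us j1).
have {J5} := nrm_frac (D:=6%N) (c:=5%N) isT isT J5 (Us j5).
have [[X EX]|oX] := even_cases (W%:Z * n2).
  rewrite EX in Ed; have := nrm_near_even Ed => *.
  by apply: F5; apply: btwP; right; lra.
have := nrm_near_odd oX Ed => *.
by apply: F1; apply: btwP; left; lra.
Qed.

End TwoMultiplesOfThree.

Lemma dst_repr_int t : exists u m, t = u + m%:~R /\ `|u| = dst t.
Proof. by have [m E] := dstP t; exists (t - m%:~R), m; rewrite subrK. Qed.

(** The multiplier is [6 * kap + 3 * W], a multiple of 3 to which both signs of the 3-adic shift may
    be applied. [z] is near 1/2 and [x + sg * y] can be brought near 1/6 or 5/6; the freedom in
    [kap] serves to make the three error terms small. *)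
Lemma good_110_mixed3 (kap : int) p q r A B C W :
  dec p 1 A (3 * W) -> dec q 0 B (3 * W) -> dec r 1 C (3 * W) ->
  ~~ (3 %| W)%N -> ~~ (3 %| A)%N -> ~~ (3 %| B)%N -> (3 %| C)%N -> coprimez kap W ->
  dst (pt (6 * kap) p) + dst (pt (6 * kap) q) + dst (pt (6 * kap) r) <= 1/3 -> good p q r.
Proof.
move=> dp dq dr W3 A3 B3 C3 cW H.
have [p0 oA oN pA] := dp; have [q0 oB _ qB] := dq; have [r0 oC _ rC] := dr.
have oW : odd W by move: oN; rewrite oddM.
have W0 : (0 < 6 * W)%N by case: (W) oW.
have pA' : (p * A = 3 * (2 * W))%N by rewrite pA; ring.
have qB' : (q * (2 * B) = 3 * (2 * W))%N by rewrite mulnCA qB; ring.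
have rC' : (r * C = 3 * (2 * W))%N by rewrite rC; ring.
have B3' : ~~ (3 %| 2 * B)%N by rewrite Euclid_dvdM.
have [sg [m [Hsg Em S3]]] := sign_sum3 A3 B3'.
have S2 := odd_sum_mixed sg B oA.
pose T := A%:Z + sg * (2 * B)%N%:Z.
pose k0 := 6 * kap + (3 * W)%N%:Z.
have pn0 := dec_neq0 dp; have qn0 := dec_neq0 dq.
have half a D : (0 < a)%N -> (a * D = 3 * (2 * W))%N ->
    pt k0 a = pt (6 * kap) a + (D%:Z)%:~R / 2.
  move=> x0 xD; rewrite /k0 pt_add (pt_scale (3 * W)%N%:Z x0 xD); last by rewrite mulnA.
  have W0' : W%:R != 0 :> R by rewrite pnatr_eq0; case: (W) oW.
  by rewrite PoszM !(intrM, natrM) -!pmulrn; congr (_ + _); field.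
have Ep := half _ _ p0 pA'; have Eq := half _ _ q0 qB'; have Er := half _ _ r0 rC'.
have [ex [mx [Ex Nx]]] := dst_repr_int (pt (6 * kap) p).
have [ey [my [Ey Ny]]] := dst_repr_int (pt (6 * kap) q).
(* [b] is the parity of the integer split off from [x + sg * y]; it contributes the term [6 * b] to
   the numerator over 6. *)
have [I [b EI]] : exists (I : int) (b : bool), mx + sg * my = 2 * I + b%:Z.
  move: (mx + _); clear => X; exists (X %/ 2)%Z, (~~ (2 %| X)%Z); lia.
have [[j1 Hj1 J1] [j5 Hj5 J5]] := residue_sixths b S2 S3.
rewrite -/T in J1 J5.
have Us j : pt k0 p + sg%:~R * pt k0 q + (2 * (T * j))%:~R / 3 =
    ex + sg%:~R * ey + (3 * T + 4 * (T * j) + 6 * b%:Z)%:~R / 6%:R + (2 * I)%:~R.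
  have {}EI : mx + sg * my - b%:Z = 2 * I by rewrite EI addrK.
  by rewrite Ep Eq Ex Ey !(intrM, intrD) (intr_divE EI) // intrB /T !(intrM, intrD); field.
have fin j : j = 1 \/ j = -1 -> btw (1 - nrm (pt k0 r))
    (nrm (pt k0 p + sg%:~R * pt k0 q + (2 * (T * j))%:~R / 3))
    (nrm (pt k0 p - sg%:~R * pt k0 q)) -> good p q r.
  move=> Hj; apply: (good_third_shift p0 q0 r0 pA' qB' rC' C3 Hsg Em).
  have k2 : ~~ (2 %| k0 + 2 * (2 * W)%N%:Z * j)%Z.
    rewrite /k0 -(mulrA 2); move: (_%:Z * j) oW => X; clear; lia.
  apply: uN_mul.
    apply: uN3 => //; rewrite /k0 !PoszM; move: W3; case: Hj => ->; clear; lia.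
  apply: uN_double; rewrite /uN coprimez2 k2.
  apply: (@coprimez_affine _ 1 (6 * kap) (3 + 4 * j)); first by rewrite /k0 !PoszM; ring.
  rewrite coprimezMl cW andbT coprimezE (_ : `|6|%N = 2 * 3)%N // coprimeMl coprime2n oW.
  by rewrite prime_coprime.
have Hz : 1/2 - dst (pt (6 * kap) r) <= nrm (pt k0 r) <= 1/2 + dst (pt (6 * kap) r).
  by apply: dst_ge_half; rewrite Er dst_half_int ?(dec_odd dr).
have Hs : `|ex + sg%:~R * ey| <= dst (pt (6 * kap) p) + dst (pt (6 * kap) q).
  apply: le_trans (ler_normD _ _) _; rewrite Nx -Ny.
  by case: Hsg => ->; rewrite ?mul1r ?rmorphN ?mulN1r ?normrN.
have {J1} := nrm_frac (D:=6%N) (c:=1%N) isT isT J1 (erefl (ex + sg%:~R * ey + _)).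
have {J5} := nrm_frac (D:=6%N) (c:=5%N) isT isT J5 (erefl (ex + sg%:~R * ey + _)).
rewrite -!(nrm_even (_ + _ / 6%:R) (m := 2 * I)) ?dvdz_mulr // -!Us => F5 F1.
have [HD|HD] := lerP (nrm (pt k0 p - sg%:~R * pt k0 q)) (1 - nrm (pt k0 r)).
  by apply: (fin j5 Hj5); apply: btwP; right; rlra.
by apply: (fin j1 Hj1); apply: btwP; left; rlra.
Qed.

End TieAtTwo.

(** * A fixed pair and an arbitrary third number *)

Section Pairs.
Implicit Types (t u v x y z mu : R) (k h m i j X Y sg T : int) (p q r N A B C P Q U L M H G f e l g : nat).

Lemma coprimez_primeP k H : (0 < H)%N ->
  (forall l, prime l -> (l %| H)%N -> ~~ (l%:Z %| k)%Z) -> coprimez k H.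
Proof.
move=> H0 Hl; rewrite coprimezE /coprime eqn_leq gcdn_gt0 H0 orbT andbT leqNgt.
apply/negP=> /pdiv_prime pl; have := Hl _ pl (dvdn_trans (pdiv_dvd _) (dvdn_gcdr _ _)).
by rewrite dvdzE (dvdn_trans (pdiv_dvd _) (dvdn_gcdl _ _)).
Qed.

(** Take for [j] the product of the primes of [H] that do not divide [k]: each prime of [H] divides
    exactly one of [k] and [m * j]. *)
Lemma coprimez_lift k m H : (0 < H)%N -> coprimez k m -> exists j, coprimez (k + m * j) H.
Proof.
move=> H0 km; pose P l := ~~ (l%:Z %| k)%Z.
exists (\prod_(l <- primes H | P l) l)%N%:Z; apply: coprimez_primeP => // l pl lH.
have [lk|lk] := boolP (l%:Z %| k)%Z.
  rewrite rpredDl // dvdzE abszM Euclid_dvdM //= negb_or; apply/andP; split.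
    apply/negP=> lm; have : (l %| gcdn `|k| `|m|)%N by rewrite dvdn_gcd lm andbT -(dvdzE l).
    by move: km; rewrite coprimezE => /eqP->; rewrite dvdn1; case: l pl {lH lk lm} => [|[]].
  rewrite big_seq_cond; elim/big_ind: _ => [|a b Ha Hb|l' /andP[]].
  - by case: l pl {lH lk} => [|[]].
  - by rewrite Euclid_dvdM // negb_or Ha.
  rewrite mem_primes => /andP[pl' _]; apply: contra.
  by rewrite dvdn_prime2 // => /eqP <-.
have ll : l \in primes H by rewrite mem_primes pl H0.
by rewrite rpredDr // (big_rem _ ll) /= /P lk PoszM mulrCA dvdz_mulr.
Qed.

(** With [a] and [b] the distances of [x] and [y], the values [nrm (x + y)] and [nrm (x - y)] are,
    up to order and a common reflection, [a + b] and [|a - b|]; they differ by twice the smaller of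
    [a] and [b]. *)
Lemma pair_window x y mu : mu <= dst x -> mu <= dst y ->
  exists lo, [/\ 0 <= lo, lo + 2 * mu <= 1 &
    forall u, lo <= u <= lo + 2 * mu -> btw u (nrm (x + y)) (nrm (x - y))].
Proof.
have [m [s Ex]] := dst_repr x; have [m' [s' Ey]] := dst_repr y.
have := dst_ge0 x; have := dst_ge0 y; have := dst_le_half x; have := dst_le_half y.
move: (dst x) (dst y) Ex Ey => a b -> -> b2 a2 b0 a0 Ha Hb.
have Np : nrm (a + b) = a + b by rewrite nrm_small ger0_norm; rlra.
have [d [Nm Hd]] : exists d, nrm (a - b) = d /\ [/\ 0 <= d, d + 2 * mu <= a + b & a + b <= 1].
  exists `|a - b|; split; first by rewrite nrm_small // ler_norml; rlra.
  by have [?|?] := lerP 0 (a - b); [rewrite ger0_norm | rewrite ltr0_norm] => //; split; rlra.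
case: Hd => d0 d1 d2.
have [n [E1 E2]] : exists n, nrm ((-1) ^+ s * a + m%:~R + ((-1) ^+ s' * b + m'%:~R)) =
     nrm ((if s == s' then a + b else a - b) + n%:~R) /\
   nrm ((-1) ^+ s * a + m%:~R - ((-1) ^+ s' * b + m'%:~R)) =
     nrm ((if s == s' then a - b else a + b) + n%:~R).
  have par t : nrm (t + (m - m')%:~R) = nrm (t + (m + m')%:~R).
    by rewrite -(nrm_even (t + (m - m')%:~R) (m := 2 * m')) ?dvdz_mulr //; congr nrm; rewrite !(intrD, intrB, intrM); ring.
  have opp t i : nrm (- t + i%:~R) = nrm (t + i%:~R).
    rewrite -nrmN -(nrm_even (- (- t + i%:~R)) (m := 2 * i)) ?dvdz_mulr //.
    by congr nrm; rewrite intrM; ring.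
  exists (m + m'); case: s s' => -[] /=; rewrite ?expr1 ?expr0; split.
  - by rewrite -opp; congr nrm; rewrite intrD; ring.
  - by rewrite -par -opp; congr nrm; rewrite intrB; ring.
  - by rewrite -opp; congr nrm; rewrite intrD; ring.
  - by rewrite -par -opp; congr nrm; rewrite intrB; ring.
  - by congr nrm; rewrite intrD; ring.
  - by rewrite -par; congr nrm; rewrite intrB; ring.
  - by congr nrm; rewrite intrD; ring.
  - by rewrite -par; congr nrm; rewrite intrB; ring.
rewrite E1 E2; case: (boolP (2 %| n)%Z) => Hn.
  exists d; split=> //; first rlra.
  by move=> u Hu; rewrite !nrm_even // (fun_if nrm) (fun_if nrm) Np Nm; case: eqP => _; apply: btwP; [right|left]; rlra.
exists (1 - (a + b)); split; [rlra | rlra |].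
by move=> u Hu; rewrite !nrm_odd // (fun_if nrm) (fun_if nrm) Np Nm; case: eqP => _; apply: btwP; [left|right]; rlra.
Qed.

(** Multiples of [2 * H] move [k / p] and [k / q] by even integers; with [U'] inverse to [U] modulo
    [Q = l ^ g], the multiple [2 * H * U' * i] moves [k / r] by [2 * i / Q] modulo 2. The window of
    [pair_window] must contain one such step if [l] divides [H], since [k] then stays prime to [l],
    and two otherwise, since one of two consecutive multipliers may be divisible by [l]. *)
Lemma good_pair_prime_power k0 p q r H U l g :
  (0 < p)%N -> (0 < q)%N -> (0 < r)%N -> (0 < H)%N -> prime l ->
  (p %| H)%N -> (q %| H)%N -> (l ^ g * H = r * U)%N -> coprime U l ->
  uN k0 (p * q) -> (if (l %| H)%N then 1 else 2) <= (l ^ g)%:R * dst (pt k0 p) ->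
  (if (l %| H)%N then 1 else 2) <= (l ^ g)%:R * dst (pt k0 q) -> good p q r.
Proof.
move=> p0 q0 r0 H0 pl pH qH QH Ul uk Dp Dq.
set Q := (l ^ g)%N in QH Dp Dq.
have Q0 : (0 < Q)%N by rewrite expn_gt0 prime_gt0.
have Qn0 : 0 < Q%:R :> R by rewrite ltr0n.
have [t kt] : exists t : int, coprimez (k0 + 2 * (p * q)%N%:Z * t) H.
  by apply: coprimez_lift => //; case/andP: uk => k2 kpq; rewrite coprimezMr k2.
set k1 := k0 + _ in kt.
have k12 : ~~ (2 %| k1)%Z.
  by case/andP: uk; rewrite coprimez2 /k1 -mulrA; move: (_%:Z * t) => X k2 _; move: k2; clear; lia.
have [U' [s EU]] : exists U' s : int, U%:Z * U' = 1 + Q%:Z * s.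
  have /coprimezP[[u v] /= uv] : coprimez U Q by rewrite coprimezE /= coprimeXr.
  by exists u, (- v); rewrite mulrC (mulrC Q%:Z) mulNr -uv addrK.
pose k i := k1 + 2 * H%:Z * U' * i.
have even_pt i a : (a %| H)%N -> (0 < a)%N -> exists m, pt (2 * H%:Z * U' * i) a = (2 * m)%:~R.
  move=> /dvdnP[c EH] a0; exists (c%:Z * U' * i).
  have a0' : a%:R != 0 :> R by rewrite pnatr_eq0 -lt0n.
  by rewrite /pt EH PoszM !intrM -!pmulrn; field.
have r0' : r%:R != 0 :> R by rewrite pnatr_eq0 -lt0n.
have Q0' : Q%:R != 0 :> R by rewrite pnatr_eq0 -lt0n.
have Ez i : pt (k i) r = pt k1 r + 2 * i%:~R / Q%:R + (2 * (s * i))%:~R.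
  rewrite pt_add -addrA; congr (_ + _).
  have EH : H%:R = r%:R * U%:R / Q%:R :> R by rewrite -natrM -QH natrM; field.
  have EU' : U%:R * U'%:~R = 1 + Q%:R * s%:~R :> R.
    by have : (U%:Z * U')%:~R = (1 + Q%:Z * s)%:~R :> R by [rewrite EU]; rewrite intrD !intrM -!pmulrn.
  rewrite /pt !intrM -pmulrn EH.
  have -> : 2%:~R * (r%:R * U%:R / Q%:R) * U'%:~R * i%:~R / r%:R = 2 * (U%:R * U'%:~R) * i%:~R / Q%:R :> R.
    by field; rewrite r0' Q0'.
  by rewrite EU'; field.
have [x_p Ex] : exists m : int, pt k1 p = pt k0 p + (2 * m)%:~R.
  exists (q%:Z * t); rewrite pt_add; congr (_ + _).
  have p0' : p%:R != 0 :> R by rewrite pnatr_eq0 -lt0n.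
  by rewrite /pt PoszM !intrM -!pmulrn; field.
have [x_q Ey] : exists m : int, pt k1 q = pt k0 q + (2 * m)%:~R.
  exists (p%:Z * t); rewrite pt_add; congr (_ + _).
  have q0' : q%:R != 0 :> R by rewrite pnatr_eq0 -lt0n.
  by rewrite /pt PoszM !intrM -!pmulrn; field.
set c : R := if _ then _ else _ in Dp Dq.
have c1 : 1 <= c by rewrite /c; case: ifP => _; rlra.
have Mp : c / Q%:R <= dst (pt k1 p) by rewrite ler_pdivrMr // Ex dst_int mulrC.
have Mq : c / Q%:R <= dst (pt k1 q) by rewrite ler_pdivrMr // Ey dst_int mulrC.
have [lo [lo0 lo1 Hw]] := pair_window Mp Mq.
have Qi : 0 < 2 / Q%:R :> R by rewrite divr_gt0.
have Ec : 2 * (c / Q%:R) = c * (2 / Q%:R) by rewrite mulrCA.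
rewrite Ec in lo1 Hw; set h := 2 / Q%:R in Qi Ez lo1 Hw *.
have {}Ez i : pt (k i) r = pt k1 r + i%:~R * h + (2 * (s * i))%:~R.
  by rewrite Ez /h; congr (_ + _ + _); field.
(* The first index that enters the window, whose length is [c] steps. *)
pose i := Num.ceil ((1 - (lo + c * h) - pt k1 r) / h).
have Hi : 1 - (lo + c * h) <= pt k1 r + i%:~R * h /\
    pt k1 r + i%:~R * h <= 1 - (lo + c * h) + h.
  have /andP[] := ceil_itv ((1 - (lo + c * h) - pt k1 r) / h); rewrite -/i.
  rewrite ltr_pdivlMr // ler_pdivrMr // intrB mulrBl mul1r.
  by move: (c * h) (i%:~R * h) => ch ih i1 i2; split; rlra.
have far_i j : 1 - (lo + c * h) <= pt k1 r + j%:~R * h <= 1 - lo ->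
    far (pt (k j) p) (pt (k j) q) (pt (k j) r).
  move=> /andP[L1 L2].
  have [mp Emp] := even_pt j p pH p0; have [mq Emq] := even_pt j q qH q0.
  have -> : pt (k j) p = pt k1 p + (2 * mp)%:~R by rewrite pt_add Emp.
  have -> : pt (k j) q = pt k1 q + (2 * mq)%:~R by rewrite pt_add Emq.
  rewrite Ez.
  have e2 : (2 %| 2 * mp + 2 * mq + 2 * (s * j))%Z by rewrite -!mulrDr dvdz_mulr.
  apply: far_shift e2 _; apply: btw_far; apply: Hw.
  by rewrite nrm_small; rewrite ger0_norm; rlra.
have uk_j j : ~~ (l%:Z %| k j)%Z -> uN (k j) (Q * H).
  move=> lk; have kj2 : coprimez (k j) 2.
    by rewrite coprimez2 /k -!mulrA; move: (H%:Z * _) k12 => X; clear; lia.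
  apply: uN_mul; rewrite /uN kj2 /=.
    by rewrite coprimezE /= coprimeXr // coprime_sym prime_coprime // -(dvdzE l).
  by apply: (@coprimez_affine _ 1 k1 (2 * U' * j)) => //; rewrite /k; ring.
have fin j : 1 - (lo + c * h) <= pt k1 r + j%:~R * h <= 1 - lo ->
    ~~ (l%:Z %| k j)%Z -> good p q r.
  move=> Hj lk; apply: (good_intro_dvd (uk_j _ lk)); last exact: far_i.
  - by rewrite dvdn_mull.
  - by rewrite dvdn_mull.
  - by rewrite QH dvdn_mulr.
have ch : h <= c * h by rewrite ler_pMl.
have l1 : ~~ (l %| 1)%N by rewrite dvdn1; case: (l) pl => [|[]].
have cop_l j : (l %| H)%N -> ~~ (l%:Z %| k j)%Z.
  move=> lH; have lH' : 2 * H%:Z * U' * j \in dvdz l by rewrite -!mulrA dvdz_mull // dvdz_mulr // dvdzE.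
  rewrite (rpredDr k1 lH'); apply/negP=> lk1.
  have : (l %| gcdn `|k1| `|H|)%N by rewrite dvdn_gcd -(dvdzE l) lk1.
  by move: kt; rewrite coprimezE => /eqP->; apply/negP.
have [li|li] := boolP (l%:Z %| k i)%Z; last by apply: (fin i) => //; rlra.
have nlH : ~~ (l %| H)%N by apply: contraL li; apply: cop_l.
(* The multiplier of index [i] is divisible by [l], so [c = 2] and the next index is still in the
   window. The difference [2 * H * U'] is prime to [l]: [l] is odd because the multipliers are, and
   [U'] is invertible modulo [l]. *)
apply: (fin (i + 1)).
  by move: ch Hi; rewrite /c (negbTE nlH) intrD mulrDl mul1r => *; rlra.
have -> : k (i + 1) = k i + 2 * H%:Z * U' by rewrite /k; ring.
rewrite rpredDl // !dvdzE !abszM !Euclid_dvdM // !negb_or nlH /=; apply/andP; split.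
- rewrite andbT; apply: contra k12; rewrite dvdn_prime2 // => /eqP l2'.
  have l2 : l = 2%N by [].
  have : (2 %| k i)%Z by move: li; rewrite l2.
  by rewrite /k -!mulrA; move: (H%:Z * _) => X; clear; lia.
- apply/negP=> lU; case: (posnP g) => [g0|g0].
    have Q1 : Q = 1%N by rewrite /Q g0.
    by move: Dp c1; rewrite Q1 mul1r; have := dst_le_half (pt k0 p); rlra.
  have : (l%:Z %| 1 + Q%:Z * s)%Z by rewrite -EU dvdz_mull // dvdzE.
  rewrite rpredDr; first by rewrite dvdzE; apply/negP.
  by rewrite dvdz_mulr // dvdzE /= /Q -(prednK g0) expnS dvdn_mulr.
Qed.

End Pairs.

(* Verification by computation over the binary integers *)
Local Delimit Scope Z_scope with coqZ.

(** The numerator of [nrm (v / D)] over the denominator [D], see [nrm_zfold]. *)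
Definition zfold (D v : Z) : Z :=
  (let y := v mod (2 * D) in Z.min y (2 * D - y))%coqZ.

(* The hypothesis of [btw_far] for [k/p], [k/q], [k/r], multiplied by [p * q * r]. *)
Definition zfar (k p q r : Z) : bool :=
  (let D := p * q * r in let x := k * q * r in let y := k * p * r in
   let a := zfold D (x + y) in let b := zfold D (x - y) in
   let u := D - zfold D (k * p * q) in
   if Z.min a b <=? u then u <=? Z.max a b else false)%coqZ.

Definition zunit (k m : Z) : bool := (Z.gcd k (2 * m) =? 1)%coqZ.

Fixpoint zsearch (fuel : nat) (step k : Z) (f : Z -> bool) : bool :=
  if fuel is n.+1 then if f k then true else zsearch n step (k + step)%coqZ f else false.

Definition zdst (k p : Z) : Z := (let y := k mod p in Z.min y (p - y))%coqZ.

(** Products of one divisor prime to [e] of each member of the list. Working factor by factor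
    enumerates the divisors of a large product without factoring it; repetitions are harmless. *)
Fixpoint zprods (e : Z) (fs : seq nat) : seq Z :=
  if fs is f :: fs' then
    let ps := zprods e fs' in
    let ds := filter (fun d => if Z.eqb (Z.modulo (Z.of_nat f) d) 0%coqZ then Z.eqb (Z.gcd d e) 1%coqZ else false)
                     (map Z.of_nat (iota 1 f)) in
    flatten [seq [seq Z.mul d x | x <- ps] | d <- ds]
  else [:: 1%coqZ].

(* [if] rather than [&&], whose two arguments [vm_compute] would evaluate. *)
Fixpoint all_if (T : Type) (f : T -> bool) (s : seq T) : bool :=
  if s is x :: s' then if f x then all_if f s' else false else true.

(** Recognizes the triples outside the theorem: those that are not hyperbolic and those of the
    Hilbert series. As 42 is the largest entry of the latter, larger [r] are never converted to
    unary numbers. *)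
Definition zskip (p q : nat) (r : Z) : bool :=
  if Z.leb (Z.of_nat p * Z.of_nat q * r) (Z.of_nat q * r + Z.of_nat p * r + Z.of_nat p * Z.of_nat q)%coqZ
  then true
  else if Z.leb r 42%coqZ then in_hilbert_series p q (Z.to_nat r) else false.

Definition small_primes : seq nat := [:: 2; 3; 5; 7; 11; 13; 17; 19; 23]%N.

(** The largest exponent of [l] still too short for [good_pair_prime_power]. With both distances at
    least [2 / L], a power of [l] is long enough from [L] on, and already from [L / 2] on when [l]
    divides [G]. *)
Definition short_exp (L e G l : nat) : nat :=
  if (l %| e)%N then 0%N else trunc_log l (if (l %| G)%N then (L.-1)./2 else L.-1).

(* Let [G = lcm p q] and let [D] be the product of the [l ^ short_exp L e G l].  If [w * c] does
   not divide [G * D], some prime power exactly dividing it is long enough, compared to [L], for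
   [good_pair_prime_power].  Otherwise [c] divides [M], and the search goes through all these [c]. *)
Definition pair_check (L e w p q : nat) : bool :=
  let zp := Z.of_nat p in let zq := Z.of_nat q in let zw := Z.of_nat w in
  let G := (p * (q %/ gcdn p q))%N in
  let Ds := [seq l ^ short_exp L e G l | l <- small_primes]%N in
  let Ms := (G %/ foldr muln 1 [seq l ^ logn l G | l <- small_primes] ::
             [seq l ^ (logn l G + short_exp L e G l) | l <- small_primes])%N in
  let D := foldr Z.mul 1%coqZ (map Z.of_nat Ds) in
  let M := foldr Z.mul 1%coqZ (map Z.of_nat Ms) in
  if [&& (0 < p), (0 < q), (0 < w), w %| G, all (leq 1) Ds & all (leq 1) Ms]%N then
  if Z.eqb (Z.modulo M (Z.of_nat G * D)) 0%coqZ then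
  (* Every number too short in this sense must divide [D], so a prime power that does not divide [D]
     is long enough. *)
  if all_if (fun n => if coprime n e && ((2 * n < L)%N || coprime n G)
                      then Z.eqb (Z.modulo D (Z.of_nat n)) 0%coqZ else true) (iota 1 L.-1) then
  (* The starting multiplier, with both distances at least [2 / L]. *)
  if zsearch 2000 2%coqZ 1%coqZ (fun k =>
       if Z.leb (2 * zp) (Z.of_nat L * zdst k zp)%coqZ then
       if Z.leb (2 * zq) (Z.of_nat L * zdst k zq)%coqZ then zunit k (zp * zq) else false else false) then
  all_if (fun c => let r := (zw * c)%coqZ in if zskip p q r then true else
      (* The even step keeps [k] odd and grows with [r], so that a bounded number of trials sweeps
         several periods of [k / r]. *)
      zsearch 400 (2 * (1 + r / 128))%coqZ 1%coqZ (fun k =>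
        if zfar k zp zq r then zunit k (zp * zq * r)%coqZ else false))
    (zprods (Z.of_nat e) Ms)
  else false else false else false else false.

Definition zr (z : Z) : R := (int_of_Z z)%:~R.

Lemma zrD a b : zr (a + b)%coqZ = zr a + zr b.
Proof. by rewrite /zr -intrD; congr (_%:~R); lia. Qed.
Lemma zrB a b : zr (a - b)%coqZ = zr a - zr b.
Proof. by rewrite /zr -intrB; congr (_%:~R); lia. Qed.
Lemma zrM a b : zr (a * b)%coqZ = zr a * zr b.
Proof. by rewrite /zr -intrM; congr (_%:~R); lia. Qed.
Lemma zr_le a b : (a <= b)%coqZ -> zr a <= zr b.
Proof. by rewrite /zr ler_int; lia. Qed.
Lemma zr_nat n : zr (Z.of_nat n) = n%:R.
Proof. by rewrite /zr pmulrn; congr (_%:~R); lia. Qed.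

Lemma zfoldP D v : (0 < D)%coqZ -> [/\ (0 <= zfold D v)%coqZ, (zfold D v <= D)%coqZ &
  exists m, (v = zfold D v + 2 * D * m \/ v = 2 * D * m - zfold D v)%coqZ].
Proof.
move=> D0; rewrite /zfold.
have := Z.mod_pos_bound v (2 * D)%coqZ; have := Z.div_mod v (2 * D)%coqZ.
move: (v mod _)%coqZ (v / _)%coqZ => y m E B; have {}E : (v = 2 * D * m + y)%coqZ by lia.
have {}B : (0 <= y < 2 * D)%coqZ by lia.
split; [lia | lia |].
have [H|H] : (y <= 2 * D - y)%coqZ \/ (2 * D - y <= y)%coqZ by lia.
  by exists m; left; rewrite Z.min_l //; lia.
by exists (m + 1)%coqZ; right; rewrite Z.min_r //; lia.
Qed.

Lemma nrm_zfold D v : (0 < D)%coqZ -> nrm (zr v / zr D) = zr (zfold D v) / zr D.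
Proof.
move=> D0; have [c0 cD [m Em]] := zfoldP v D0.
have Dp : 0 < zr D by rewrite /zr ltr0z; lia.
move: (zfold D v) c0 cD Em => c c0 cD Em.
have Nc : nrm (zr c / zr D) = zr c / zr D.
  have c0' : 0 <= zr c by have := zr_le c0.
  by rewrite nrm_small ger0_norm ?divr_ge0 ?(ltW Dp) // ler_pdivrMr // mul1r zr_le.
have two : zr 2%coqZ = 2 by [].
have Dn : zr D != 0 by rewrite gt_eqF.
have Em2 t : nrm (t + (2 * int_of_Z m)%:~R) = nrm t by rewrite nrm_even ?dvdz_mulr.
case: Em => ->; rewrite ?zrB ?zrD !zrM two.
  by rewrite -[RHS]Nc -[RHS]Em2 intrM; congr nrm; rewrite -/(zr m); field.
by rewrite -[RHS]Nc -[LHS]nrmN -[LHS]Em2 intrM; congr nrm; rewrite -/(zr m); field.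
Qed.

Lemma zfar_far k (p q r : nat) : (0 < p)%N -> (0 < q)%N -> (0 < r)%N ->
  zfar k (Z.of_nat p) (Z.of_nat q) (Z.of_nat r) ->
  far (pt (int_of_Z k) p) (pt (int_of_Z k) q) (pt (int_of_Z k) r).
Proof.
move=> p0 q0 r0; rewrite /zfar; set D := (_ * _ * Z.of_nat r)%coqZ.
set x := (k * _ * _)%coqZ; set y := (k * _ * _)%coqZ; set z := (k * _ * _)%coqZ.
have D0 : (0 < D)%coqZ by rewrite /D; nia.
have p0' : p%:R != 0 :> R by rewrite pnatr_eq0 -lt0n.
have q0' : q%:R != 0 :> R by rewrite pnatr_eq0 -lt0n.
have r0' : r%:R != 0 :> R by rewrite pnatr_eq0 -lt0n.
have ED : zr D = p%:R * q%:R * r%:R by rewrite /D !zrM !zr_nat.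
have Ex : pt (int_of_Z k) p = zr x / zr D.
  by rewrite ED /x !zrM !zr_nat /pt -/(zr k); field; rewrite p0' q0' r0'.
have Ey : pt (int_of_Z k) q = zr y / zr D.
  by rewrite ED /y !zrM !zr_nat /pt -/(zr k); field; rewrite p0' q0' r0'.
have Ez : pt (int_of_Z k) r = zr z / zr D.
  by rewrite ED /z !zrM !zr_nat /pt -/(zr k); field; rewrite p0' q0' r0'.
case: Z.leb_spec => // H1; case: Z.leb_spec => // H2 _.
apply: btw_far; rewrite Ex Ey Ez -mulrDl -mulrBl -zrD -zrB !nrm_zfold //.
have Dp : 0 < zr D by rewrite /zr ltr0z; lia.
have -> : 1 - zr (zfold D z) / zr D = zr (D - zfold D z)%coqZ / zr D.
  by rewrite zrB mulrBl divff // gt_eqF.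
rewrite /btw !ler_pM2r ?invr_gt0 //.
have [H|H] : (zfold D (x + y) <= zfold D (x - y))%coqZ \/ (zfold D (x - y) <= zfold D (x + y))%coqZ by lia.
  by rewrite Z.min_l // in H1; rewrite Z.max_r // in H2; apply/orP; left; rewrite !zr_le.
by rewrite Z.min_r // in H1; rewrite Z.max_l // in H2; apply/orP; right; rewrite !zr_le.
Qed.

Lemma zunitP k (m : nat) : zunit k (Z.of_nat m) -> uN (int_of_Z k) m.
Proof.
rewrite /zunit => /Z.eqb_spec H.
have [u [v E]] := Z.gcd_bezout _ _ _ H.
rewrite /uN; apply/andP; split; apply/coprimezP.
  by exists (int_of_Z u, int_of_Z (v * Z.of_nat m)%coqZ) => /=; lia.
by exists (int_of_Z u, int_of_Z (v * 2)%coqZ) => /=; lia.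
Qed.

Lemma zsearchP fuel step k f : zsearch fuel step k f -> exists k', f k'.
Proof. by elim: fuel k => //= n IHn k; case: (boolP (f k)) => [fk _|_ /IHn//]; exists k. Qed.

Lemma all_ifP (T : eqType) (f : T -> bool) s : all_if f s -> {in s, forall x, f x}.
Proof.
elim: s => //= a s IHs; case: ifP => // fa /IHs H x.
by rewrite inE => /predU1P[-> //|/H].
Qed.

Lemma zdstP k (p : nat) : (0 < p)%N -> zr (zdst k (Z.of_nat p)) / p%:R <= dst (pt (int_of_Z k) p).
Proof.
move=> p0; rewrite /zdst; set zp := Z.of_nat p; have zp0 : (0 < zp)%coqZ by rewrite /zp; lia.
have := Z.mod_pos_bound k zp; have := Z.div_mod k zp.
move: (k mod _)%coqZ (k / _)%coqZ => y m E B; have {}E : (k = zp * m + y)%coqZ by lia.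
have {}B : (0 <= y < zp)%coqZ by lia.
have pp : 0 < p%:R :> R by rewrite ltr0n.
have pn0 : p%:R != 0 :> R by rewrite gt_eqF.
have -> : pt (int_of_Z k) p = zr y / p%:R + (int_of_Z m)%:~R.
  by rewrite /pt -/(zr k) -/(zr m) E zrD zrM zr_nat; field.
have y0 : 0 <= zr y by have := @zr_le 0%coqZ y; apply; lia.
rewrite dst_int; have [H|H] : (y <= zp - y)%coqZ \/ (zp - y <= y)%coqZ by lia.
  rewrite Z.min_l // dst_small ger0_norm ?divr_ge0 //.
  by rewrite ler_pdivrMr //; have := zr_le H; rewrite zrB zr_nat; rlra.
rewrite Z.min_r // -(dst_int _ (-1)) dst_small ler0_norm ?mulrN1z.
- by rewrite zrB zr_nat mulrBl divff //; rlra.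
- by rewrite subr_le0 ler_pdivrMr // mul1r -zr_nat; apply: zr_le; lia.
- by rewrite opprB lerBlDr -lerBlDl ler_pdivlMr //; have := zr_le H; rewrite zrB zr_nat; rlra.
- by rewrite subr_le0 ler_pdivrMr // mul1r -zr_nat; apply: zr_le; lia.
Qed.

(** Split off [gcdn c f] from [c]: the quotient is prime to the rest of [f], hence divides the
    product of the remaining factors. *)
Lemma mem_zprods (e : nat) fs c : all (fun f => 0 < f)%N fs -> (c %| \prod_(f <- fs) f)%N ->
  coprime c e -> Z.of_nat c \in zprods (Z.of_nat e) fs.
Proof.
elim: fs c => [|f fs IHfs] c /=; first by rewrite big_nil dvdn1 => _ /eqP->.
case/andP=> f0 fs0; rewrite big_cons => cf ce.
have g0 : (0 < gcdn c f)%N by rewrite gcdn_gt0 f0 orbT.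
have Ec : c = (gcdn c f * (c %/ gcdn c f))%N by rewrite mulnC divnK ?dvdn_gcdl.
apply/flattenP => /=.
exists [seq Z.mul (Z.of_nat (gcdn c f)) x | x <- zprods (Z.of_nat e) fs].
  apply/mapP; exists (Z.of_nat (gcdn c f)) => //.
  rewrite mem_filter; apply/andP; split; last first.
    apply/mapP; exists (gcdn c f) => //; rewrite mem_iota g0 add1n ltnS.
    by rewrite dvdn_leq ?dvdn_gcdr.
  have -> : Z.eqb (Z.modulo (Z.of_nat f) (Z.of_nat (gcdn c f))) 0.
    apply/Z.eqb_spec; have := dvdn_gcdr c f; move: (gcdn c f) g0 => g g0 /dvdnP[n ->].
    by rewrite Nat2Z.inj_mul Z.mod_mul //; lia.
  have : coprime (gcdn c f) e by apply: coprime_dvdl (dvdn_gcdl _ _) ce.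
  by move: (gcdn c f) => g Hg; apply/Z.eqb_spec; lia.
apply/mapP; exists (Z.of_nat (c %/ gcdn c f)); last by rewrite {1}Ec; lia.
apply: IHfs => //; last by apply: coprime_dvdl ce; apply/dvdnP; exists (gcdn c f).
have cop : coprime (c %/ gcdn c f) (f %/ gcdn c f).
  by rewrite /coprime -(eqn_pmul2l g0) muln1 muln_gcdr ![(gcdn c f * _)%N]mulnC !divnK ?dvdn_gcdl ?dvdn_gcdr.
rewrite -(Gauss_dvdr _ cop) -(dvdn_pmul2l g0) -Ec mulnA.
by rewrite (mulnC (gcdn c f)) divnK ?dvdn_gcdr.
Qed.

Lemma exists_large_prime_power r M : (0 < r)%N -> (0 < M)%N -> ~~ (r %| M)%N ->
  exists2 l, prime l & (logn l M < logn l r)%N.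
Proof.
move=> r0 M0 /dvdn_partP - /(_ r0) H.
have [l pl lr] : exists2 l, l \in \pi(r) & ~~ (r`_l %| M)%N.
  apply: boolp.contrapT => H'; apply: H => l lr; apply: boolp.contrapT => /negP H2.
  by apply: H'; exists l.
exists l; first by move: pl; rewrite mem_primes => /andP[].
move: lr; rewrite p_part pfactor_dvdn //; first by rewrite -ltnNge.
by move: pl; rewrite mem_primes => /andP[].
Qed.

Lemma dvdn_of_Zmod Q M : (0 < Q)%N -> Z.modulo (Z.of_nat M) (Z.of_nat Q) = 0%coqZ -> (Q %| M)%N.
Proof.
move=> Q0 E; apply/dvdnP; exists (Z.to_nat (Z.div (Z.of_nat M) (Z.of_nat Q))).
have := Z.div_mod (Z.of_nat M) (Z.of_nat Q); rewrite E.
have := Z.div_pos (Z.of_nat M) (Z.of_nat Q); move: (Z.div _ _) => d; nia.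
Qed.

Lemma prod_zfold (fs : seq nat) :
  foldr Z.mul 1%coqZ (map Z.of_nat fs) = Z.of_nat (\prod_(f <- fs) f)%N.
Proof. by elim: fs => [|f fs IHfs] /=; rewrite ?big_nil // big_cons IHfs; lia. Qed.

Lemma pair_checkP L e w p q : pair_check L e w p q -> forall c,
  (0 < c)%N -> coprime c e ->
  (q * (w * c) + p * (w * c) + p * q < p * q * (w * c))%N ->
  ~~ in_hilbert_series p q (w * c) -> good p q (w * c)%N.
Proof.
rewrite /pair_check; set G := (p * (q %/ gcdn p q))%N.
set Ds := [seq (l ^ _)%N | l <- _]; set Ms := (_ :: _); rewrite !prod_zfold.
case: ifP => // /and5P[p0 q0 w0 wG /andP[Ds0 Ms0]].
case: ifP => // /Z.eqb_spec HM.
case: ifP => // /all_ifP HL; case: ifP => // /zsearchP[k].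
case: Z.leb_spec => // Kp; case: Z.leb_spec => // Kq /[!(=^~ Nat2Z.inj_mul)] /zunitP uk.
move=> /all_ifP Hc c c0 ce hyp hil; rewrite !multE in uk.
have EG : G = lcmn p q by rewrite /G muln_divA ?dvdn_gcdr.
set D := (\prod_(f <- Ds) f)%N in HL HM.
have D0 : (0 < D)%N.
  by rewrite /D big_seq prodn_cond_gt0 // => f /(allP Ds0).
have G0 : (0 < G)%N by rewrite EG lcmn_gt0 p0.
have r0 : (0 < w * c)%N by rewrite muln_gt0 w0.
have [rGD|rGD] := boolP (w * c %| G * D)%N.
  have cin : Z.of_nat c \in zprods (Z.of_nat e) Ms.
    apply: mem_zprods => //; rewrite -Nat2Z.inj_mul in HM.
    apply: dvdn_trans (dvdn_of_Zmod _ HM); last by rewrite multE muln_gt0 G0.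
    by apply: dvdn_trans rGD; rewrite dvdn_mull.
  have := Hc _ cin; rewrite -Nat2Z.inj_mul; case: ifP => [|_ /zsearchP[k']].
    rewrite /zskip; case: Z.leb_spec => [H|_]; first by move: hyp H; clear; lia.
    by case: Z.leb_spec => // _; rewrite Nat2Z.id (negbTE hil).
  case: ifP => // /(zfar_far) H; rewrite -!Nat2Z.inj_mul => /zunitP uk'.
  rewrite !multE in H uk'.
  apply: (good_intro_dvd uk' _ _ _ (H p0 q0 r0)).
  - by rewrite -mulnA dvdn_mulr.
  - by rewrite -mulnA mulnCA dvdn_mulr.
  - by rewrite dvdn_mull.
have GD0 : (0 < G * D)%N by rewrite muln_gt0 G0.
have [l pl Hl] := exists_large_prime_power r0 GD0 rGD.
rewrite lognM // in Hl.
have lG : (logn l G < logn l (w * c))%N by apply: leq_ltn_trans Hl; rewrite leq_addr.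
pose g := (logn l (w * c) - logn l G)%N.
have Er := partnC l r0; have EGl := partnC l G0; rewrite p_part in Er; rewrite p_part in EGl.
have EQ : (l ^ g * l ^ logn l G = l ^ logn l (w * c))%N by rewrite -expnD subnK // ltnW.
(* A multiple of [G] with the same power of [l], containing the whole part of [w * c] prime to [l]:
   exactly [l ^ g] is missing to make it a multiple of [w * c]. *)
pose H := (G`_l^' * (l ^ logn l G * (w * c)`_l^'))%N.
have GH : (G %| H)%N by rewrite /H mulnCA mulnA EGl dvdn_mulr.
have QH : (l ^ g * H = w * c * G`_l^')%N.
  by rewrite -{1}Er -EQ /H; ring.
have cop : coprime G`_l^' l.
  rewrite coprime_sym prime_coprime //; apply/negP=> lG'.
  have /andP[g0 /allP] := part_pnat l^' G => /(_ l).
  by rewrite mem_primes pl g0 lG' => /(_ isT); rewrite !inE eqxx.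
have lc : (l %| c)%N.
  have : (logn l w <= logn l G)%N by rewrite dvdn_leq_log.
  move: lG; rewrite lognM // => lG wl; have : (0 < logn l c)%N by move: lG wl; clear; lia.
  by rewrite logn_gt0 mem_primes => /and3P[].
have lH : (l %| H)%N = (l %| G)%N.
  apply/idP/idP => [|lG']; last exact: dvdn_trans GH.
  rewrite /H Euclid_dvdM // [X in _ || X]Euclid_dvdM // => /or3P[lG'|lG'|lr].
  - exact: dvdn_trans lG' (dvdn_part _ _).
  - by rewrite -EGl dvdn_mulr.
  have := coprime_partC l (w * c) (w * c); rewrite p_part => /(coprime_dvdr lr).
  have w_l : (0 < logn l (w * c))%N by apply: leq_ltn_trans lG.
  by rewrite coprime_pexpl // prime_coprime // dvdnn.
have QL : (if l %| G then L <= 2 * l ^ g else L <= l ^ g)%N.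
  have Qe : coprime (l ^ g) e by rewrite coprimeXl //; apply: coprime_dvdl lc ce.
  have Q0 : (0 < l ^ g)%N by rewrite expn_gt0 prime_gt0.
  have QD : ~~ (l ^ g %| D)%N.
    by rewrite pfactor_dvdn // /g; move: Hl lG; clear; lia.
  have : ~~ ((l ^ g < L) && ((2 * l ^ g < L) || coprime (l ^ g) G))%N.
    apply: contra QD => /andP[QL H2].
    have : (l ^ g)%N \in iota 1 L.-1 by rewrite mem_iota Q0 add1n prednK // (leq_trans _ QL).
    by move/HL; rewrite Qe H2 => /Z.eqb_spec; apply: dvdn_of_Zmod.
  have := @coprimeXl g l G; rewrite prime_coprime //.
  move: Q0; move: (l ^ g)%N => Q Q0; case: (boolP (l %| G)%N) => [_ _|_ ->] //.
    rewrite negb_and negb_or -!leqNgt; clear -Q0 => /orP[|/andP[]//]; lia.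
  by rewrite orbT andbT -leqNgt.
have big a : (0 < a)%N -> (2 * Z.of_nat a <= Z.of_nat L * zdst k (Z.of_nat a))%coqZ ->
    (if (l %| H)%N then 1 else 2) <= (l ^ g)%:R * dst (pt (int_of_Z k) a).
  move=> a0 Ka; have := zdstP k a0.
  have an0 : 0 < a%:R :> R by rewrite ltr0n.
  rewrite ler_pdivrMr // => Hd.
  have := zr_le Ka; rewrite !zrM !zr_nat => H2.
  have {H2 Hd} HL2 : 2 <= L%:R * dst (pt (int_of_Z k) a).
    rewrite -(ler_pM2r an0); apply: le_trans H2 _.
    by rewrite -mulrA; apply: ler_wpM2l.
  have d0 := dst_ge0 (pt (int_of_Z k) a).
  move: QL; rewrite lH; case: ifP => _ QL.
    have : L%:R * dst (pt (int_of_Z k) a) <= (2 * l ^ g)%:R * dst (pt (int_of_Z k) a).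
      by rewrite ler_wpM2r // ler_nat.
    by rewrite natrM -mulrA; move: ((l ^ g)%:R * _) => X; rlra.
  by apply: le_trans HL2 _; rewrite ler_wpM2r // ler_nat.
apply: (good_pair_prime_power p0 q0 r0 _ pl _ _ QH cop uk).
- by rewrite /H !muln_gt0 !part_gt0 expn_gt0 prime_gt0.
- by apply: dvdn_trans GH; rewrite EG dvdn_lcml.
- by apply: dvdn_trans GH; rewrite EG dvdn_lcmr.
- exact: big.
- exact: big.
Qed.

(** * Tables of pairs *)

(** A small threshold leaves few third numbers to check but asks for large distances of [k / p] and
    [k / q]. Since [k / 6] has distance [1/6 = 2/12], a pair containing 6 requires the threshold
    12. *)
Definition pair_ok (e w p q : nat) : bool :=
  if pair_check 7 e w p q then true else pair_check 12 e w p q.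

(** The pairs, up to order, whose reciprocals are too large for the estimates of the case analysis;
    the third number is arbitrary. *)
Definition small_pairs : seq (nat * nat) :=
  [:: (2, 4); (3, 4); (3, 6); (3, 10); (4, 4); (4, 6); (4, 10); (4, 12);
      (5, 6); (5, 10); (5, 14); (5, 30); (5, 42); (5, 66); (5, 78);
      (6, 6); (6, 7); (6, 8); (6, 9); (6, 10); (6, 11); (6, 12); (6, 13); (6, 14);
      (6, 17); (6, 18); (6, 19); (6, 20); (6, 23); (6, 25); (6, 29); (6, 30);
      (6, 31); (6, 45); (7, 10); (9, 10); (10, 12); (10, 18)]%N.

Lemma small_pairs_ok : all_if (fun x => pair_ok 1 1 x.1 x.2) small_pairs.
Proof. by vm_compute. Qed.

Definition mixed_pair (s : bool) (c k x : nat) : nat * nat :=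
  if s then (c, k * x)%N else (k * x, c)%N.

(* An entry [(w, s, c, k, m)] stands for the pairs [c], [k * x] (in this order
   if [s]), where [x < m] is prime to 6; the third number is [w] times a
   number prime to 6. *)
Definition mixed_entries : seq (nat * bool * nat * nat * nat) :=
  [:: (2, true, 6, 3, 12); (3, true, 6, 2, 18);
      (2, true, 30, 3, 30); (3, true, 30, 2, 45);
      (2, true, 42, 3, 21); (3, true, 42, 2, 32);
      (2, false, 15, 6, 30); (6, true, 15, 2, 90);
      (2, false, 21, 6, 32); (6, true, 21, 2, 95);
      (2, false, 33, 6, 14); (6, true, 33, 2, 40);
      (2, false, 39, 6, 12); (6, true, 39, 2, 34);
      (6, true, 51, 2, 28);
      (3, false, 10, 6, 30); (6, false, 10, 3, 60);
      (3, false, 14, 6, 21); (6, false, 14, 3, 42);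
      (3, false, 22, 6, 33); (6, false, 22, 3, 66);
      (3, false, 26, 6, 20); (6, false, 26, 3, 39);
      (3, false, 34, 6, 13); (6, false, 34, 3, 26);
      (3, false, 38, 6, 12); (6, false, 38, 3, 23);
      (6, false, 46, 3, 20); (6, false, 50, 3, 19)]%N.

Definition mixed_entry_ok (e : nat * bool * nat * nat * nat) : bool :=
  let: (w, s, c, k, m) := e in
  all_if (fun x => if coprime x 6 then
      let y := mixed_pair s c k x in pair_ok 6 w y.1 y.2 else true) (iota 5 (m - 5)%N).

Lemma mixed_entries_ok : all_if mixed_entry_ok mixed_entries.
Proof. by vm_compute. Qed.

Lemma mixed_entryP w s c k m x : (w, s, c, k, m) \in mixed_entries -> coprime x 6 -> (5 <= x < m)%N ->
  pair_ok 6 w (mixed_pair s c k x).1 (mixed_pair s c k x).2.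
Proof.
move=> /(all_ifP mixed_entries_ok) /all_ifP H cx /andP[x5 xm]; have := H x; rewrite cx; apply.
by rewrite mem_iota x5 subnKC // (leq_trans x5 (ltnW xm)).
Qed.

(** * Admissible triples and exceptional pairs *)

Definition admissible p q r : bool :=
  [&& (0 < p), (0 < q), (0 < r), q * r + p * r + p * q < p * q * r & ~~ in_hilbert_series p q r]%N.

Lemma admissible_perm12 p q r : admissible p q r -> admissible q p r.
Proof.
case/and5P=> p0 q0 r0 h hil; apply/and5P; split=> //; first by move: h; clear; lia.
rewrite /in_hilbert_series (eq_has (a2 := perm_eq [:: p; q; r])) // => s.
exact: (perm_catCA [:: q] [:: p] [:: r]).
Qed.

Lemma admissible_perm23 p q r : admissible p q r -> admissible p r q.
Proof.
case/and5P=> p0 q0 r0 h hil; apply/and5P; split=> //; first by move: h; clear; lia.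
rewrite /in_hilbert_series (eq_has (a2 := perm_eq [:: p; q; r])) // => s.
by apply/permPl: s; rewrite perm_cons; apply/permPl; exact: (perm_catC [:: r] [:: q]).
Qed.

Lemma admissible_ge2 p q r : admissible p q r -> [/\ 1 < p, 1 < q & 1 < r]%N.
Proof. by case/and5P=> *; split; nia. Qed.

Lemma pair_okP e w p q c : pair_ok e w p q -> coprime c e -> admissible p q (w * c) ->
  good p q (w * c)%N.
Proof.
rewrite /pair_ok; case: ifP => [/pair_checkP H _|_ /pair_checkP H] ce /and5P[_ _ wc0 hyp hil];
  by apply: H => //; move: wc0; rewrite muln_gt0 => /andP[].
Qed.

Definition exceptional p q : bool := ((p, q) \in small_pairs) || ((q, p) \in small_pairs).

Lemma exceptional_good p q r : admissible p q r -> exceptional p q -> good p q r.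
Proof.
have ok x : x \in small_pairs -> pair_ok 1 1 x.1 x.2 by apply: (all_ifP small_pairs_ok).
have fin p' q' : admissible p' q' r -> (p', q') \in small_pairs -> good p' q' r.
  by move=> ad /ok H; have := pair_okP H (coprimen1 r); rewrite mul1n; apply.
move=> ad /orP[/(fin _ _ ad)//|/fin H]; apply: good_perm12; apply: H.
exact: admissible_perm12.
Qed.

Lemma exceptional_good13 p q r : admissible p q r -> exceptional p r -> good p q r.
Proof. by move=> /admissible_perm23 ad /(exceptional_good ad) H; apply: good_perm23. Qed.

Lemma exceptional_good23 p q r : admissible p q r -> exceptional q r -> good p q r.
Proof. by move=> /admissible_perm12 ad /(exceptional_good13 ad) H; apply: good_perm12. Qed.

(** * The triples 6a, 3b, 2c with a, b, c prime to 6 *)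

Lemma dst_frac (k n p : nat) : dst (pt (Posz k) p) <= `|k%:R / p%:R - n%:R|.
Proof. by have := dst_le (pt k p) n; rewrite /pt -!pmulrn. Qed.

Lemma mixed_bound (kap m l : nat) (u v : R) a b c : (0 < a)%N -> (0 < b)%N -> (0 < c)%N ->
  `|2 * kap%:R * inv b - m%:R| <= u -> `|3 * kap%:R * inv c - l%:R| <= v ->
  kap%:R * inv a + u + v <= 1/3 ->
  dst (pt (6 * kap%:Z) (6 * a)) + dst (pt (6 * kap%:Z) (3 * b)) + dst (pt (6 * kap%:Z) (2 * c)) <= 1/3.
Proof.
move=> a0 b0 c0 Hu Hv; apply: le_trans; rewrite -PoszM.
have an0 : a%:R != 0 :> R by rewrite pnatr_eq0 -lt0n.
have bn0 : b%:R != 0 :> R by rewrite pnatr_eq0 -lt0n.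
have cn0 : c%:R != 0 :> R by rewrite pnatr_eq0 -lt0n.
apply: lerD; first apply: lerD.
- apply: le_trans (dst_frac _ 0 _) _; rewrite subr0 ger0_norm ?divr_ge0 // !natrM.
  by rewrite le_eqVlt; apply/orP; left; apply/eqP; field.
- apply: le_trans (dst_frac _ m _) _; apply: le_trans Hu.
  by rewrite le_eqVlt; apply/orP; left; apply/eqP; congr `|_ - _|; rewrite !natrM; field.
- apply: le_trans (dst_frac _ l _) _; apply: le_trans Hv.
  by rewrite le_eqVlt; apply/orP; left; apply/eqP; congr `|_ - _|; rewrite !natrM; field.
Qed.

Lemma coprime6 x : coprime x 6 = odd x && ~~ (3 %| x)%N.
Proof. by rewrite coprime_sym -[6%N]/(2 * 3)%N coprimeMl coprime2n prime_coprime. Qed.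

(** The smallness hypothesis of [good_110_mixed3] for the triple [6 * a], [3 * b], [2 * c], whose
    error terms are the distances of [kap / a], [2 * kap / b] and [3 * kap / c]. The values 1, 2, 3
    of [kap] are prime to [W], which is prime to 6. *)
Definition mixed_ok a b c := exists2 kap : nat, kap \in [:: 1; 2; 3]%N &
  dst (pt (6 * kap%:Z) (6 * a)) + dst (pt (6 * kap%:Z) (3 * b)) + dst (pt (6 * kap%:Z) (2 * c)) <= 1/3.

Lemma mixed_ok1 a b c a0 b0 c0 : (0 < a0 <= a)%N -> (0 < b0 <= b)%N -> (0 < c0 <= c)%N ->
  inv a0 + 2 * inv b0 + 3 * inv c0 <= 1/3 -> mixed_ok a b c.
Proof.
move=> /andP[a00 Ha] /andP[b00 Hb] /andP[c00 Hc] H; exists 1%N => //.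
have Ia := inv_bound Ha a00; have Ib := inv_bound Hb b00; have Ic := inv_bound Hc c00.
have [a1 b1 c1] := And3 (leq_trans a00 Ha) (leq_trans b00 Hb) (leq_trans c00 Hc).
apply: (@mixed_bound 1 0 0 (2 * inv b0) (3 * inv c0)) => //.
- by rewrite ler_norml; rlra.
- by rewrite ler_norml; rlra.
rlra.
Qed.

Lemma mixed_okb (kap m : nat) a b c a0 c0 (v : R) : kap \in [:: 1; 2; 3]%N ->
  (0 < a0 <= a)%N -> (0 < b)%N -> (0 < c0 <= c)%N ->
  `|2 * kap%:R * inv b - m%:R| <= v ->
  kap%:R * inv a0 + v + 3 * kap%:R * inv c0 <= 1/3 -> mixed_ok a b c.
Proof.
move=> Hk /andP[a00 Ha] b0 /andP[c00 Hc] Hv H; exists kap => //.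
have Ia := inv_bound Ha a00; have Ic := inv_bound Hc c00.
apply: (@mixed_bound kap m 0 v (3 * kap%:R * inv c0)) => //.
- exact: leq_trans a00 Ha.
- exact: leq_trans c00 Hc.
- by rewrite subr0 ger0_norm ?mulr_ge0 ?invr_ge0 // ler_wpM2l ?mulr_ge0 //; case/andP: Ic.
apply: le_trans H; rewrite !lerD2r ler_wpM2l //; by case/andP: Ia.
Qed.

Lemma mixed_okc (kap l : nat) a b c a0 b0 (v : R) : kap \in [:: 1; 2; 3]%N ->
  (0 < a0 <= a)%N -> (0 < b0 <= b)%N -> (0 < c)%N ->
  `|3 * kap%:R * inv c - l%:R| <= v ->
  kap%:R * inv a0 + 2 * kap%:R * inv b0 + v <= 1/3 -> mixed_ok a b c.
Proof.
move=> Hk /andP[a00 Ha] /andP[b00 Hb] c0 Hv H; exists kap => //.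
have Ia := inv_bound Ha a00; have Ib := inv_bound Hb b00.
apply: (@mixed_bound kap 0 l (2 * kap%:R * inv b0) v) => //.
- exact: leq_trans a00 Ha.
- exact: leq_trans b00 Hb.
- by rewrite subr0 ger0_norm ?mulr_ge0 ?invr_ge0 // ler_wpM2l ?mulr_ge0 //; case/andP: Ib.
apply: le_trans H; rewrite !lerD2r ler_wpM2l //; by case/andP: Ia.
Qed.

(** For [a = 1] the term [kap / a] is an integer, and only the other two contribute. *)
Lemma mixed_ok_a1 b c : (13 <= b)%N -> (19 <= c)%N -> mixed_ok 1 b c.
Proof.
move=> Hb Hc; exists 1%N => //.
have Ib := inv_bound Hb isT; have Ic := inv_bound Hc isT.
have : dst (pt (6 * 1%:Z) (6 * 1)) <= 0.
  by apply: le_trans (dst_frac 6 1 6) _; rewrite ler_norml; rlra.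
have : dst (pt (6 * 1%:Z) (3 * b)) <= 2 / 13.
  apply: le_trans (dst_frac 6 0 _) _; rewrite subr0 ger0_norm ?divr_ge0 // natrM.
  have bn0 : b%:R != 0 :> R by rewrite pnatr_eq0; move: Hb; clear; case: b.
  by rewrite (_ : 6%:R / _ = 2 * inv b); [rlra | field].
have : dst (pt (6 * 1%:Z) (2 * c)) <= 3 / 19.
  apply: le_trans (dst_frac 6 0 _) _; rewrite subr0 ger0_norm ?divr_ge0 // natrM.
  have cn0 : c%:R != 0 :> R by rewrite pnatr_eq0; move: Hc; clear; case: c.
  by rewrite (_ : 6%:R / _ = 3 * inv c); [rlra | field].
rlra.
Qed.

(** The crude condition is [1 / a + 2 / b + 3 / c <= 1/3]. If [b] or [c] is 5 or 7, [kap] is chosen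
    to bring its term near the integer 1, as in [4/5], [6/7] or [6/5]. With one number small, either
    another is below a fixed bound and their pair is in the table, or the remaining terms are small
    enough. *)
Lemma mixed_cases a b c : coprime a 6 -> coprime b 6 -> coprime c 6 -> (5 <= b)%N -> (5 <= c)%N ->
  [\/ mixed_ok a b c, pair_ok 6 2 (6 * a) (3 * b), pair_ok 6 3 (6 * a) (2 * c) |
    pair_ok 6 6 (3 * b) (2 * c)].
Proof.
move=> ca cb cc b5 c5.
have := ca; have := cb; have := cc; rewrite !coprime6 => /andP[c2 c3] /andP[b2 b3] /andP[a2 a3].
have a0 : (0 < a)%N by case: (a) a2.
have b0 : (0 < b)%N by case: (b) b2.
have c0 : (0 < c)%N by case: (c) c2.
have pab m : (2, true, 6 * a, 3, m)%N \in mixed_entries -> (b < m)%N -> pair_ok 6 2 (6 * a) (3 * b).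
  by move=> H bm; have := mixed_entryP H cb; rewrite b5 bm => /(_ isT).
have pac m : (3, true, 6 * a, 2, m)%N \in mixed_entries -> (c < m)%N -> pair_ok 6 3 (6 * a) (2 * c).
  by move=> H cm; have := mixed_entryP H cc; rewrite c5 cm => /(_ isT).
have pba m : (2, false, 3 * b, 6, m)%N \in mixed_entries -> (5 <= a < m)%N -> pair_ok 6 2 (6 * a) (3 * b).
  by move=> H am; have := mixed_entryP H ca am.
have pbc m : (6, true, 3 * b, 2, m)%N \in mixed_entries -> (c < m)%N -> pair_ok 6 6 (3 * b) (2 * c).
  by move=> H cm; have := mixed_entryP H cc; rewrite c5 cm => /(_ isT).
have pca m : (3, false, 2 * c, 6, m)%N \in mixed_entries -> (5 <= a < m)%N -> pair_ok 6 3 (6 * a) (2 * c).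
  by move=> H am; have := mixed_entryP H ca am.
have pcb m : (6, false, 2 * c, 3, m)%N \in mixed_entries -> (b < m)%N -> pair_ok 6 6 (3 * b) (2 * c).
  by move=> H bm; have := mixed_entryP H cb; rewrite b5 bm => /(_ isT).
have [a9|a9] := ltnP a 9.
  have [Ea|[Ea|Ea]] : a = 1%N \/ a = 5%N \/ a = 7%N by move: a0 a2 a3 a9; clear; lia.
  - subst a; have [Hb|Hb] := ltnP b 12; first by apply: Or42; apply: (pab 12).
    have [Hc|Hc] := ltnP c 18; first by apply: Or43; apply: (pac 18).
    apply: Or41; apply: mixed_ok_a1; [move: Hb b2 b3 | move: Hc c2 c3]; clear; lia.
  - subst a; have [Hb|Hb] := ltnP b 30; first by apply: Or42; apply: (pab 30).
    have [Hc|Hc] := ltnP c 45; first by apply: Or43; apply: (pac 45).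
    by apply: Or41; apply: (@mixed_ok1 _ _ _ 5 30 45) => //; rlra.
  - subst a; have [Hb|Hb] := ltnP b 21; first by apply: Or42; apply: (pab 21).
    have [Hc|Hc] := ltnP c 32; first by apply: Or43; apply: (pac 32).
    by apply: Or41; apply: (@mixed_ok1 _ _ _ 7 21 32) => //; rlra.
have [b18|b18] := ltnP b 18.
  have Eb : [\/ b = 5, b = 7, b = 11 | b = 13]%N \/ b = 17%N.
    by move: b5 b2 b3 b18; clear => *; have : b \in [:: 5; 7; 11; 13; 17]%N by [rewrite !inE; lia];
      rewrite !inE => /or4P[/eqP->|/eqP->|/eqP->|/orP[/eqP->|/eqP->]]; [left; apply: Or41 | left; apply: Or42 | left; apply: Or43 | left; apply: Or44 | right].
  have a5 : (5 <= a)%N by apply: leq_trans a9.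
  case: Eb => [[]|] Eb; subst b.
  - have [Ha|Ha] := ltnP a 30; first by apply: Or42; apply: (pba 30); rewrite ?a5.
    have [Hc|Hc] := ltnP c 90; first by apply: Or44; apply: (pbc 90).
    by apply: Or41; apply: (@mixed_okb 2 1 _ _ _ 30 90 (1/5)) => //; [rewrite ler_norml; rlra | rlra].
  - have [Ha|Ha] := ltnP a 32; first by apply: Or42; apply: (pba 32); rewrite ?a5.
    have [Hc|Hc] := ltnP c 95; first by apply: Or44; apply: (pbc 95).
    by apply: Or41; apply: (@mixed_okb 3 1 _ _ _ 32 95 (1/7)) => //; [rewrite ler_norml; rlra | rlra].
  - have [Ha|Ha] := ltnP a 14; first by apply: Or42; apply: (pba 14); rewrite ?a5.
    have [Hc|Hc] := ltnP c 40; first by apply: Or44; apply: (pbc 40).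
    by apply: Or41; apply: (@mixed_okb 1 0 _ _ _ 14 40 (2/11)) => //; [rewrite ler_norml; rlra | rlra].
  - have [Ha|Ha] := ltnP a 12; first by apply: Or42; apply: (pba 12); rewrite ?a5.
    have [Hc|Hc] := ltnP c 34; first by apply: Or44; apply: (pbc 34).
    by apply: Or41; apply: (@mixed_okb 1 0 _ _ _ 12 34 (2/13)) => //; [rewrite ler_norml; rlra | rlra].
  - have [Hc|Hc] := ltnP c 28; first by apply: Or44; apply: (pbc 28).
    have a11 : (11 <= a)%N by move: a9 a2 a3; clear; lia.
    by apply: Or41; apply: (@mixed_okb 1 0 _ _ _ 11 28 (2/17)) => //; [rewrite ler_norml; rlra | rlra].
have a11 : (11 <= a)%N by move: a9 a2 a3; clear; lia.
have b19 : (19 <= b)%N by move: b18 b2 b3; clear; lia.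
have a5 : (5 <= a)%N by apply: leq_trans a9.
have [c27|c27] := ltnP c 27; last first.
  have c29 : (29 <= c)%N by move: c27 c2 c3; clear; lia.
  by apply: Or41; apply: (@mixed_ok1 _ _ _ 11 19 29) => //; rlra.
have Ec : [\/ c = 5, c = 7, c = 11 | c = 13]%N \/ [\/ c = 17, c = 19, c = 23 | c = 25]%N.
  move: c5 c2 c3 c27; clear => *; have : c \in [:: 5; 7; 11; 13; 17; 19; 23; 25]%N by [rewrite !inE; lia].
  rewrite !inE => /or4P[/eqP->|/eqP->|/eqP->|/orP[/eqP->|/or4P[]/eqP->]];
  by [left; apply: Or41 | left; apply: Or42 | left; apply: Or43 | left; apply: Or44
     | right; apply: Or41 | right; apply: Or42 | right; apply: Or43 | right; apply: Or44].
have fin (kap l ma mb a0' b0' : nat) (v : R) : kap \in [:: 1; 2; 3]%N ->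
    (3, false, 2 * c, 6, ma)%N \in mixed_entries \/ (ma <= 11)%N ->
    (6, false, 2 * c, 3, mb)%N \in mixed_entries ->
    `|3 * kap%:R * inv c - l%:R| <= v ->
    (0 < a0' <= maxn ma 11)%N -> (0 < b0' <= maxn mb 19)%N ->
    kap%:R * inv a0' + 2 * kap%:R * inv b0' + v <= 1/3 ->
    [\/ mixed_ok a b c, pair_ok 6 2 (6 * a) (3 * b), pair_ok 6 3 (6 * a) (2 * c) |
    pair_ok 6 6 (3 * b) (2 * c)].
  move=> Hk Ha Hb Hv /andP[a0'0 Ha0] /andP[b0'0 Hb0] H.
  have [Hbm|Hbm] := ltnP b mb; first by apply: Or44; apply: (pcb mb).
  have [Ham|Ham] := ltnP a ma.
    by case: Ha => [Ha|Ha]; [apply: Or43; apply: (pca ma); rewrite ?a5 | move: Ham; rewrite ltnNge (leq_trans Ha a11)].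
  apply: Or41; apply: (mixed_okc Hk _ _ c0 Hv H).
    by rewrite a0'0 (leq_trans Ha0) // geq_max Ham.
  by rewrite b0'0 (leq_trans Hb0) // geq_max Hbm.
case: Ec => -[] Ec; subst c.
- by apply: (fin 2%N 1%N 30%N 60%N 30%N 60%N (1/5)) => //; [left | rewrite ler_norml; rlra | rlra].
- by apply: (fin 2%N 1%N 21%N 42%N 21%N 42%N (1/7)) => //; [left | rewrite ler_norml; rlra | rlra].
- by apply: (fin 1%N 0%N 33%N 66%N 33%N 66%N (3/11)) => //; [left | rewrite ler_norml; rlra | rlra].
- by apply: (fin 1%N 0%N 20%N 39%N 20%N 39%N (3/13)) => //; [left | rewrite ler_norml; rlra | rlra].
- by apply: (fin 1%N 0%N 13%N 26%N 13%N 26%N (3/17)) => //; [left | rewrite ler_norml; rlra | rlra].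
- by apply: (fin 1%N 0%N 12%N 23%N 12%N 23%N (3/19)) => //; [left | rewrite ler_norml; rlra | rlra].
- by apply: (fin 1%N 0%N 11%N 20%N 11%N 20%N (3/23)) => //; [right | rewrite ler_norml; rlra | rlra].
- by apply: (fin 1%N 0%N 11%N 19%N 11%N 19%N (3/25)) => //; [right | rewrite ler_norml; rlra | rlra].
Qed.

(** * Case analysis *)

Section Assembly.
Implicit Types (p q r N A B C e L W : nat).

Lemma inv_sum_le p q r p0 q0 r0 (u : R) : (0 < p0 <= p)%N -> (0 < q0 <= q)%N -> (0 < r0 <= r)%N ->
  inv p0 + inv q0 + inv r0 <= u -> inv p + inv q + inv r <= u.
Proof.
move=> /andP[p00 Hp] /andP[q00 Hq] /andP[r00 Hr].
by have := inv_bound Hp p00; have := inv_bound Hq q00; have := inv_bound Hr r00; rlra.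
Qed.

Lemma inv_sum2_le q r q0 r0 (u : R) : (0 < q0 <= q)%N -> (0 < r0 <= r)%N ->
  inv q0 + inv r0 <= u -> inv q + inv r <= u.
Proof.
move=> /andP[q00 Hq] /andP[r00 Hr].
by have := inv_bound Hq q00; have := inv_bound Hr r00; rlra.
Qed.

(** Instantiated at numerals, this excludes one concrete pair in a form ready for linear
    arithmetic. *)
Definition avoids x y := forall a b, exceptional a b -> ~ (x = a /\ y = b).

Lemma good_unless_exceptional p q r : admissible p q r ->
  (avoids p q -> avoids p r -> avoids q r -> good p q r) -> good p q r.
Proof.
move=> ad; have avoidsP x y : exceptional x y \/ avoids x y.
  case: (boolP (exceptional x y)) => nE; [by left | right=> a b Eab [xa yb]].
  by move: nE; rewrite xa yb Eab.
case: (avoidsP p q) => [E|n_pq]; first by move=> _; exact: exceptional_good ad E.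
case: (avoidsP p r) => [E|n_pr]; first by move=> _; exact: exceptional_good13 ad E.
case: (avoidsP q r) => [E|n_qr]; first by move=> _; exact: exceptional_good23 ad E.
exact.
Qed.

Lemma good_of_flip p q r e1 e2 e3 A B C N : admissible p q r ->
  dec p e1 A N -> dec q e2 B N -> dec r e3 C N -> (e3 <= e2 < e1)%N -> good p q r.
Proof.
move=> ad dp dq dr /andP[l32 l21]; have [p1 q1 r1] := admissible_ge2 ad.
have [p' op Ep] := dec_form dp; have [q' oq Eq] := dec_form dq; have [r' or Er] := dec_form dr.
case: e1 dp l21 Ep => // e1 dp l21 Ep.
case: e2 dq l32 l21 Eq => [|[|e2]] dq l32 l21 Eq.
- case: e3 dr l32 Er => // dr _ Er.
  apply: (flip_e00 dp dq dr).
  + by move: q1 Eq oq; rewrite expn0; clear; lia.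
  + by move: r1 Er or; rewrite expn0; clear; lia.
  + apply/implyP=> /eqP E; move: p1 Ep op; rewrite E expn1; clear; lia.
- case: e1 dp l21 Ep => // e1 dp _ Ep.
  have q6 : (q == 2)%N || (6 <= q)%N by move: q1 Eq oq; rewrite expn1; clear; lia.
  case: e3 dr l32 Er => [|[|]] // dr _ Er.
    have r3 : (3 <= r)%N by move: r1 Er or; rewrite expn0; clear; lia.
    case: e1 dp Ep => [|e1] dp Ep; last exact: flip_e10 dp dq dr r3 q6.
    have p4 : (p == 4)%N || (12 <= p)%N by move: p1 Ep op; clear; lia.
    case: (eqVneq q 2) q6 => [Eq2 _|q2 /= q6].
      apply: (flip_210 dp dq dr r3); last by rewrite Eq2.
      by case/orP: p4 => [->|->]; rewrite ?orbT ?Eq2.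
    case: (eqVneq p 4) p4 => [Ep4 _|_ /= p12].
      by rewrite Ep4 in dp *; exact: flip_210_4 dp dq dr r3 q6.
    by apply: (flip_210 dp dq dr r3); rewrite ?p12 ?q6 orbT.
  have r6 : (r == 2)%N || (6 <= r)%N by move: r1 Er or; rewrite expn1; clear; lia.
  have p4 : (4 <= p)%N by exact: dec_ge4 dp.
  have q2r : (q == 2)%N -> good p q r.
    move=> /eqP Eq2; rewrite Eq2 in ad dq *; have {r6} r6 : (6 <= r)%N.
      case/orP: r6 => // /eqP r2; move: ad; rewrite r2 => /and5P[_ _ _ + _]; clear; lia.
    case: (eqVneq p 4) => [p4'|p4']; first by apply: exceptional_good => //; rewrite p4'.
    apply: (flip_e11_2 dp dq dr r6); apply/implyP=> /eqP E; move: p4 p4' Ep op; rewrite E; clear; lia.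
  case/orP: (q6) => [/q2r//|{}q6].
  case/orP: (r6) => [/eqP r2|{}r6].
    apply: good_perm23; rewrite r2 in ad dr *.
    case: (eqVneq p 4) => [p4'|p4']; first by apply: exceptional_good; [exact: admissible_perm23 | rewrite p4'].
    apply: (flip_e11_2 dp dr dq q6); apply/implyP=> /eqP E; move: p4 p4' Ep op; rewrite E; clear; lia.
  apply: (good_unless_exceptional ad) => n_pq n_pr n_qr.
  have [h1 h2 h3] := And3 (n_qr 6 6 isT) (n_qr 6 10 isT)
    (n_qr 10 6 isT).
  have qr : (14 <= q)%N || (14 <= r)%N || (10 <= q)%N && (10 <= r)%N.
    by move: Eq Er oq or q6 r6 h1 h2 h3; rewrite expn1; clear; lia.
  have qr4 : inv q + inv r <= 1/4.
    case/orP: qr => [/orP[H|H]|/andP[H1 H2]].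
    + by apply: (@inv_sum2_le _ _ 14 6) => //; rlra.
    + by apply: (@inv_sum2_le _ _ 6 14) => //; rlra.
    + by apply: (@inv_sum2_le _ _ 10 10) => //; rlra.
  apply: (flip_e11 dp dq dr q6 r6); case: e1 dp Ep => [|e1] dp Ep //=.
  have [->//|p4'] := eqVneq p 4; rewrite orFb.
  have p12 : (12 <= p)%N by move: p4 p4' Ep op; clear; lia.
  have Bd : [\/ (28 <= p)%N && (22 <= r)%N, (28 <= p)%N && (22 <= q)%N,
      (14 <= q)%N && (14 <= r)%N | [&& 20 <= p, 10 <= q & 10 <= r]%N].
    have [h4' h4] := conj (n_qr 6 14 isT) (n_qr 6 18 isT).
    have [h6 h7] := conj (n_qr 14 6 isT) (n_qr 18 6 isT).
    have [h8 h9 h10] := And3 (n_pq 12 6 isT)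
      (n_pq 20 6 isT) (n_pq 12 10 isT).
    have [h11 h12 h13] := And3 (n_pr 12 6 isT)
      (n_pr 20 6 isT) (n_pr 12 10 isT).
    have [Hq|Hq] : (q = 6 \/ 10 <= q)%N by move: q6 Eq oq; rewrite expn1; clear; lia.
      by apply: Or41; move: r6 Er or p12 Ep op Hq h1 h2 h4' h4 h8 h9; rewrite expn1; clear; lia.
    have [Hr|Hr] : (r = 6 \/ 10 <= r)%N by move: r6 Er or; rewrite expn1; clear; lia.
      by apply: Or42; move: q6 Eq oq p12 Ep op Hr h1 h3 h6 h7 h11 h12; rewrite expn1; clear; lia.
    have [Hp|Hp] : (p = 12 \/ 20 <= p)%N by move: p12 Ep op; clear; lia.
      by apply: Or43; move: Hq Hr Hp Eq Er oq or h10 h13; rewrite expn1; clear; lia.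
    by apply: Or44; rewrite Hp Hq Hr.
  case: Bd => [/andP[Hp Hr]|/andP[Hp Hq]|/andP[Hq Hr]|/and3P[Hp Hq Hr]].
  - by apply: (@inv_sum_le _ _ _ 28 6 22) => //; rlra.
  - by apply: (@inv_sum_le _ _ _ 28 22 6) => //; rlra.
  - by apply: (@inv_sum_le _ _ _ 12 14 14) => //; rlra.
  - by apply: (@inv_sum_le _ _ _ 20 10 10) => //; rlra.
- have [E32|l32'] := eqVneq e3 e2.+2.
    by rewrite E32 in dr; exact: flip_eff dp dq dr l21.
  have l : (e3 < e2.+2 < e1.+1)%N by rewrite ltn_neqAle l32' l32.
  have [r6|r6] := eqVneq r 6; last exact: flip_decreasing dp dq dr l isT r1 r6.
  have e3_1 : e3 = 1%N.
    move: Er or; rewrite r6; clear; case: e3 => [|[|n]] //; first by rewrite expn0; lia.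
    by rewrite !expnS; move: (2 ^ n)%N => x; lia.
  have [q4|q4] := eqVneq q 4; first by apply: (exceptional_good23 ad); rewrite q4 r6.
  by rewrite r6 e3_1 in dr *; exact: (flip_decreasing_6 dp dq dr).
Qed.

Lemma good_of_equal p q r e A B C N : admissible p q r ->
  dec p e.+1 A N -> dec q e.+1 B N -> dec r e.+1 C N -> good p q r.
Proof.
move=> ad dp dq dr; have [p1 q1 r1] := admissible_ge2 ad.
case: e dp dq dr => [|e] dp dq dr; last exact: flip_eee dp dq dr.
have six x D : (1 < x)%N -> dec x 1 D N -> (x == 2)%N || (6 <= x)%N.
  by move=> x1 /dec_form[x' ox]; rewrite expn1 => Ex; move: x1 Ex ox; clear; lia.
have two y z D E F : admissible 2 y z -> dec 2 1 D N -> dec y 1 E N -> dec z 1 F N -> good 2%N y z.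
  move=> ad2 d2 dy dz; have [_ y1 z1] := admissible_ge2 ad2.
  have y6 := six _ _ y1 dy; have z6 := six _ _ z1 dz.
  have [_ _ _ hyp hil] := and5P ad2.
  have {y6} y6 : (6 <= y)%N by case/orP: y6 => // /eqP y2; move: hyp; rewrite y2; clear; lia.
  have {z6} z6 : (6 <= z)%N by case/orP: z6 => // /eqP z2; move: hyp; rewrite z2; clear; lia.
  have [y' oy Ey] := dec_form dy; have [z' oz Ez] := dec_form dz; rewrite expn1 in Ey Ez.
  have ne a b : in_hilbert_series 2 a b -> ~ (y = a /\ z = b).
    by move=> Hab [ya zb]; move: hil; rewrite ya zb Hab.
  (* Among numbers from 6 on that are 2 modulo 4, only the pairs 6, 6 and 6, 10 violate the bound
     1/4, and with 2 they form Hilbert triples. *)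
  have [h1 h2 h3] := And3 (ne 6 6 isT) (ne 6 10 isT) (ne 10 6 isT).
  apply: (flip_111_2 d2 dy dz y6 z6).
  have [H|H|/andP[Hy Hz]] : [\/ 14 <= y, 14 <= z | (10 <= y) && (10 <= z)]%N.
    have [Hy|Hy|Hy] : [\/ y = 6, y = 10 | 14 <= y]%N.
      by have : [|| y == 6, y == 10 | 14 <= y]%N by [move: y6 Ey oy; clear; lia]; case/or3P=> [/eqP|/eqP|] ?; [apply: Or31 | apply: Or32 | apply: Or33].
    - by apply: Or32; move: z6 Ez oz Hy h1 h2; clear; lia.
    - have [Hz|Hz] : (z = 6 \/ 10 <= z)%N by move: z6 Ez oz; clear; lia.
        by case: h3.
      by apply: Or33; rewrite Hy Hz.
    - exact: Or31.
  - by apply: (@inv_sum2_le _ _ 14 6) => //; rlra.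
  - by apply: (@inv_sum2_le _ _ 6 14) => //; rlra.
  - by apply: (@inv_sum2_le _ _ 10 10) => //; rlra.
case/orP: (six _ _ p1 dp) => [/eqP p2|p6]; first by rewrite p2 in ad dp *; exact: two ad dp dq dr.
case/orP: (six _ _ q1 dq) => [/eqP q2|q6].
  by apply: good_perm12; rewrite q2 in ad dq *; exact: two (admissible_perm12 ad) dq dp dr.
case/orP: (six _ _ r1 dr) => [/eqP r2|r6]; last exact: flip_111 dp dq dr p6 q6 r6.
apply: good_perm23; apply: good_perm12; rewrite r2 in ad dr *.
exact: two (admissible_perm12 (admissible_perm23 ad)) dr dp dq.
Qed.

Lemma good_of_tie p q r e e3 A B C N : admissible p q r ->
  dec p e.+2 A N -> dec q e.+2 B N -> dec r e3 C N -> (e3 < e.+2)%N -> good p q r.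
Proof.
move=> ad dp dq dr l3; have [p1 q1 r1] := admissible_ge2 ad.
have [p' op Ep] := dec_form dp; have [q' oq Eq] := dec_form dq; have [r' or Er] := dec_form dr.
apply: (good_unless_exceptional ad) => n_pq n_pr n_qr.
case: e dp dq l3 Ep Eq => [|e] dp dq l3 Ep Eq; last first.
  case: (ltnP e3 e.+2) => l3'; last first.
    have E3 : e3 = e.+2 by apply/eqP; rewrite eqn_leq l3' andbT -ltnS.
    by rewrite E3 in dr; exact: tie_adjacent dp dq dr.
  have [r6|r6] := eqVneq r 6; last exact: tie_gap dp dq dr l3' r1 r6.
  have e3_1 : e3 = 1%N.
    move: Er or; rewrite r6; clear; case: e3 => [|[|n]] //; first by rewrite expn0; lia.
    by rewrite !expnS; move: (2 ^ n)%N => x; lia.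
  rewrite r6 e3_1 in dr *; apply: (tie_gap_6 dp dq dr).
  have ge x D : dec x e.+3 D N -> x <> 8 -> (16 <= x)%N.
    case/dec_form=> x' ox; rewrite -[e.+3]/(3 + e)%N expnD => ->.
    by have := expn_gt0 2 e; move: (2 ^ e)%N ox => y; clear; nia.
  apply: (@inv_sum2_le _ _ 16 16); last rlra.
  - by apply: (ge p _ dp) => p8; have := n_pr 8 6 isT; rewrite p8 r6; case.
  - by apply: (ge q _ dq) => q8; have := n_qr 8 6 isT; rewrite q8 r6; case.
have four x x' : odd x' -> x = (2 ^ 2 * x')%N -> [\/ x = 4, x = 12, x = 20 | 28 <= x]%N.
  move=> ox Ex; have : [|| x == 4, x == 12, x == 20 | 28 <= x]%N by move: Ex ox; clear; lia.
  by case/or4P=> [/eqP|/eqP|/eqP|] ?; [apply: Or41 | apply: Or42 | apply: Or43 | apply: Or44].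
have Hp := four _ _ op Ep; have Hq := four _ _ oq Eq.
have p4 := dec_ge4 dp; have q4 := dec_ge4 dq.
case: e3 dr l3 Er => [|[|]] // dr _ Er.
  have r3 : (3 <= r)%N by move: r1 Er or; rewrite expn0; clear; lia.
  apply: (tie_220 dp dq dr).
  have [P|P] := eqVneq p 4.
    have r5 : (5 <= r)%N by have := n_pr 4 3 isT; move: P r3 Er or; rewrite expn0; clear; lia.
    apply: (@inv_sum_le _ _ _ 4 20 5) => //; last rlra.
    by have := n_pq 4 4 isT; have := n_pq 4 12 isT; case: Hq; move: P; clear; lia.
  have p12 : (12 <= p)%N by case: Hp; move: P; clear; lia.
  have [Q|Q] := eqVneq q 4.
    have r5 : (5 <= r)%N by have := n_qr 4 3 isT; move: Q r3 Er or; rewrite expn0; clear; lia.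
    apply: (@inv_sum_le _ _ _ 20 4 5) => //; last rlra.
    by have := n_pq 12 4 isT; case: Hp; move: P Q; clear; lia.
  have q12 : (12 <= q)%N by case: Hq; move: Q; clear; lia.
  by apply: (@inv_sum_le _ _ _ 12 12 3) => //; rlra.
have [r2|r2] := eqVneq r 2; first by apply: (tie_221 dp dq dr); rewrite r2.
have r6 : (6 <= r)%N by move: r1 r2 Er or; rewrite expn1; clear; lia.
have [P|P] := eqVneq p 4.
  rewrite P in ad dp n_pq n_pr *; apply: (tie_221_4 dp dq dr).
  apply: (@inv_sum2_le _ _ 20 14); last rlra.
    by have := n_pq 4 4 isT; have := n_pq 4 12 isT; case: Hq; clear; lia.
  by have := n_pr 4 6 isT; have := n_pr 4 10 isT; move: r6 Er or; rewrite expn1; clear; lia.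
have [Q|Q] := eqVneq q 4.
  rewrite Q in ad dq n_pq n_qr *; apply: good_perm12; apply: (tie_221_4 dq dp dr).
  apply: (@inv_sum2_le _ _ 20 14); last rlra.
    by have := n_pq 4 4 isT; have := n_pq 12 4 isT; case: Hp; clear; lia.
  by have := n_qr 4 6 isT; have := n_qr 4 10 isT; move: r6 Er or; rewrite expn1; clear; lia.
apply: (tie_221 dp dq dr); apply/orP; right.
have p12 : (12 <= p)%N by case: Hp; move: P; clear; lia.
have q12 : (12 <= q)%N by case: Hq; move: Q; clear; lia.
have [r6'|r6'] := eqVneq r 6.
  apply: (@inv_sum_le _ _ _ 28 28 6); last rlra; last by rewrite r6'.
    by have := n_pr 12 6 isT; have := n_pr 20 6 isT; case: Hp; move: r6' p12; clear; lia.
  by have := n_qr 12 6 isT; have := n_qr 20 6 isT; case: Hq; move: r6' q12; clear; lia.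
have [r10|r10] := eqVneq r 10.
  apply: (@inv_sum_le _ _ _ 20 20 10); last rlra; last by rewrite r10.
    by have := n_pr 12 10 isT; case: Hp; move: r10 p12; clear; lia.
  by have := n_qr 12 10 isT; case: Hq; move: r10 q12; clear; lia.
apply: (@inv_sum_le _ _ _ 12 12 14) => //; last rlra.
by move: r6 r6' r10 Er or; rewrite expn1; clear; lia.
Qed.

(** Here 3 divides [p] and [q] exactly once and does not divide [r], which gives the form [6 * a],
    [3 * b], [2 * c] with [a], [b], [c] prime to 6. *)
Lemma good_of_mixed p q r A B C W : admissible p q r ->
  dec p 1 A (3 * W) -> dec q 0 B (3 * W) -> dec r 1 C (3 * W) ->
  ~~ (3 %| W)%N -> ~~ (3 %| A)%N -> ~~ (3 %| B)%N -> (3 %| C)%N ->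
  q != 3 -> r != 2 -> good p q r.
Proof.
move=> ad dp dq dr W3 A3 B3 C3 q3 r2; have [p1 q1 r1] := admissible_ge2 ad.
have [_ oA oN pA] := dp; have [_ _ _ qB] := dq; have [_ _ _ rC] := dr.
have [p' op Ep] := dec_form dp; have [q' oq Eq] := dec_form dq; have [r' or Er] := dec_form dr.
have [C' EC] := dvdnP C3.
have [a Ea ca] : exists2 a, p = (6 * a)%N & coprime a 6.
  have E : (p' * A = 3 * W)%N by move: pA; rewrite Ep; clear; nia.
  have : (3 %| p' * A)%N by rewrite E dvdn_mulr.
  rewrite Euclid_dvdM // (negbTE A3) orbF => /dvdnP[a Ea]; exists a; first by rewrite Ep Ea; ring.
  rewrite coprime6; apply/andP; split; first by move: op; rewrite Ea oddM => /andP[].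
  apply: contra W3 => a3; have -> : W = (a * A)%N by move: E; rewrite Ea; clear; nia.
  by rewrite dvdn_mulr.
have [b Eb cb] : exists2 b, q = (3 * b)%N & coprime b 6.
  have E : (q' * B = 3 * W)%N by move: qB; rewrite Eq; clear; nia.
  have : (3 %| q' * B)%N by rewrite E dvdn_mulr.
  rewrite Euclid_dvdM // (negbTE B3) orbF => /dvdnP[b Eb]; exists b; first by rewrite Eq Eb; ring.
  rewrite coprime6; apply/andP; split; first by move: oq; rewrite Eb oddM => /andP[].
  apply: contra W3 => b3; have -> : W = (b * B)%N by move: E; rewrite Eb; clear; nia.
  by rewrite dvdn_mulr.
have [c Ec cc] : exists2 c, r = (2 * c)%N & coprime c 6.
  exists r' => //; rewrite coprime6 or; apply: contra W3 => r3.
  have -> : W = (r' * C')%N by move: rC; rewrite Er EC; clear; nia.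
  by rewrite dvdn_mulr.
have b5 : (5 <= b)%N by move: cb q1 q3; rewrite coprime6 Eb; clear; lia.
have c5 : (5 <= c)%N by move: cc r1 r2; rewrite coprime6 Ec; clear; lia.
rewrite Ea Eb Ec in ad dp dq dr *.
case: (mixed_cases ca cb cc b5 c5) => [[kap Hk H]|H|H|H].
- apply: (good_110_mixed3 dp dq dr W3 A3 B3 C3 _ H).
  rewrite coprimezE /=; move: Hk; rewrite !inE => /or3P[] /eqP ->; rewrite ?coprime1n ?coprime2n //.
    by move: oN; rewrite oddM.
  by rewrite prime_coprime.
- exact: (pair_okP H).
- by apply: good_perm23; apply: (pair_okP H) => //; exact: admissible_perm23.
- apply: good_perm12; apply: good_perm23; apply: (pair_okP H) => //.
  exact: admissible_perm23 (admissible_perm12 ad).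
Qed.

(** [p] and [r] carry the full power of 3, at least 9, so [p] is a multiple of 18 and [r] of 9. The
    values 6 and 10 of [q] fall below the bound 12 of [good_110_pair_mixed]. *)
Lemma good_of_pair_mixed p q r A B C L : admissible p q r ->
  dec p 1 A (3 * L) -> dec q 1 B (3 * L) -> dec r 0 C (3 * L) -> (3 %| L)%N ->
  ~~ (3 %| A)%N -> (3 %| B)%N -> ~~ (3 %| C)%N -> (6 <= q)%N -> good p q r.
Proof.
move=> ad dp dq dr /dvdnP[L' EL] A3 B3 C3 q6.
apply: (good_unless_exceptional ad) => n_pq n_pr n_qr.
have [p' op Ep] := dec_form dp; have [q' oq Eq] := dec_form dq; have [r' or Er] := dec_form dr.
have [_ _ oN pA] := dp; have [_ _ _ rC] := dr; rewrite expn1 in Ep Eq; rewrite expn0 mul1n in Er.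
have EN : (3 * L = 9 * L')%N by rewrite EL; ring.
have Ep9 : (p' * A = 9 * L')%N by move: pA; rewrite Ep EN; clear; nia.
have Er9 : (r' * C = 9 * L')%N by move: rC; rewrite Er EN; clear; nia.
have [a Ea] : exists a, p' = (9 * a)%N.
  have : (9 %| p' * A)%N by rewrite Ep9 dvdn_mulr.
  rewrite -[9%N]/(3 ^ 2)%N Gauss_dvdl; first by case/dvdnP=> a ->; exists a; rewrite mulnC.
  by apply: coprimeXl; rewrite prime_coprime.
have [c Ec] : exists c, r' = (9 * c)%N.
  have : (9 %| r' * C)%N by rewrite Er9 dvdn_mulr.
  rewrite -[9%N]/(3 ^ 2)%N Gauss_dvdl; first by case/dvdnP=> c ->; exists c; rewrite mulnC.
  by apply: coprimeXl; rewrite prime_coprime.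
have p18 : p <> 18 -> (54 <= p)%N by move: op; rewrite Ep Ea; clear; lia.
have r9 : r <> 9 -> (27 <= r)%N by move: or; rewrite Er Ec; clear; lia.
have [q12|q12] := leqP 12 q.
  by apply: good_perm23; apply: (good_110_pair_mixed dp dr dq) => //; rewrite EL dvdn_mull.
have [Eq'|Eq'] : (q = 6 \/ q = 10)%N by move: q6 q12 Eq oq; clear; lia.
  rewrite Eq' in ad dq n_pq n_qr *; apply: good_perm23.
  have p18' : p <> 18 by move=> E; exact: (n_pq 18 6 isT).
  have r9' : r <> 9 by move=> E; exact: (n_qr 6 9 isT).
  rewrite EN in dp dq dr; have [L3|L3] := boolP (3 %| L')%N.
    exact: (good_110_pair_6_27 dp dr dq).
  apply: (good_110_pair_6_9 dp dr dq) => //.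
  have a3 : ~~ (3 %| a)%N.
    apply: contra L3 => a3; have -> : L' = (a * A)%N by move: Ep9; rewrite Ea; clear; nia.
    by rewrite dvdn_mulr.
  have c3 : ~~ (3 %| c)%N.
    apply: contra L3 => c3; have -> : L' = (c * C)%N by move: Er9; rewrite Ec; clear; nia.
    by rewrite dvdn_mulr.
  (* [a] and [c] are odd and prime to 3; [p <> 18] gives [a >= 5], and [r] different from 9 and 45
     gives [c >= 7]. *)
  apply: (@inv_sum2_le _ _ 90 63); last rlra.
    by move: p18' op a3; rewrite Ep Ea; clear; lia.
  have r45 : r <> 45 by move=> E; exact: (n_qr 6 45 isT).
  by move: r9' r45 or c3; rewrite Er Ec; clear; lia.
rewrite Eq' in ad dq n_pq n_qr *; apply: good_perm23.
have p18' : p <> 18 by move=> E; exact: (n_pq 18 10 isT).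
have r9' : r <> 9 by move=> E; exact: (n_qr 10 9 isT).
apply: (good_110_pair_10 dp dr dq) => //; first by rewrite EL dvdn_mull.
apply: (@inv_sum2_le _ _ 54 27); last rlra; first exact: p18.
exact: r9.
Qed.

(** The sign is dictated by divisibility of [A - sg * B] by 3, so the parity of half the other
    combination cannot be chosen; odd parity costs the stronger bound 2/9. *)
Lemma good_of_two3 p q r A B C W : admissible p q r ->
  dec p 1 A (3 * W) -> dec q 1 B (3 * W) -> dec r 0 C (3 * W) -> ~~ (3 %| W)%N ->
  ~~ (3 %| A)%N -> ~~ (3 %| B)%N -> (3 %| C)%N -> (5 <= r)%N ->
  inv p + inv q + inv r <= 1/3 -> good p q r.
Proof.
move=> ad dp dq dr W3 A3 B3 C3 r5 H.
apply: (good_unless_exceptional ad) => n_pq n_pr n_qr.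
have [p' op Ep] := dec_form dp; have [q' oq Eq] := dec_form dq; have [r' or Er] := dec_form dr.
have [_ oA _ pA] := dp; have [_ oB _ qB] := dq; have [_ _ _ rC] := dr.
rewrite expn1 in Ep Eq; rewrite expn0 mul1n in Er.
have [sg [m [Hsg Em S3]]] := sign_sum3 A3 B3.
have [n En] : exists n, A%:Z + sg * B%:Z = 2 * n.
  by exists ((A%:Z + sg * B%:Z) %/ 2)%Z; case: Hsg => ->; move: oA oB; clear; lia.
have n3 : ~~ (3 %| n)%Z by move: S3; rewrite En; clear; lia.
have [n2|n2] := boolP (2 %| n)%Z.
  exact: (good_110_two3_even dp dq dr W3 C3 Hsg En Em n3 n2 H).
apply: (good_110_two3_odd dp dq dr W3 C3 Hsg En Em n3 n2).
have six x' D : odd x' -> (2 * x' * D = 2 ^ 1 * (3 * W))%N -> ~~ (3 %| D)%N ->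
    exists a, [/\ x' = (3 * a)%N, odd a & ~~ (3 %| a)%N].
  move=> ox xD D3; have E : (x' * D = 3 * W)%N by move: xD; clear; nia.
  have : (3 %| x' * D)%N by rewrite E dvdn_mulr.
  rewrite Euclid_dvdM // (negbTE D3) orbF => /dvdnP[a Ea]; exists a; split; first by rewrite Ea mulnC.
    by move: ox; rewrite Ea oddM => /andP[].
  apply: contra W3 => a3; have -> : W = (a * D)%N by move: E; rewrite Ea; clear; nia.
  by rewrite dvdn_mulr.
have [a [Ea oa a3]] : exists a, [/\ p' = (3 * a)%N, odd a & ~~ (3 %| a)%N].
  by apply: (six _ A) => //; rewrite -Ep.
have [b [Eb ob b3]] : exists a, [/\ q' = (3 * a)%N, odd a & ~~ (3 %| a)%N].
  by apply: (six _ B) => //; rewrite -Eq.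
have r3 : ~~ (3 %| r)%N.
  have [C' EC] := dvdnP C3; apply: contra W3 => r3.
  have -> : W = (r * C')%N by move: rC; rewrite EC; clear; nia.
  by rewrite dvdn_mulr.
have {}Ep : p = (6 * a)%N by rewrite Ep Ea; ring.
have {}Eq : q = (6 * b)%N by rewrite Eq Eb; ring.
have or2 : odd r by rewrite Er.
(* The table pairs 6 with all numbers prime to 6 from 5 to 31; the next one is 35, and
   [1/6 + 1/42 + 1/35] is below 2/9. *)
have r35 : (forall x, exceptional 6 x -> r <> x) -> (35 <= r)%N.
  move=> nx; have [h1 h2 h3 h4] := And4 (nx 5 isT) (nx 7 isT) (nx 11 isT) (nx 13 isT).
  have [h5 h6 h7 h8] := And4 (nx 17 isT) (nx 19 isT) (nx 23 isT) (nx 25 isT).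
  have [h9 h10] := conj (nx 29 isT) (nx 31 isT).
  by move: r5 or2 r3 h1 h2 h3 h4 h5 h6 h7 h8 h9 h10; clear; lia.
have [P|P] := eqVneq p 6.
  apply: (@inv_sum_le _ _ _ 6 42 35); last rlra; first by rewrite P.
    by have := n_pq 6 6 isT; have := n_pq 6 30 isT; move: P Eq ob b3; clear; lia.
  by apply: r35 => x Ex Erx; exact: (n_pr 6 x Ex).
have [Q|Q] := eqVneq q 6.
  apply: (@inv_sum_le _ _ _ 42 6 35); last rlra; last first.
  - by apply: r35 => x Ex Erx; exact: (n_qr 6 x Ex).
  - by rewrite Q.
  by have := n_pq 30 6 isT; move: P Q Ep oa a3; clear; lia.
have p30 : (30 <= p)%N by move: P Ep oa a3; clear; lia.
have q30 : (30 <= q)%N by move: Q Eq ob b3; clear; lia.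
have [r5'|r5'] := eqVneq r 5.
  have big x y : (x = 6 * y)%N -> odd y -> ~~ (3 %| y)%N -> (30 <= x)%N ->
      (forall z, exceptional z 5 -> ~ (x = z /\ r = 5)) -> (102 <= x)%N.
    move=> Ex oy y3 x30 nx; have := nx 30 isT; have := nx 42 isT; have := nx 66 isT; have := nx 78 isT.
    by move: Ex oy y3 x30 r5'; clear; lia.
  apply: (@inv_sum_le _ _ _ 102 102 5); last rlra; last by rewrite r5'.
    exact: (big _ _ Ep oa a3 p30 (fun z => n_pr z 5)).
  exact: (big _ _ Eq ob b3 q30 (fun z => n_qr z 5)).
apply: (@inv_sum_le _ _ _ 30 30 7) => //; last rlra.
by move: r5 r5' or2; clear; lia.
Qed.

Lemma inv_sum_lt1 p q r : (0 < p)%N -> (0 < q)%N -> (0 < r)%N ->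
  (inv p + inv q + inv r < 1) = (q * r + p * r + p * q < p * q * r)%N.
Proof.
move=> p0 q0 r0; have E x : (0 < x)%N -> x%:R != 0 :> R by rewrite pnatr_eq0 -lt0n.
have -> : inv p + inv q + inv r = (q * r + p * r + p * q)%:R / (p * q * r)%:R.
  by rewrite !natrD !natrM; field; rewrite !E.
by rewrite ltr_pdivrMr ?mul1r ?ltr_nat // ltr0n !muln_gt0 p0 q0.
Qed.

Lemma admissible_inv p q r : admissible p q r -> inv p + inv q + inv r < 1.
Proof. by case/and5P=> p0 q0 r0 hyp _; rewrite inv_sum_lt1. Qed.

Lemma good_of_110 p q r A B C N : admissible p q r ->
  dec p 1 A N -> dec q 1 B N -> dec r 0 C N -> (3 %| N)%N ->
  ~~ [&& 3 %| A, 3 %| B & 3 %| C]%N -> good p q r.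
Proof.
move=> ad dp dq dr N3 ABC; have [p1 q1 r1] := admissible_ge2 ad.
have Sig := admissible_inv ad.
apply: (good_unless_exceptional ad) => n_pq n_pr n_qr.
have [p' op Ep] := dec_form dp; have [q' oq Eq] := dec_form dq; have [r' or Er] := dec_form dr.
rewrite expn1 in Ep Eq; rewrite expn0 mul1n in Er.
have [p2|p2] := eqVneq p 2.
  by rewrite p2 in dp Sig *; apply: (good_110_2 dp dq dr); rlra.
have [q2|q2] := eqVneq q 2.
  by rewrite q2 in dq Sig *; apply: good_perm12; apply: (good_110_2 dq dp dr); rlra.
have p6 : (6 <= p)%N by move: p1 p2 Ep op; clear; lia.
have q6 : (6 <= q)%N by move: q1 q2 Eq oq; clear; lia.
have [r3|r3] := eqVneq r 3.
  rewrite r3 in dr n_pr n_qr *; apply: (good_110_3 dp dq dr).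
  apply: (@inv_sum2_le _ _ 14 14); last rlra.
    by have := n_pr 6 3 isT; have := n_pr 10 3 isT; move: p6 Ep op; clear; lia.
  by have := n_qr 6 3 isT; have := n_qr 10 3 isT; move: q6 Eq oq; clear; lia.
have r5 : (5 <= r)%N by move: r1 r3 Er or; clear; lia.
have or2 : odd r by rewrite Er.
have S3 : inv p + inv q + inv r <= 1/3.
  have [P|P] := eqVneq p 6.
    apply: (@inv_sum_le _ _ _ 6 18 9); last rlra; first by rewrite P.
      have := n_pq 6 6 isT; have := n_pq 6 10 isT; have := n_pq 6 14 isT.
      by move: P q6 Eq oq; clear; lia.
    by have := n_pr 6 5 isT; have := n_pr 6 7 isT; move: P r5 or2; clear; lia.
  have p10 : (10 <= p)%N by move: P p6 Ep op; clear; lia.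
  have [Q|Q] := eqVneq q 6.
    apply: (@inv_sum_le _ _ _ 18 6 9); last rlra; last first.
    - by have := n_qr 6 5 isT; have := n_qr 6 7 isT; move: Q r5 or2; clear; lia.
    - by rewrite Q.
    by have := n_pq 10 6 isT; have := n_pq 14 6 isT; move: Q p10 Ep op; clear; lia.
  have q10 : (10 <= q)%N by move: Q q6 Eq oq; clear; lia.
  have [r9|r9] := leqP 9 r; first by apply: (@inv_sum_le _ _ _ 10 10 9) => //; rlra.
  have [r57|r57] : (r = 5 \/ r = 7)%N by move: r5 r9 or2; clear; lia.
    apply: (@inv_sum_le _ _ _ 18 18 5); last rlra; last by rewrite r57.
      by have := n_pr 10 5 isT; have := n_pr 14 5 isT; move: r57 p10 Ep op; clear; lia.
    by have := n_qr 10 5 isT; have := n_qr 14 5 isT; move: r57 q10 Eq oq; clear; lia.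
  apply: (@inv_sum_le _ _ _ 14 14 7); last rlra; last by rewrite r57.
    by have := n_pr 10 7 isT; move: r57 p10 Ep op; clear; lia.
  by have := n_qr 10 7 isT; move: r57 q10 Eq oq; clear; lia.
have S3' : inv q + inv p + inv r <= 1/3 by move: S3; rlra.
have ad12 := admissible_perm12 ad.
have /dvdnP[L EN] := N3; rewrite mulnC in EN; rewrite {N N3}EN in dp dq dr.
have [p0 _ _ pA] := dp; have [q0 _ _ qB] := dq; have [r0 _ _ rC] := dr.
have pA' : (p * A = 3 * (2 * L))%N by rewrite pA; ring.
have qB' : (q * B = 3 * (2 * L))%N by rewrite qB; ring.
have rC' : (r * (2 * C) = 3 * (2 * L))%N by rewrite mulnCA rC; ring.
have C3' : (3 %| 2 * C)%N = (3 %| C)%N by rewrite Euclid_dvdM.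
have third x D : (x * D = 3 * (2 * L))%N -> (3 %| D)%N -> exists D', (x * D' = 2 * L)%N.
  by move=> xD /dvdnP[D' ED]; exists D'; move: xD; rewrite ED; clear; nia.
(* A cofactor prime to 3 means that its number carries the full power of 3 of [3 * L]. The cases are
   the nonempty sets of such numbers, each split according to whether 9 divides [3 * L]. *)
move: ABC; case: (boolP (3 %| A)%N) => A3; case: (boolP (3 %| B)%N) => B3;
  case: (boolP (3 %| C)%N) => C3 // _; case: (boolP (3 %| L)%N) => L3.
- exact: (good_110_top_odd dp dq dr L3 A3 B3 C3 S3).
- have [A' pA''] := third _ _ pA' A3; have [B' qB''] := third _ _ qB' B3.
  by apply: (good_single3 p0 q0 r0 pA'' qB'' rC'); rewrite ?C3' // Euclid_dvdM.
- exact: good_perm12 (good_110_top_even dq dp dr L3 B3 A3 C3 S3').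
- have [A' pA''] := third _ _ pA' A3; have [C' rC''] : exists C', (r * C' = 2 * L)%N by apply: third rC' _; rewrite C3'.
  apply: good_perm23; apply: (good_single3 p0 r0 q0 pA'' rC'' qB'); rewrite ?Euclid_dvdM //.
  by move: S3; rlra.
- apply: good_perm12; apply: (good_of_pair_mixed ad12 dq dp dr) => //.
- apply: good_perm12; apply: good_perm23.
  by apply: (good_of_mixed (admissible_perm23 ad12) dq dr dp).
- exact: (good_110_top_even dp dq dr L3 A3 B3 C3 S3).
- have [B' qB''] := third _ _ qB' B3; have [C' rC''] : exists C', (r * C' = 2 * L)%N by apply: third rC' _; rewrite C3'.
  apply: good_perm12; apply: good_perm23; apply: (good_single3 q0 r0 p0 qB'' rC'' pA'); rewrite ?Euclid_dvdM //.
  by move: S3; rlra.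
- exact: (good_of_pair_mixed ad dp dq dr).
- by apply: good_perm23; apply: (good_of_mixed (admissible_perm23 ad) dp dr dq).
- by apply: (good_110_pair_even dp dq dr) => //; exact: leq_trans r5.
- exact: (good_of_two3 ad dp dq dr).
- by apply: (good_equal3 p0 q0 r0 pA' qB' rC') => //; rewrite C3'.
- by apply: (good_equal3 p0 q0 r0 pA' qB' rC') => //; rewrite C3'.
Qed.

(** [N] is the least common multiple of the odd parts: if 3 divided all three cofactors, [N / 3]
    would be a smaller common multiple. *)
Lemma exists_dec p q r : (0 < p)%N -> (0 < q)%N -> (0 < r)%N -> exists N A B C,
  [/\ dec p (logn 2 p) A N, dec q (logn 2 q) B N, dec r (logn 2 r) C N &
   ~~ [&& 3 %| A, 3 %| B & 3 %| C]%N].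
Proof.
move=> p0 q0 r0; pose o (x : nat) := (x`_2^')%N.
have oo x : (0 < x)%N -> odd (o x).
  by move=> x0; rewrite -coprime2n; exact: (pnat_coprime (pnat_id (isT : prime 2)) (part_pnat _ _)).
have Eo x : (0 < x)%N -> (2 ^ logn 2 x * o x = x)%N.
  by move=> x0; rewrite -p_part; exact: partnC.
pose N := lcmn (o p) (lcmn (o q) (o r)).
have pN : (o p %| N)%N by exact: dvdn_lcml.
have qN : (o q %| N)%N by apply: dvdn_trans (dvdn_lcmr _ _); exact: dvdn_lcml.
have rN : (o r %| N)%N by apply: dvdn_trans (dvdn_lcmr _ _); exact: dvdn_lcmr.
have oN : odd N.
  have : (N %| o p * (o q * o r))%N.
    rewrite !dvdn_lcm; apply/and3P; split; first exact: dvdn_mulr.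
      by apply: dvdn_mull; exact: dvdn_mulr.
    by apply: dvdn_mull; exact: dvdn_mull.
  by move/dvdn_odd; apply; rewrite !oddM !oo.
have main x : (0 < x)%N -> (o x %| N)%N -> dec x (logn 2 x) (N %/ o x) N.
  move=> x0 xN; split=> //; first by apply: dvdn_odd oN; apply/dvdnP; exists (o x); rewrite mulnC divnK.
  by rewrite -{1}(Eo x x0) -mulnA (mulnC (o x)) divnK.
exists N, (N %/ o p)%N, (N %/ o q)%N, (N %/ o r)%N; split; try exact: main.
apply/negP=> /and3P[/dvdnP[A EA] /dvdnP[B EB] /dvdnP[C EC]].
have N0 : (0 < N)%N by case: (N) oN.
have third x D : (o x %| N)%N -> (N %/ o x = D * 3)%N -> (o x %| N %/ 3)%N.
  move=> xN ED; apply/dvdnP; exists D; rewrite -[in LHS](divnK xN) ED.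
  by rewrite mulnAC mulnK.
have : (N %| N %/ 3)%N by rewrite {1}/N !dvdn_lcm (third _ _ pN EA) (third _ _ qN EB) (third _ _ rN EC).
have N3 : (0 < N %/ 3)%N.
  have : (3 %| N)%N by rewrite -(divnK pN) EA -mulnA mulnCA dvdn_mulr.
  by move: N0; clear; lia.
by move/(dvdn_leq N3); move: N0; clear; lia.
Qed.

Lemma good_sorted p q r : admissible p q r -> (logn 2 r <= logn 2 q <= logn 2 p)%N -> good p q r.
Proof.
move=> ad lpqr; have [p0 q0 r0 _ _] := and5P ad.
have Sig := admissible_inv ad.
have [N [A [B [C [dp dq dr ABC]]]]] := exists_dec p0 q0 r0.
case: (boolP (coprime 3 (p * q * r))) => c3.
  by apply: good_coprime3 => //; exact: ltW.
have N3 : (3 %| N)%N.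
  have three x e D : dec x e D N -> (3 %| x)%N -> (3 %| N)%N.
    case=> _ _ _ xD x3; have : (3 %| 2 ^ e * N)%N by rewrite -xD dvdn_mulr.
    by rewrite Gauss_dvdr // coprimeXr.
  move: c3; rewrite prime_coprime // negbK !Euclid_dvdM //.
  by case/orP=> [/orP[/(three _ _ _ dp)|/(three _ _ _ dq)]|/(three _ _ _ dr)].
move: lpqr dp dq dr.
move: (logn 2 p) (logn 2 q) (logn 2 r) => e1 e2 e3 /andP[l32 l21] dp dq dr.
have [E12|n12] := eqVneq e1 e2; last first.
  by apply: (good_of_flip ad dp dq dr); rewrite l32 ltn_neqAle eq_sym n12.
subst e2; have [E13|n13] := eqVneq e1 e3.
  subst e3; case: e1 {l32 l21} dp dq dr => [|e1] dp dq dr.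
    by apply: (good_odd dp dq dr); exact: ltW.
  exact: (good_of_equal ad dp dq dr).
have l31 : (e3 < e1)%N by rewrite ltn_neqAle eq_sym n13.
case: e1 {l32 l21 n13} dp dq l31 => [|[|e1]] // dp dq l31.
  case: e3 dr l31 => // dr _.
  exact: (good_of_110 ad dp dq dr N3 ABC).
exact: (good_of_tie ad dp dq dr l31).
Qed.

Lemma admissible_good p q r : admissible p q r -> good p q r.
Proof.
move=> ad.
have s23 p' q' r' : admissible p' q' r' -> (logn 2 q' <= logn 2 p')%N -> (logn 2 r' <= logn 2 p')%N ->
    good p' q' r'.
  move=> ad' lq lr; have [l|/ltnW l] := leqP (logn 2 r') (logn 2 q').
    by apply: good_sorted => //; rewrite l.
  by apply: good_perm23; apply: good_sorted; [exact: admissible_perm23 | rewrite l].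
have [lqp|/ltnW lpq] := leqP (logn 2 q) (logn 2 p).
  have [lrp|/ltnW lpr] := leqP (logn 2 r) (logn 2 p); first exact: s23.
  apply: good_perm23; apply: good_perm12; apply: s23 => //; last exact: leq_trans lpr.
  exact: admissible_perm12 (admissible_perm23 ad).
have [lrq|/ltnW lqr] := leqP (logn 2 r) (logn 2 q).
  by apply: good_perm12; apply: s23 => //; exact: admissible_perm12.
apply: good_perm23; apply: good_perm12; apply: s23 => //; last exact: leq_trans lqr.
exact: admissible_perm12 (admissible_perm23 ad).
Qed.

End Assembly.

End Lattice.

Theorem theorem1p5p4 (R : realType) (p q r : nat)
    (hp : (0 < p)%N) (hq : (0 < q)%N) (hr : (0 < r)%N)
    (hpqr : p%:R^-1 + q%:R^-1 + r%:R^-1 < 1 :> R)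
    (hH : ~~ in_hilbert_series p q r) :
  let n := lcmn 2 (lcmn p (lcmn q r)) in
  exists k : int, coprimez k n%:Z /\
    1 <= dist_Lambda (k%:~R / p%:R, k%:~R / q%:R, k%:~R / r%:R : R).
Proof.
move=> n; have ad : admissible p q r by apply/and5P; split=> //; rewrite -(inv_sum_lt1 (R := R)).
have [k [k2 kp kq kr H]] := admissible_good (R := R) ad; exists k; split.
  have kn : coprimez k (2 * (p * (q * r)))%N by rewrite !PoszM !coprimezMr k2 kp kq kr.
  apply: coprimez_dvdr kn; rewrite !dvdn_lcm; apply/and4P; split; first exact: dvdn_mulr.
  - by apply: dvdn_mull; exact: dvdn_mulr.
  - by apply: dvdn_mull; apply: dvdn_mull; exact: dvdn_mulr.
  - by apply: dvdn_mull; apply: dvdn_mull; exact: dvdn_mull.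
have [[w Lw ->] _] := dist_Lambda_min (k%:~R / p%:R, k%:~R / q%:R, k%:~R / r%:R : R).
exact: H.
Qed.
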